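(* For every compatible pair $(\mathscr{B},\mathscr{B}')$ of collections of integer bases $\mathscr{B},\mathscr{B}'\subseteq\mathbb N\setminus\{1\}$, there exists a Rajchman (Borel) probability measure $\mu=\mu[\mathscr{B},\mathscr{B}']$ on $[0,1)$ such that $\mu$-almost every point lies in $\mathscr N(\mathscr{B},\mathscr{B}')$. In particular, this is true for $\mathscr N(\emptyset,\mathbb N\setminus\{1\})$, the set of absolutely non-normal numbers.
   Context: $\mathbb N=\{1,2,3,\dots\}$. Normality: for an integer $b\ge 2$ and $x\in[0,1)$ write $x=\sum_{j\ge1}x_jb^{-j}$ with digits $x_j\in\{0,\dots,b-1\}$. The number $x$ is $b$-normal if for every $k\ge1$ and every $(d_1,\dots,d_k)\in\{0,\dots,b-1\}^k$, $\lim_{N\to\infty}\frac1N\#\{1\le n\le N:(x_n,\dots,x_{n+k-1})=(d_1,\dots,d_k)\}=b^{-k}$. A real number is $b$-normal if its fractional part is. Throughout $\mathscr B\cup\mathscr B'\neq\emptyset$. For non-empty collections, $\mathscr N(\mathscr B,\cdot)$ is the set of real $x$ that are $b$-normal for all $b\in\mathscr B$, $\mathscr N(\cdot,\mathscr B')$ is the set of real $x$ that are not $b'$-normal for any $b'\in\mathscr B'$. Conventions: $\mathscr N(\cdot,\emptyset):=\mathscr N(\mathbb N\setminus\{1\},\cdot)$ and $\mathscr N(\emptyset,\cdot):=\mathscr N(\cdot,\mathbb N\setminus\{1\})$. In all cases $\mathscr N(\mathscr B,\mathscr B'):=\mathscr N(\mathscr B,\cdot)\cap\mathscr N(\cdot,\mathscr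 B')$. Absolutely non-normal numbers are those not normal in any integer base $b\ge2$. For $r,s\in\mathbb N\setminus\{1\}$ write $r\sim s$ (multiplicatively dependent) if $r^m=s^n$ for some $m,n\in\mathbb N$, and $r\not\sim s$ otherwise. The pair $(\mathscr B,\mathscr B')$ is compatible if $b\not\sim b'$ for all $(b,b')\in\mathscr B\times\mathscr B'$; this is taken to be vacuously true if exactly one of $\mathscr B,\mathscr B'$ is empty. A measure $\mu$ on $[0,1)$ is Rajchman if $\widehat\mu(n):=\int_0^1e^{-2\pi i nx}\,d\mu(x)\to0$ as $|n|\to\infty$, $n\in\mathbb Z$. *)

(* Defs.v *)
From mathcomp Require Import all_boot all_order all_algebra.
From mathcomp Require Import all_classical all_reals all_analysis.
From mathcomp Require Import complex.
Set Implicit Arguments.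
Unset Strict Implicit.
Unset Printing Implicit Defensive.
Import Order.TTheory GRing.Theory Num.Theory.
Import numFieldNormedType.Exports.

Local Open Scope classical_set_scope.
Local Open Scope ring_scope.

Definition fracpart (R : realType) (x : R) : R := x - (Num.floor x)%:~R.

(* For 0 <= x < 1 and j >= 1 this is the j-th digit of the b-adic expansion of x
   that does not end in repeated digits b - 1; see [digit_expansion]. Choosing
   the other expansion at the b-adic rationals would not affect normality: both
   expansions of such a number are eventually constant. *)
Definition digit (R : realType) (b : nat) (x : R) (j : nat) : nat :=
  (Num.truncn (x * b%:R ^+ j) %% b)%N.

Definition occurs_at (R : realType) (b : nat) (x : R) (k : nat)
    (d : k.-tuple 'I_b) (n : nat) : bool :=
  [forall i : 'I_k, digit b x (n + i)%N == tnth d i :> nat].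

Definition occ_count (R : realType) (b : nat) (x : R) (k : nat)
    (d : k.-tuple 'I_b) (N : nat) : nat :=
  (\sum_(1 <= n < N.+1) occurs_at x d n)%N.

Definition normal01 (R : realType) (b : nat) (x : R) : Prop :=
  forall (k : nat) (d : k.-tuple 'I_b), (0 < k)%N ->
    ((occ_count x d N)%:R / N%:R : R) @[N --> \oo] --> (b%:R ^- k : R).

Definition normal (R : realType) (b : nat) (x : R) : Prop :=
  normal01 b (fracpart x).

Definition bases : set nat := [set b | (1 < b)%N].

Definition normal_in_all (R : realType) (B : set nat) : set R :=
  [set x | forall b, B b -> normal b x].

Definition nonnormal_in_all (R : realType) (B : set nat) : set R :=
  [set x | forall b, B b -> ~ normal b x].

(* A collection that is empty is not simply dropped: the set of numbers normal
   in the bases of the empty collection is, by convention, the set of absolutely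
   non-normal numbers, and symmetrically. *)
Definition normalL (R : realType) (B : set nat) : set R :=
  if B == set0 then nonnormal_in_all bases else normal_in_all B.

Definition normalR (R : realType) (B' : set nat) : set R :=
  if B' == set0 then normal_in_all bases else nonnormal_in_all B'.

Definition normal_set (R : realType) (B B' : set nat) : set R :=
  @normalL R B `&` @normalR R B'.

Arguments normal_set R B B' : clear implicits.

Definition mult_dependent (r s : nat) : Prop :=
  exists m n : nat, [/\ (0 < m)%N, (0 < n)%N & (r ^ m = s ^ n)%N].

Definition compatible (B B' : set nat) : Prop :=
  forall b b', B b -> B' b' -> ~ mult_dependent b b'.

Definition cis (R : realType) (t : R) : R[i] := (cos t +i* sin t)%C.

Definition Cintegral d (T : measurableType d) (R : realType)
    (mu : {measure set T -> \bar R}) (D : set T) (f : T -> R[i]) : R[i] :=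
  (Rintegral mu D (fun x => complex.Re (f x)) +i*
   Rintegral mu D (fun x => complex.Im (f x)))%C.

Definition fourier_coef (R : realType)
    (mu : {measure set (measurableTypeR R) -> \bar R}) (n : int) : R[i] :=
  Cintegral mu [set` `[0, 1[%R] (fun x : R => cis (- (2 * pi * n%:~R * x))).

Definition rajchman (R : realType)
    (mu : {measure set (measurableTypeR R) -> \bar R}) : Prop :=
  forall e : R, 0 < e -> exists M : nat, forall n : int,
    (M <= `|n|)%N -> ComplexField.Normc.normc (fourier_coef mu n) < e.

Lemma digit_partial_sum (R : realType) (b : nat) (x : R) (N : nat) :
  (1 < b)%N -> 0 <= x < 1 ->
  \sum_(1 <= j < N.+1) (digit b x j)%:R * b%:R ^- j
    = (Num.truncn (x * b%:R ^+ N))%:R * b%:R ^- N :> R.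
Proof.
move=> b1 /andP[x0 x1]; have b0 : (0 < b)%N by exact: ltnW.
have bR : 0 < b%:R :> R by rewrite ltr0n.
have bn0 n : b%:R ^+ n != 0 :> R by rewrite gt_eqF// exprn_gt0.
elim: N => [|N IH].
  rewrite big_geq// expr0 mulr1 invr1 mulr1.
  by have /eqP -> : Num.truncn x == 0%N by rewrite truncn_eq// x0 x1.
rewrite big_nat_recr//= IH /digit.
set t := Num.truncn (x * b%:R ^+ N.+1).
have t_ge : 0 <= x * b%:R ^+ N.+1 by rewrite mulr_ge0// exprn_ge0// ltW.
have /andP[t1 t2] := truncn_itv t_ge.
have -> : Num.truncn (x * b%:R ^+ N) = (t %/ b)%N.
  apply: truncn_def; apply/andP; split.
    rewrite -(ler_pM2r bR) -mulrA -exprSr -natrM.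
    by apply: le_trans t1; rewrite ler_nat leq_divM.
  rewrite -(ltr_pM2r bR) -mulrA -exprSr -natrM.
  by apply: (lt_le_trans t2); rewrite ler_nat; apply: ltn_ceil.
rewrite {3}(divn_eq t b) natrD natrM mulrDl; congr (_ + _).
by rewrite exprS invfM mulrA mulfK ?gt_eqF.
Qed.

Lemma digit_expansion (R : realType) (b : nat) (x : R) :
  (1 < b)%N -> 0 <= x < 1 ->
  (\sum_(1 <= j < N.+1) (digit b x j)%:R * b%:R ^- j : R) @[N --> \oo] --> x.
Proof.
move=> b1 x01; have bR : 0 < b%:R :> R by rewrite ltr0n; apply: ltnW.
have bN N : 0 < b%:R ^+ N :> R by exact: exprn_gt0.
have -> : (fun N : nat => \sum_(1 <= j < N.+1) (digit b x j)%:R * b%:R ^- j : R)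
  = (fun N => (Num.truncn (x * b%:R ^+ N))%:R * b%:R ^- N).
  by apply/funext => N; rewrite digit_partial_sum.
have /andP[x0 _] := x01.
apply: (@squeeze_cvgr _ _ _ _ (fun N => x - b%:R^-1 ^+ N) (fun=> x)).
- near=> N.
  have t_ge : 0 <= x * b%:R ^+ N by rewrite mulr_ge0// ltW.
  have /andP[t1 t2] := truncn_itv t_ge.
  rewrite ler_pdivrMr// t1 andbT ler_pdivlMr// mulrBl -exprMn mulVf ?gt_eqF//.
  by rewrite expr1n lerBlDr natr1 ltW.
- rewrite -[X in _ --> X]subr0; apply: cvgB; first exact: cvg_cst.
  by apply: cvg_expr; rewrite ger0_norm ?invr_ge0 ?ltW// invf_lt1// ltr1n.
- exact: cvg_cst.
Unshelve. all: by end_near.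
Qed.

Lemma normal_set_absolutely_non_normal (R : realType) :
  normal_set R set0 bases = [set x | forall b, (1 < b)%N -> ~ normal b x].
Proof.
rewrite /normal_set /normalL /normalR eqxx ifF ?setIid//.
by apply/negbTE/eqP => /seteqP[h _]; exact: (h 2%N).
Qed.

(* Main.v *)
(* The measure is the weak limit of measures [P_i dx] with [P_0 = 1], where
   [P_(i+1)] is [P_i] multiplied by an average of Riesz products
   [prod_(T <= j < 2T) (1 + cos (2 pi q^(2j) x))] over many far apart scales [T].
   The base [q] runs through [B'], each element being used at infinitely many
   stages. The spectra of the windows are disjoint, so that averaging over many
   of them makes all the new Fourier coefficients small: the limit is Rajchman.
   Under the window [T] the mean of [cos (2 pi q^n x)] is [1/2] for even [n] in
   [2T, 4T) and [0] for odd [n], and these cosines are nearly uncorrelated. Hence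
   almost surely, for infinitely many [T], the average of [cos (2 pi q^n x)] over
   [2T, 4T) is about [1/4], and Weyl's criterion excludes [q]-normality.
   If [b] is multiplicatively independent of [q], only [o(T^2)] pairs [(m, n)]
   make [h (b^m - b^n) - l] a sum of [+- q^(2j)] with distinct [j] in [T, 2T).
   Choosing [T] large, each stage therefore adds arbitrarily little to
   [sum_N N^-3 int |sum_(n < N) e(h b^n x)|^2], and since this sum stays bounded,
   [b]-normality follows as in the theorem of Davenport, Erdos and LeVeque. *)
From HB Require Import structures.
Require Import Defs.
From mathcomp Require Import all_boot all_order all_algebra.
From mathcomp Require Import all_classical all_reals all_analysis.
From mathcomp Require Import complex cyclic measurable_realfun.
From mathcomp Require Import zify ring lra.
Import Order.TTheory GRing.Theory Num.Theory.
Import numFieldNormedType.Exports.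
Set Implicit Arguments.
Unset Strict Implicit.
Unset Printing Implicit Defensive.

Local Open Scope classical_set_scope.
Local Open Scope ring_scope.

(** * Gaps between exponents *)

Section NumberTheory.
Local Open Scope nat_scope.

(** Why even powers [q^(2j)]: their ratio is at least 4, so the spectra of successive Riesz factors
    never overlap, even for [q = 2], and means under a window can be computed exactly. The same
    choice wins the counting: the lowest [g] digits of a signed sum leave [3^g] possibilities,
    whereas exponents of [b] sharing a possibility are of order [4^g] apart. All coefficients are
    nonnegative, so every control is an upper bound, and coefficients only grow from stage to stage.
    The obstacle is to let the work of a stage survive the later ones. The test for bias, multiplied
    by the density, is dominated by a cosine polynomial [W] of small mean; later factors only have
    frequencies above the degree of [W] and leave its mean unchanged. Averaging over windows means
    that a point can only be expected to be biased in one window of a stage, hence the minimum of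
    the tests of all windows. *)

Lemma sparse_count (s X : nat) (A : pred nat) : 0 < s ->
  (forall m n, m < n -> A m -> A n -> s <= n - m) ->
  (\sum_(0 <= n < X) A n) * s <= X + s.
Proof.
move=> s0 gap.
(* The second clause carries the induction: at the last element [z] of [A] below [Y] the sharper
   bound [z + s] holds, which leaves room for the next element. *)
suff H : forall Y, (\sum_(0 <= n < Y) A n) * s <= Y + s /\
   forall z, A z -> z < Y -> (\sum_(0 <= n < Y) A n) * s <= z + s \/ exists2 y, A y & z < y < Y.
  by case: (H X).
elim=> [|Y [IH1 IH2]]; first by rewrite big_geq.
rewrite big_nat_recr//=; case: (boolP (A Y)) => AY; last first.
  rewrite addn0; split; first by apply: leq_trans IH1 _; rewrite leq_add2r.
  move=> z Az; rewrite ltnS leq_eqVlt => /orP[/eqP zY|zY].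
    by rewrite -zY Az in AY.
  case: (IH2 z Az zY) => [|[y Ay /andP[y1 y2]]]; first by left.
  by right; exists y => //; rewrite y1 ltnW.
have E : (\sum_(0 <= n < Y) A n + 1) * s <= Y + s.
  case: (boolP (has A (iota 0 Y))) => hA; last first.
    have -> : \sum_(0 <= n < Y) A n = 0.
      rewrite big_nat; apply: big1 => n nY; apply/eqP; rewrite eqb0.
      by apply: contra hA => An; apply/hasP; exists n => //; rewrite mem_iota.
    by rewrite add0n mul1n leq_addl.
  have ex : exists n, A n && (n < Y).
    by case/hasP: hA => n; rewrite mem_iota => /andP[_ nY] An; exists n; rewrite An.
  have bd : forall n, A n && (n < Y) -> n <= Y by move=> n /andP[_ /ltnW].
  case: (ex_maxnP ex bd) => z /andP[Az zY] zmax.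
  case: (IH2 z Az zY) => [H|[y Ay /andP[y1 y2]]]; last first.
    by have := zmax y; rewrite Ay y2 leqNgt y1 => /(_ isT).
  have := gap z Y zY Az AY; lia.
split; first by lia.
move=> z Az; rewrite ltnS leq_eqVlt => /orP[/eqP ->|zY]; first by left.
by right; exists Y => //; rewrite zY /=.
Qed.

Lemma geom_sum_mod (m x k : nat) : x = 1 %[mod m] ->
  \sum_(i < k) x ^ i = k %[mod m].
Proof.
move=> x1; elim: k => [|k IH]; first by rewrite big_ord0.
rewrite big_ord_recr /= -modnDm IH -modnXm x1 modnXm exp1n modnDm addn1 //.
Qed.

(** Lifting the exponent: the cofactor of [x - 1] in [x^p - 1] is [p] modulo [p^2], hence has
    exactly one factor [p]. Asking for [p^2] instead of [p] covers [p = 2] as well. *)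
Lemma logn_geom_prime (p x : nat) : prime p -> 1 < x -> p ^ 2 %| x.-1 ->
  logn p (x ^ p).-1 = (logn p x.-1).+1.
Proof.
move=> pp x1 px.
have p1 := prime_gt1 pp.
rewrite predn_exp lognM; last 2 first.
- by rewrite -subn1 subn_gt0.
- rewrite -(prednK (prime_gt0 pp)) big_ord_recl expn0//.
rewrite -addn1; congr (_ + _).
have S : \sum_(i < p) x ^ i = p %[mod p ^ 2].
  by apply: geom_sum_mod; apply/eqP; rewrite eqn_mod_dvd ?subn1// ltnW.
set s := \sum_(i < p) _ in S *.
have ps : p %| s.
  rewrite /dvdn /s (@geom_sum_mod p x p) ?modnn//.
  apply/eqP; rewrite eqn_mod_dvd ?subn1; last by rewrite ltnW.
  by apply: dvdn_trans px; rewrite expnS dvdn_mulr.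
have s0 : 0 < s by rewrite /s -(prednK (prime_gt0 pp)) big_ord_recl expn0.
apply/eqP; rewrite eqn_leq; apply/andP; split; last first.
  by rewrite -pfactor_dvdn.
rewrite leqNgt -pfactor_dvdn//; apply/negP => h.
move: S; rewrite (eqP h) modn_small ?ltn_Pmulr ?prime_gt0//; lia.
Qed.

(** Write [d = p^r d'] by induction and [y = x^(p^r)]. The valuation of [y - 1] is known by lifting,
    and its cofactor in [y^d' - 1] is [d'] modulo [p], so a further factor [p] must divide [d']. *)
Lemma dvdn_pow_pred (p x r d : nat) : prime p -> 1 < x -> p ^ 2 %| x.-1 ->
  p ^ (logn p x.-1 + r) %| (x ^ d).-1 -> p ^ r %| d.
Proof.
move=> pp x1 px; elim: r => [|r IH] H; first by rewrite expn0 dvd1n.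
have /IH /dvdnP[d' dE] : p ^ (logn p x.-1 + r) %| (x ^ d).-1.
  by apply: dvdn_trans H; rewrite dvdn_exp2l// leq_add2l.
have [d0|d0] := posnP d'; first by rewrite dE d0 mul0n dvdn0.
have H2 : forall k, [/\ 1 < x ^ (p ^ k), p ^ 2 %| (x ^ (p ^ k)).-1 &
    logn p (x ^ (p ^ k)).-1 = logn p x.-1 + k].
  elim=> [|k [h1 h2 h3]]; first by rewrite expn0 expn1 addn0.
  rewrite expnS mulnC expnM; split.
  - by rewrite -(exp1n p) ltn_exp2r ?prime_gt0.
  - by rewrite predn_exp dvdn_mulr.
  - by rewrite logn_geom_prime// h3 addnS.
have [y1 y2 y3] := H2 r.
move: H; rewrite dE mulnC expnM; set y := x ^ _ in y1 y2 y3 *.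
have y0 : 0 < y.-1 by rewrite -subn1 subn_gt0.
have S0 : 0 < \sum_(i < d') y ^ i by rewrite -(prednK d0) big_ord_recl expn0.
rewrite predn_exp pfactor_dvdn ?muln_gt0 ?y0// lognM// y3 addnS.
rewrite -addn1 leq_add2l -pfactor_dvdn// expn1 => pS.
rewrite expnSr dvdn_pmul2l ?expn_gt0 ?prime_gt0//.
suff : \sum_(i < d') y ^ i = d' %[mod p].
  by move=> e; rewrite /dvdn -e; apply: pS.
apply: geom_sum_mod; apply/eqP; rewrite eqn_mod_dvd ?subn1; last by rewrite ltnW.
by apply: dvdn_trans y2; rewrite expnS dvdn_mulr.
Qed.

(** The order of [w] modulo [p^s] grows like [p^s]. The power [w^e] with [e = totient (p^2)]
    satisfies the congruence modulo [p^2] that lifting requires. *)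
Lemma order_mod_prime_power (p w : nat) : prime p -> coprime p w -> 1 < w ->
  exists C, forall d s, 0 < d -> p ^ s %| (w ^ d).-1 -> p ^ s <= C * d.
Proof.
move=> pp pw w1.
pose e := totient (p ^ 2).
have e0 : 0 < e by rewrite totient_gt0 expn_gt0 prime_gt0.
have x1 : 1 < w ^ e by rewrite -(exp1n e) ltn_exp2r.
have px : p ^ 2 %| (w ^ e).-1.
  rewrite -subn1 -eqn_mod_dvd ?expn_gt0 ?(ltnW w1)//; apply/eqP.
  by apply: Euler_exp_totient; rewrite coprime_sym coprimeXl.
exists (p ^ logn p (w ^ e).-1) => d s d0 H.
have {}H : p ^ s %| ((w ^ e) ^ d).-1.
  by rewrite -expnM mulnC expnM (predn_exp _ e) dvdn_mulr.
have [sl|sl] := leqP s (logn p (w ^ e).-1).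
  apply: leq_trans (leq_pmulr _ d0); rewrite leq_exp2l//; exact: prime_gt1.
move: H; rewrite -(subnKC (ltnW sl)) => H.
have := dvdn_pow_pred pp x1 px H => /dvdn_leq -/(_ d0).
by rewrite expnD leq_mul2l => ->; rewrite orbT.
Qed.


(** The parts coprime to [q] of two powers of [b] satisfy [w0^d = w^d0]. The congruence on [w]
    therefore bounds [d] through the order of the fixed [w0] modulo a power of [p = pdiv q], and
    [p^(2g) >= 4^g]. *)
Lemma coprime_part_gap (b q : nat) : 1 < b -> 1 < q -> ~ mult_dependent b q ->
  exists C, forall d k w g, 0 < d -> b ^ d = q ^ k * w -> coprime w q ->
    q ^ (2 * g) %| w.-1 -> 4 ^ g <= C * d.
Proof.
move=> b1 q1 ind.
case: (pselect (exists d k w, [/\ 0 < d, b ^ d = q ^ k * w & coprime w q])); last first.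
  by move=> h; exists 0 => d k w g d0 e cw; case: h; exists d, k, w.
case=> d0 [k0 [w0 [d00 e0 cw0]]].
have w01 : 1 < w0.
  have bd : 1 < b ^ d0 by rewrite -(exp1n d0) ltn_exp2r.
  case: w0 e0 cw0 => [|[|//]] e0 cw0; first by rewrite e0 muln0 in bd.
  (* Independence enters here: [w0 = 1] would make a power of [b] a power of [q]. *)
  exfalso; apply: ind; exists d0, k0; split => //; last by rewrite e0 muln1.
  by case: k0 e0 => // e0; rewrite e0 in bd.
have pp := pdiv_prime q1; set p := pdiv q in pp.
have pq : p %| q by exact: pdiv_dvd.
have cpw : coprime p w0 by apply: coprime_dvdl pq _; rewrite coprime_sym.
have [C HC] := order_mod_prime_power pp cpw w01.
exists C => d k w g d_gt0 e cw H.
have wd : w0 ^ d = w ^ d0.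
  have : q ^ (k0 * d) * w0 ^ d = q ^ (k * d0) * w ^ d0.
    by rewrite !expnM -!expnMn -e -e0 -!expnM mulnC.
  have c1 : coprime (w0 ^ d) q by rewrite coprimeXl.
  have c2 : coprime (w ^ d0) q by rewrite coprimeXl.
  have key k1 k2 x y : k1 < k2 -> coprime x q -> q ^ k1 * x <> q ^ k2 * y.
    move=> lt cx E.
    have : q ^ k1 * x = q ^ k1 * (q ^ (k2 - k1) * y).
      by rewrite mulnA -expnD subnKC// ltnW.
    move/eqP; rewrite eqn_pmul2l ?expn_gt0 ?(ltnW q1)// => /eqP xE.
    have : q %| x by rewrite xE dvdn_mulr// -[X in X %| _]expn1 dvdn_exp2l// subn_gt0.
    move/gcdn_idPr; move: cx; rewrite /coprime => /eqP -> E1; lia.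
  case: (ltngtP (k0 * d) (k * d0)) => lt E.
  - by case: (key _ _ _ _ lt c1 E).
  - by case: (key _ _ _ _ lt c2 (esym E)).
  - by move: E; rewrite lt => /eqP; rewrite eqn_pmul2l ?expn_gt0 ?(ltnW q1)// => /eqP.
have : p ^ (2 * g) %| (w0 ^ d).-1.
  rewrite wd predn_exp dvdn_mulr//; apply: dvdn_trans H; exact: dvdn_exp2r.
move/(HC d (2 * g) d_gt0); apply: leq_trans.
have [->|g0] := posnP g; first by rewrite !expn0.
by rewrite expnM leq_exp2r// -[4%N]/(2 ^ 2)%N leq_exp2r// prime_gt1.
Qed.

End NumberTheory.

(** * Signed sums of even powers of [q] *)

Section Representations.
Implicit Types (b q s t g n m d : nat) (x h l E : int).

(** These numbers contain all frequencies of the Riesz product whose factors have index in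
    [[s, t)]. *)
Definition rep q s t x := exists2 e : nat -> int,
  (forall i, (`|e i| <= 1)%N) & x = \sum_(s <= i < t) e i * q%:Z ^+ (2 * i).

(** Residue modulo [q^(2g)] read off the [g] lowest digits. The digits -1, 0, 1 are coded in ['I_3],
    so that there are [3^g] classes. *)
Definition digit_class q g (c : {ffun 'I_g -> 'I_3}) : int :=
  \sum_(j < g) ((c j)%:Z - 1) * q%:Z ^+ (2 * j).

Lemma rep_dvd q s t x : rep q s t x -> (q%:Z ^+ (2 * s) %| x)%Z.
Proof.
case=> e _ ->; rewrite big_nat; apply: rpred_sum => i /andP[si _].
by apply: dvdz_mull; apply: dvdz_exp2l; rewrite leq_mul2l.
Qed.

(** Because [q^2 >= 4], the sum of the lower powers stays below a third of the next one. This third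
    separates the translates of the spectrum of a Riesz product. *)
Lemma rep_bound q s t x : (1 < q)%N -> rep q s t x -> (3 * `|x| < q ^ (2 * t))%N.
Proof.
move=> q1 [e eb ->]; elim: t => [|t IH]; first by rewrite big_geq.
have [st|ts] := leqP s t; last first.
  by rewrite big_geq//= muln0 expn_gt0 (ltnW q1).
rewrite big_nat_recr//=.
have H : (`|(e t * q%:Z ^+ (2 * t))%R| <= q ^ (2 * t))%N.
  rewrite abszM abszX absz_nat; move: (eb t); nia.
have E : (q ^ (2 * t.+1) = q ^ 2 * q ^ (2 * t))%N by rewrite -expnD mulnS.
have q4 : (4 <= q ^ 2)%N by rewrite -[4%N]/(2 ^ 2)%N leq_exp2r.
rewrite E; set S := \sum_(_ <= _ < _) _ in IH *.
have : (4 * q ^ (2 * t) <= q ^ 2 * q ^ (2 * t))%N by rewrite leq_mul2r q4 orbT.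
move: IH H; set X := e t * _; set Y := (q ^ (2 * t))%N; set Z := (q ^ 2 * Y)%N.
lia.
Qed.

(** Factoring out the lowest nonzero digit leaves a factor [E] that is 1 or -1 modulo [q^2], hence
    coprime to [q], and that lies in one of [3^g] classes for every [g]. *)
Lemma rep_lowest q s t x : (1 < q)%N -> rep q s t x -> x != 0 ->
  exists i E, [/\ (s <= i)%N, x = q%:Z ^+ (2 * i) * E,
   (exists2 u : int, (`|u| = 1)%N & (q%:Z ^+ 2 %| E - u)%Z) &
    forall g, exists c : {ffun 'I_g -> 'I_3},
      (q%:Z ^+ (2 * g) %| E - digit_class q c)%Z].
Proof.
move=> q1 [e eb ->].
have [k] : exists k, (t <= s + k)%N by exists t; rewrite leq_addl.
elim: k s => [|k IH] s; first by rewrite addn0 => ts; rewrite big_geq// eqxx.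
have [ts|st] := leqP t s; first by move=> _; rewrite big_geq// eqxx.
rewrite addnS -addSn => tk.
case: (eqVneq (e s) 0) => [es|es].
  rewrite big_ltn// es mul0r add0r => /(IH _ tk)[i [E [si xE HE HC]]].
  by exists i, E; split => //; exact: ltnW.
(* Digits beyond [t] are set to 0, so that [g] may exceed the number of digits present. *)
move=> _; pose f j : int := if (s + j < t)%N then e (s + j)%N else 0.
pose dg n : int := \sum_(0 <= j < n) f j * q%:Z ^+ (2 * j).
have dgE n : (t - s <= n)%N -> dg n = dg (t - s)%N.
  move=> tn; rewrite /dg (@big_cat_nat _ _ _ (t - s)%N)//= [X in _ + X]big_nat.
  rewrite [X in _ + X]big1 ?addr0// => j /andP[jt _].
  by rewrite /f ltnNge -leq_subLR jt mul0r.
have dgM n m : (n <= m)%N -> (q%:Z ^+ (2 * n) %| dg m - dg n)%Z.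
  move=> nm; rewrite /dg (@big_cat_nat _ _ _ n)//= addrAC subrr add0r.
  rewrite big_nat; apply: rpred_sum => i /andP[si _].
  by apply: dvdz_mull; apply: dvdz_exp2l; rewrite leq_mul2l.
have fb j : (`|f j| <= 1)%N by rewrite /f; case: ifP.
exists s, (dg (t - s)%N); split => //.
- rewrite /dg -{1}(add0n s) -{1}(subnK (ltnW st)) big_addn addnK big_distrr/=.
  apply: eq_big_nat => i /andP[_ it].
  rewrite /f addnC ifT; last by rewrite -ltn_subRL.
  by rewrite mulnDr exprD; ring.
- exists (e s); first by have := eb s; lia.
  have := dgM 1%N (t - s)%N; rewrite muln1 => /(_ _).
  rewrite {2}/dg big_nat1 muln0 expr0 mulr1 /f addn0 st; apply.
  by rewrite subn_gt0.
- move=> g; exists [ffun j : 'I_g => inord `|(f j + 1)%R|%N].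
  have -> : digit_class q [ffun j : 'I_g => inord `|(f j + 1)%R|%N] = dg g.
    rewrite /digit_class /dg big_mkord; apply: eq_bigr => j _; rewrite ffunE.
    rewrite inordK; last by have := fb j; lia.
    by congr (_ * _); have := fb j; lia.
  by rewrite -(dgE (t - s + g)%N) ?leq_addr// dgM// leq_addl.
Qed.

End Representations.

(** * Exponents in a common residue class *)

Section GapOfClasses.
Implicit Types (b q s t g n m d : nat) (x h l E : int).

Lemma coprimez_class q u E : (1 < q)%N -> (`|u| = 1)%N -> (q%:Z ^+ 2 %| E - u)%Z ->
  coprimez E q%:Z.
Proof.
move=> q1 u1 qE.
have qE' : (q%:Z %| E - u)%Z by apply: dvdz_trans qE; rewrite expr2 dvdz_mulr.
case/dvdzP: qE' => z Ez.
have -> : E = z * q%:Z + u by rewrite -Ez subrK.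
rewrite coprimez_sym /coprimez gcdzMDl.
by rewrite /gcdz u1 gcdn1.
Qed.

(* Two exponents in the same class have a quotient of powers of [b] that is [1]
   modulo [q^(2 g)], up to a power of [q]. Lifting the exponent at a prime divisor of
   [q] then forces [n' - n] to be at least of order [4^g] ([coprime_part_gap]),
   whereas there are only [3^g] classes. *)
Lemma same_class_gap b q g h n n' d d' i i' E E' :
  (1 < q)%N -> (0 < g)%N -> h != 0 -> (n < n')%N ->
  h * b%:Z ^+ n * (b%:Z ^+ d - 1) = q%:Z ^+ (2 * i) * E ->
  h * b%:Z ^+ n' * (b%:Z ^+ d' - 1) = q%:Z ^+ (2 * i') * E' ->
  coprimez E q%:Z -> coprimez E' q%:Z ->
  (q%:Z ^+ (2 * g) %| E - E')%Z ->
  (q%:Z ^+ (2 * g) %| b%:Z ^+ d)%Z -> (q%:Z ^+ (2 * g) %| b%:Z ^+ d')%Z ->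
  exists k w, [/\ (b ^ (n' - n) = q ^ k * w)%N, coprime w q & (q ^ (2 * g) %| w.-1)%N].
Proof.
move=> q1 g0 h0 nn eq1 eq2 cE cE' EE bd bd'.
have qp : 0 < q%:Z :> int by rewrite ltz_nat ltnW.
have q0 : q%:Z != 0 by rewrite gt_eqF.
have cpB e : (q%:Z ^+ (2 * g) %| b%:Z ^+ e)%Z -> coprimez (b%:Z ^+ e - 1) q%:Z.
  move=> H; apply: (@coprimez_class q (-1)) => //; rewrite opprK subrK.
  by apply: dvdz_trans H; apply: dvdz_exp2l; rewrite leq_pmulr.
(* Eliminating [h] gives [b^(n' - n) * A * q^(2i) = q^(2i') * A'] with [A] and [A'] coprime to [q].
   Since [q^(2g)] divides [b^d] and [b^d'], these are [-E] and [-E'] modulo [q^(2g)], hence their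
   quotient [w] is 1. *)
pose A := E * (b%:Z ^+ d' - 1); pose A' := E' * (b%:Z ^+ d - 1).
have cA : coprimez A q%:Z by rewrite coprimezMl cE cpB.
have cA' : coprimez A' q%:Z by rewrite coprimezMl cE' cpB.
have main : b%:Z ^+ (n' - n) * A * q%:Z ^+ (2 * i) = q%:Z ^+ (2 * i') * A'.
  have hb : h * b%:Z ^+ n' = h * b%:Z ^+ n * b%:Z ^+ (n' - n).
    by rewrite -mulrA -exprD subnKC// ltnW.
  rewrite /A' mulrA -eq2 hb /A.
  transitivity (b%:Z ^+ (n' - n) * (b%:Z ^+ d' - 1) * (q%:Z ^+ (2 * i) * E)); first by ring.
  by rewrite -eq1; ring.
have ii : (i <= i')%N.
  rewrite leqNgt; apply/negP => lt.
  have : (q%:Z %| A')%Z.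
    have : q%:Z ^+ (2 * i') * A' = q%:Z ^+ (2 * i') *
       (b%:Z ^+ (n' - n) * A * q%:Z ^+ (2 * i - 2 * i')).
      rewrite -main -[in LHS](@subnK (2 * i') (2 * i)); last by rewrite leq_mul2l ltnW.
      by rewrite exprD; ring.
    move/mulfI => -> //; last by rewrite expf_neq0.
    apply: dvdz_mull; rewrite -[X in (X %| _)%Z]expr1; apply: dvdz_exp2l.
    by rewrite subn_gt0 ltn_mul2l.
  move=> qA; have : (q%:Z %| gcdz A' q%:Z)%Z by rewrite dvdz_gcd qA dvdzz.
  by rewrite (eqP cA') dvdz1 absz_nat => /eqP q1'; rewrite q1' in q1.
have {}main : b%:Z ^+ (n' - n) * A = q%:Z ^+ (2 * (i' - i)) * A'.
  apply: (@mulIf _ (q%:Z ^+ (2 * i))); first by rewrite expf_neq0.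
  by rewrite main mulnBr -[in LHS](@subnK (2 * i) (2 * i')) ?leq_mul2l// exprD; ring.
have /dvdzP[w wE] : (q%:Z ^+ (2 * (i' - i)) %| b%:Z ^+ (n' - n))%Z.
  rewrite -(@Gauss_dvdzl _ _ A); first by rewrite main dvdz_mulr.
  by rewrite coprimezXl// coprimez_sym.
have qn0 k : q%:Z ^+ k != 0 by rewrite expf_neq0.
have w0 : 0 <= w.
  rewrite -(@pmulr_lge0 _ (q%:Z ^+ (2 * (i' - i)))) -?wE ?exprn_ge0//.
  by rewrite exprn_gt0.
have wA : w * A = A'.
  apply: (mulfI (qn0 (2 * (i' - i))%N)); rewrite -main wE; ring.
exists (2 * (i' - i))%N, `|w|%N; split.
- have := congr1 absz wE; rewrite abszM !abszX !absz_nat => ->; by rewrite mulnC.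
- have : coprimez w q%:Z by move: cA'; rewrite -wA coprimezMl => /andP[].
  by rewrite /coprimez /gcdz absz_nat.
- have d1 : (q%:Z ^+ (2 * g) %| w - 1)%Z.
    rewrite -(@Gauss_dvdzl _ _ A); last by rewrite coprimezXl// coprimez_sym.
    have -> : (w - 1) * A = E' * b%:Z ^+ d - E * b%:Z ^+ d' + (E - E').
      rewrite mulrBl wA mul1r /A /A'; ring.
    by apply: rpredD; [apply: rpredB; apply: dvdz_mull|].
  clear -d1 w0; case: w w0 d1 => // -[|w'] _ //.
  by rewrite intS addrC addKr dvdzE abszX absz_nat.
Qed.

(** Only the smaller exponent [n] of a far apart pair is kept and the window is forgotten, so that
    one count serves all windows. The last clause makes [b^d - 1] equal to -1 modulo [q^(2g)]. *)
Definition bad_class b q h g (c : {ffun 'I_g -> 'I_3}) n :=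
  exists d i E, [/\ h * b%:Z ^+ n * (b%:Z ^+ d - 1) = q%:Z ^+ (2 * i) * E,
    coprimez E q%:Z, (q%:Z ^+ (2 * g) %| E - digit_class q c)%Z &
    (q%:Z ^+ (2 * g) %| b%:Z ^+ d)%Z].

Lemma bad_class_count b q h : (1 < b)%N -> (1 < q)%N -> ~ mult_dependent b q ->
  h != 0 -> exists C : nat, forall g (c : {ffun 'I_g -> 'I_3}) X, (0 < g)%N ->
    ((\sum_(0 <= n < X) `[< bad_class b q h c n >]) * 4 ^ g <= C * X + 4 ^ g)%N.
Proof.
move=> b1 q1 ind h0.
have [C HC] := coprime_part_gap b1 q1 ind.
exists C.+1 => g c X g0; set S := (\sum_(_ <= _ < _) _)%N.
have gap : forall m n, (m < n)%N -> bad_class b q h c m -> bad_class b q h c n ->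
    (4 ^ g <= C.+1 * (n - m))%N.
  move=> m n mn [d [i [E [e1 cE Ec bd]]]] [d' [i' [E' [e1' cE' Ec' bd']]]].
  have EE : (q%:Z ^+ (2 * g) %| E - E')%Z.
    have -> : E - E' = (E - digit_class q c) - (E' - digit_class q c) by ring.
    exact: rpredB.
  have [k [w [w1 w2 w3]]] := same_class_gap q1 g0 h0 mn e1 e1' cE cE' EE bd bd'.
  apply: leq_trans (HC _ _ _ _ _ w1 w2 w3) _; first by rewrite subn_gt0.
  by rewrite leq_mul2r leqnSn orbT.
(* The gap [4^g / (C + 1)], rounded up; the successor of [C] avoids a division by 0. *)
pose s := ((4 ^ g + C) %/ C.+1)%N.
have sC : (4 ^ g <= s * C.+1)%N.
  by have := divn_eq (4 ^ g + C) C.+1; have := ltn_pmod (4 ^ g + C) (ltn0Sn C); rewrite -/s; lia.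
have s0 : (0 < s)%N.
  by rewrite lt0n; apply/eqP => s0; move: sC; rewrite s0 mul0n leqNgt expn_gt0.
have : (S * s <= X + s)%N.
  apply: sparse_count => // m n mn /asboolP Bm /asboolP Bn.
  have := gap m n mn Bm Bn => H.
  by rewrite /s -ltnS ltn_divLR//; lia.
clearbody S s; case: S => [|S]; first by rewrite mul0n.
rewrite mulSn [(S.+1 * _)%N]mulSn addnC leq_add2r => H.
rewrite addnC leq_add2r; apply: leq_trans (leq_mul (leqnn S) sC) _.
by rewrite mulnA mulnC leq_mul2l H orbT.
Qed.

End GapOfClasses.

(** * Counting represented pairs *)

Section CountRepresented.
Implicit Types (b q s t g n m d : nat) (x h l E : int).

(** [l] stands for a frequency of the density of the previous stage. Zero is excluded: it comes from
    the constant term of the Riesz product and belongs to the old density. *)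
Definition represented_pair q T b h l m n : bool :=
  `[< h * (b%:Z ^+ m - b%:Z ^+ n) - l != 0 /\
      rep q T (2 * T) (h * (b%:Z ^+ m - b%:Z ^+ n) - l) >].

Definition pair_count (P : nat -> nat -> bool) N :=
  (\sum_(0 <= m < N) \sum_(0 <= n < N) P m n)%N.

Lemma sum_support (F : nat -> nat) X N : (forall m, (X <= m)%N -> F m = 0%N) ->
  (\sum_(0 <= m < N) F m <= \sum_(0 <= m < X) F m)%N.
Proof.
move=> F0; have [NX|XN] := leqP N X.
  by rewrite [leqRHS](@big_cat_nat _ _ _ N)//= leq_addr.
rewrite (@big_cat_nat _ _ _ X)//=; last exact: ltnW.
rewrite [X in (_ + X)%N]big_nat [X in (_ + X)%N]big1 ?addn0// => m /andP[Xm _].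
exact: F0.
Qed.

Lemma pair_count_support (P : nat -> nat -> bool) X N : (forall m n, P m n -> (m < X)%N && (n < X)%N) ->
  (pair_count P N <= pair_count P X)%N.
Proof.
move=> H; rewrite /pair_count; apply: (@leq_trans (\sum_(0 <= m < X) \sum_(0 <= n < N) P m n)%N).
  apply: (@sum_support (fun m => \sum_(0 <= n < N) P m n)%N) => m Xm.
  apply: big1 => n _; apply/eqP; rewrite eqb0; apply/negP => /H /andP[].
  by rewrite ltnNge Xm.
apply: leq_sum => m _; apply: (@sum_support (fun n => P m n : nat)) => n Xn.
by apply/eqP; rewrite eqb0; apply/negP => /H /andP[_]; rewrite ltnNge Xn.
Qed.

Lemma absz_dvd_le x (k : int) : x != 0 -> (k %| x)%Z -> (`|k| <= `|x|)%N.
Proof. by move=> x0; rewrite dvdzE; apply: dvdn_leq; rewrite lt0n absz_eq0. Qed.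

Lemma pow2_lower q T : (1 < q)%N -> (2 ^ (2 * T) <= q ^ (2 * T))%N.
Proof. by move=> q1; case: T => // T; rewrite leq_exp2r// muln_gt0. Qed.

Lemma pow2_upper b n : (b ^ n <= 2 ^ (b * n))%N.
Proof.
case: n => [|n]; first by rewrite muln0.
by rewrite expnM leq_exp2r// ltnW// ltn_expl.
Qed.

Lemma PoszX b n : (b ^ n)%N%:Z = b%:Z ^+ n.
Proof. by rewrite -!natz natrX. Qed.

Lemma absz_sub_le (a c M : nat) : (a <= M -> c <= M -> `|(a%:Z - c%:Z)%R| <= M)%N.
Proof. lia. Qed.

(** A nonzero multiple of [q^(2T)] is at least [4^T], which [h (b^m - b^n) - l] reaches only if an
    exponent is of order [T]. *)
Lemma represented_pair_lower q T b h l m n : (1 < q)%N -> (1 < b)%N ->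
  (`|h| + `|l| <= T)%N -> represented_pair q T b h l m n -> (T <= b * maxn m n)%N.
Proof.
move=> q1 b1 hT /asboolP[x0 /rep_dvd /(absz_dvd_le x0)]; rewrite abszX absz_nat => H.
have H2 : (`|(h * (b%:Z ^+ m - b%:Z ^+ n) - l)%R| <= `|h| * b ^ maxn m n + `|l|)%N.
  have : (`|(b%:Z ^+ m - b%:Z ^+ n)%R| <= b ^ maxn m n)%N.
    by rewrite -!PoszX absz_sub_le// leq_exp2l// ?leq_maxl ?leq_maxr.
  have : (`|(h * (b%:Z ^+ m - b%:Z ^+ n) - l)%R| <=
     `|(h * (b%:Z ^+ m - b%:Z ^+ n))%R| + `|l|)%N by lia.
  rewrite abszM => H1 H2; apply: leq_trans H1 _.
  by rewrite leq_add2r leq_mul2l H2 orbT.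
have hl : (`|h| * b ^ maxn m n + `|l| <= (`|h| + `|l|) * b ^ maxn m n)%N.
  by rewrite mulnDl leq_add2l leq_pmulr// expn_gt0 (ltnW b1).
have : (2 ^ (2 * T) <= 2 ^ (`|h| + `|l| + b * maxn m n))%N.
  apply: leq_trans (pow2_lower T q1) _; apply: leq_trans H _.
  apply: leq_trans H2 _; apply: leq_trans hl _.
  by rewrite expnD leq_mul// ?pow2_upper// ltnW// ltn_expl.
rewrite leq_exp2l//; move: (b * _)%N => B; lia.
Qed.

(** A represented number is below [q^(4T)], whereas [h (b^m - b^n)] is at least [2^(m - 1)] for
    [n < m]. The diagonal is excluded because [-l] is too small to be a nonzero multiple of
    [q^(2T)]. *)
Lemma represented_pair_upper q b h l : (1 < q)%N -> (1 < b)%N -> h != 0 ->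
  exists C T0 : nat, forall T m n, (T0 <= T)%N ->
    represented_pair q T b h l m n -> [&& m != n, (m < C * T)%N & (n < C * T)%N].
Proof.
move=> q1 b1 h0; exists (4 * q + 3)%N, (`|l| + 1)%N => T m n T0.
have main : forall m n h, h != 0 -> (n < m)%N ->
     rep q T (2 * T) (h * (b%:Z ^+ m - b%:Z ^+ n) - l) -> (m < (4 * q + 3) * T)%N.
  move=> {m n h0} {}m n {}h h0 nm /(rep_bound q1) H.
  have B : (2 ^ m.-1 <= `|(h * (b%:Z ^+ m - b%:Z ^+ n))%R|)%N.
    rewrite abszM; apply: (@leq_trans `|(b%:Z ^+ m - b%:Z ^+ n)%R|); last first.
      by rewrite leq_pmull// lt0n absz_eq0.
    case: m nm {H} => // m; rewrite ltnS => nm /=.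
    have bm : (2 ^ m <= b ^ m)%N by case: m {nm} => // m; rewrite leq_exp2r.
    apply: leq_trans bm _; rewrite -!PoszX.
    have : (b ^ n <= b ^ m)%N by rewrite leq_exp2l.
    rewrite expnS; move: (b ^ n)%N (b ^ m)%N => u v uv.
    have : (2 * v <= b * v)%N by rewrite leq_mul2r b1 orbT.
    by move: (b * v)%N => w; lia.
  have l2 : (`|l| < 2 ^ `|l|)%N by rewrite ltn_expl.
  have : (2 ^ m.-1 < 2 ^ (q * (2 * (2 * T)) + `|l| + 1))%N.
    apply: leq_ltn_trans B _.
    have := pow2_upper q (2 * (2 * T)).
    have l3 : (2 ^ `|l| <= 2 ^ (q * (2 * (2 * T)) + `|l|))%N by rewrite leq_exp2l// leq_addl.
    have l4 : (2 ^ (q * (2 * (2 * T))) <= 2 ^ (q * (2 * (2 * T)) + `|l|))%N.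
      by rewrite leq_exp2l// leq_addr.
    rewrite [X in (_ < X)%N]expnD expn1.
    move: H; set x := h * _; set y := (q ^ (_))%N.
    move: l2 l3 l4; set z := (2 ^ (_ + _))%N; set z1 := (2 ^ (q * _))%N; set z2 := (2 ^ `|l|)%N.
    lia.
  rewrite ltn_exp2l//.
  have -> : (q * (2 * (2 * T)) = 4 * q * T)%N by rewrite !mulnA (mulnC q 2) -(mulnA 2 q) (mulnC q 2) !mulnA.
  rewrite mulnDl; move: (4 * q * T)%N => Z; lia.
move=> /asboolP[x0 rx].
case: (ltngtP m n) => mn; last 1 first.
- move: x0 rx; rewrite mn subrr mulr0 sub0r => x0 /rep_dvd /(absz_dvd_le x0).
  rewrite abszX absz_nat abszN => H; exfalso.
  have lT : (`|l| <= T)%N by apply: leq_trans T0; rewrite leq_addr.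
  have := leq_trans (leq_trans (pow2_lower T q1) H) lT; apply/negP; rewrite -ltnNge.
  by apply: (leq_trans (@ltn_expl 2 T isT)); rewrite leq_exp2l// leq_pmull.
- have N0 : - h != 0 by rewrite oppr_eq0.
  have nC := main n m (- h) N0 mn.
  move: rx; rewrite -(opprB (b%:Z ^+ n)) mulrN -mulNr => /nC nC'.
  by rewrite nC' andbT (ltn_trans mn).
- have mC := main m n h h0 mn rx.
  by rewrite mC (ltn_trans mn).
Qed.

End CountRepresented.

Section PairCount.
Implicit Types (b q s t g n m d : nat) (x h l E : int).

Lemma exchange_pair_count (P : nat -> nat -> bool) N :
  pair_count P N = pair_count (fun m n => P n m) N.
Proof. by rewrite /pair_count exchange_big. Qed.

Lemma pair_count_rows (P : nat -> nat -> bool) X S :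
  (forall n, (\sum_(0 <= m < X) P m n <= S)%N) -> (pair_count P X <= X * S)%N.
Proof.
move=> H; rewrite exchange_pair_count /pair_count.
apply: (@leq_trans (\sum_(0 <= m < X) S)%N); first by apply: leq_sum => n _; exact: H.
by rewrite sum_nat_const_nat subn0.
Qed.

(* For a prime [p] dividing [q] but not [b], two exponents [m] with
   [p ^ (2T) %| h (b^m - b^n) - l] differ by at least [T / b], by size alone. *)
Lemma pair_count_foreign_prime q b h l p C T : (1 < q)%N -> (1 < b)%N -> h != 0 ->
  prime p -> (p %| q)%N -> coprime p b -> (b <= T)%N -> (`|h| <= T)%N ->
  (pair_count (represented_pair q T b h l) (C * T) <= C * T * (2 * b * C + 1))%N.
Proof.
move=> q1 b1 h0 pp pq pb bT hT.
apply: pair_count_rows => n.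
set A := fun m => represented_pair q T b h l m n.
have s0 : (0 < T %/ b)%N by rewrite divn_gt0// ltnW.
have : ((\sum_(0 <= m < C * T) A m) * (T %/ b) <= C * T + T %/ b)%N.
  apply: sparse_count => // m' m mm /asboolP[_ /rep_dvd d1] /asboolP[_ /rep_dvd d2].
  have {d1 d2} := rpredB d2 d1; rewrite -!/(_ %| _)%Z => H.
  have {}H : (p%:Z ^+ (2 * T) %| h * (b%:Z ^+ (m - m') - 1))%Z.
    have cop : coprimez (p%:Z ^+ (2 * T)) (b%:Z ^+ m').
      by rewrite coprimezXl// coprimezXr// /coprimez /gcdz !absz_nat.
    rewrite -(Gauss_dvdzl _ cop).
    have -> : h * (b%:Z ^+ (m - m') - 1) * b%:Z ^+ m' = h * (b%:Z ^+ m - b%:Z ^+ n) - l -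
         (h * (b%:Z ^+ m' - b%:Z ^+ n) - l).
      by rewrite -(subnK (ltnW mm)) exprD addnK; ring.
    apply: dvdz_trans H; rewrite dvdzE !abszX !absz_nat; exact: dvdn_exp2r.
  have d0 : (0 < m - m')%N by rewrite subn_gt0.
  have bd1 : (1 < b ^ (m - m'))%N by rewrite -(exp1n (m - m')) ltn_exp2r.
  have n0 : h * (b%:Z ^+ (m - m') - 1) != 0.
    by rewrite mulf_neq0// -PoszX subr_eq0 gt_eqF.
  have {H} := absz_dvd_le n0 H; rewrite abszX absz_nat abszM => H.
  have : (2 ^ (2 * T) <= 2 ^ (`|h| + b * (m - m')))%N.
    apply: leq_trans (pow2_lower T (prime_gt1 pp)) _; apply: leq_trans H _.
    rewrite expnD leq_mul//; first by rewrite ltnW// ltn_expl.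
    apply: leq_trans (pow2_upper b (m - m')).
    by rewrite -PoszX; move: (b ^ _)%N bd1 => z; clear; lia.
  rewrite leq_exp2l// => H2.
  have {H2} : (T <= b * (m - m'))%N.
    by move: H2 hT; move: (b * _)%N => Z; clear; lia.
  move=> H2; rewrite -ltnS ltn_divLR ?(ltnW b1)// mulSn mulnC.
  by apply: leq_ltn_trans H2 _; rewrite -[X in (X < _)%N]add0n ltn_add2r ltnW.
move: (\sum_(_ <= _ < _) _)%N => S HS.
have Ts : (T <= 2 * b * (T %/ b))%N.
  have := ltn_ceil T (ltnW b1); move: (T %/ b)%N s0 => s s0; nia.
rewrite -(leq_pmul2r s0); apply: leq_trans HS _.
rewrite mulnDl mul1n leq_add2r mulnAC mulnC leq_mul2r.
by rewrite Ts orbT.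
Qed.

(** If both exponents were large, [q^|l|] would divide [h (b^m - b^n)] as well as the represented
    number, hence also [l], which is too small. *)
Lemma represented_pair_offset q b h l k T m n : (1 < q)%N -> (q %| b ^ k)%N -> l != 0 ->
  (`|l| <= T)%N -> represented_pair q T b h l m n ->
  (n < k * `|l|)%N || (m < k * `|l|)%N.
Proof.
move=> q1 qb l0 lT /asboolP[_ /rep_dvd H]; rewrite -[_ || _]negbK negb_or -!leqNgt.
apply/negP => /andP[nl ml].
have big e : (k * `|l| <= e)%N -> (q%:Z ^+ `|l| %| b%:Z ^+ e)%Z.
  move=> ke; apply: (@dvdz_trans (b%:Z ^+ (k * `|l|))); last exact: dvdz_exp2l.
  by rewrite dvdzE !abszX !absz_nat (expnM b) dvdn_exp2r.
have {}H : (q%:Z ^+ `|l| %| h * (b%:Z ^+ m - b%:Z ^+ n) -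
    (h * (b%:Z ^+ m - b%:Z ^+ n) - l))%Z.
  have B1 := big _ nl; have B2 := big _ ml.
  apply: rpredB; first by apply: dvdz_mull; apply: rpredB.
  by apply: dvdz_trans H; apply: dvdz_exp2l; rewrite (leq_trans lT)// leq_pmull.
rewrite subKr in H.
have := absz_dvd_le l0 H; rewrite abszX absz_nat; apply/negP; rewrite -ltnNge.
exact: ltn_expl.
Qed.

(** Once [m - n] is large enough for [q^(2g)] to divide [b^(m - n)], the smaller exponent is bad for
    the class of the represented number stripped of its power of [q]. *)
Lemma represented_pair_bad q b h k g T m n : (1 < q)%N -> (q %| b ^ k)%N -> (0 < g)%N ->
  (n < m)%N -> represented_pair q T b h 0 m n ->
  (m < n + k * (2 * g))%N \/ exists c : {ffun 'I_g -> 'I_3}, bad_class b q h c n.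
Proof.
move=> q1 qb g0 nm /asboolP[]; rewrite subr0 => x0 rx.
have [|far] := ltnP m (n + k * (2 * g)); [by left | right].
have [i [E [_ xE [u u1 uE] Ec]]] := rep_lowest q1 rx x0.
have [c cE] := Ec g; exists c, (m - n)%N, i, E; split => //.
- by rewrite -xE -{2}(subnKC (ltnW nm)) exprD; ring.
- exact: coprimez_class uE.
- apply: (@dvdz_trans (b%:Z ^+ (k * (2 * g)))).
    by rewrite dvdzE !abszX !absz_nat (expnM b) dvdn_exp2r.
  by apply: dvdz_exp2l; rewrite leq_subRL// ltnW.
Qed.

Lemma represented_pairC q T b h l m n :
  represented_pair q T b h l m n = represented_pair q T b (- h) l n m.
Proof.
rewrite /represented_pair.
by have -> : h * (b%:Z ^+ m - b%:Z ^+ n) = - h * (b%:Z ^+ n - b%:Z ^+ m) by ring.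
Qed.

Lemma exp3_lt_exp4 K : exists2 g, (0 < g)%N & (K * 3 ^ g <= 4 ^ g)%N.
Proof.
(* Bernoulli's inequality for [(1 + 1/3)^g], cleared of fractions. *)
suff H g : ((g + 3) * 3 ^ g <= 3 * 4 ^ g)%N.
  exists (3 * K.+1)%N; first by rewrite muln_gt0.
  rewrite -(leq_pmul2l (ltn0Sn 2)); apply: leq_trans (H _); rewrite mulnA leq_mul2r.
  by apply/orP; right; lia.
elim: g => [|g IH]; first by [].
rewrite !expnS; move: (3 ^ g)%N (4 ^ g)%N IH => u v; nia.
Qed.

Lemma row_band D X n : (\sum_(0 <= m < X) ((n <= m) && (m < n + D))%N <= D)%N.
Proof.
have E : (\sum_(n <= m < n + D) 1 = D)%N by rewrite sum_nat_const_nat addKn muln1.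
apply: (@leq_trans (\sum_(n <= m < n + D) 1)%N); last by rewrite E.
have [Xn|nX] := leqP X n.
  rewrite big_nat big1// => m /andP[_ mX]; apply/eqP; rewrite eqb0 negb_and -ltnNge.
  by rewrite (leq_trans mX).
rewrite (@big_cat_nat _ _ _ n)//=; last exact: ltnW.
rewrite big_nat big1 ?add0n; last first.
  by move=> m /andP[_ mX]; apply/eqP; rewrite eqb0 negb_and -ltnNge mX.
have [XD|DX] := leqP X (n + D).
  rewrite [leqRHS](@big_cat_nat _ _ _ X)//=; last exact: ltnW.
  by apply: leq_trans (leq_addr _ _); apply: leq_sum => m _; exact: leq_b1.
rewrite (@big_cat_nat _ _ _ (n + D))//= ?leq_addr//; last exact: ltnW.
rewrite [X in (_ + X <= _)%N]big_nat [X in (_ + X <= _)%N]big1 ?addn0; last first.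
  by move=> m /andP[mX _]; apply/eqP; rewrite eqb0 negb_and -!leqNgt mX orbT.
by apply: leq_sum => m _; exact: leq_b1.
Qed.

(** Divided by [4^g], the bound has one quadratic term, [C1 (3/4)^g (C T)^2]; the band near the
    diagonal and the rounding terms of the classes are linear in [T]. *)
Lemma pair_count_lower_triangle q b h k g C1 C T : (1 < q)%N -> (q %| b ^ k)%N ->
  (0 < g)%N ->
  (forall (c : {ffun 'I_g -> 'I_3}) X,
    ((\sum_(0 <= n < X) `[< bad_class b q h c n >]) * 4 ^ g <= C1 * X + 4 ^ g)%N) ->
  (pair_count (fun m n => represented_pair q T b h 0 m n && (n < m)%N) (C * T) * 4 ^ g <=
    C * T * (k * (2 * g) * 4 ^ g + 3 ^ g * (C1 * (C * T) + 4 ^ g)))%N.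
Proof.
move=> q1 qb g0 HC; set X := (C * T)%N; set D := (k * (2 * g))%N.
pose Bad n := (\sum_(c : {ffun 'I_g -> 'I_3}) `[< bad_class b q h c n >])%N.
have step m n : ((represented_pair q T b h 0 m n && (n < m)) <=
    ((n <= m) && (m < n + D)) + Bad n)%N.
  case: (boolP (_ && _)) => // /andP[rp nm].
  case: (represented_pair_bad q1 qb g0 nm rp) => [H|[c cb]].
    by rewrite /D H (ltnW nm).
  by rewrite /Bad (bigD1 c)//= asboolT// addnCA leq_addr.
apply: (@leq_trans ((\sum_(0 <= m < X) \sum_(0 <= n < X)
   (((n <= m) && (m < n + D)) + Bad n)) * 4 ^ g)%N).
  by rewrite leq_mul2r; apply/orP; right; apply: leq_sum => m _; apply: leq_sum => n _; exact: step.
have -> : (\sum_(0 <= m < X) \sum_(0 <= n < X) (((n <= m) && (m < n + D)) + Bad n) =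
   \sum_(0 <= m < X) \sum_(0 <= n < X) (((n <= m) && (m < n + D)) : nat) +
   X * \sum_(0 <= n < X) Bad n)%N.
  rewrite -{5}(subn0 X) -sum_nat_const_nat -big_split/=; apply: eq_bigr => m _.
  by rewrite big_split.
rewrite mulnDl mulnDr leq_add//.
  rewrite mulnA leq_mul2r; apply/orP; right.
  exact: (@pair_count_rows (fun m n => (n <= m)%N && (m < n + D)%N) X D (row_band D X)).
rewrite -mulnA leq_mul2l; apply/orP; right.
rewrite /Bad exchange_big/= big_distrl/=.
apply: (@leq_trans (\sum_(c : {ffun 'I_g -> 'I_3}) (C1 * X + 4 ^ g))%N).
  by apply: leq_sum => c _; exact: HC.
by rewrite sum_nat_const card_ffun !card_ord.
Qed.

(** The free factor [K] expresses the [o(T^2)]. If some prime of [q] does not divide [b], or if [l]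
    is nonzero, the count is even linear in [T]; the classes modulo [q^(2g)] serve the remaining
    case. *)
Theorem represented_pair_count b q h l K : (1 < b)%N -> (1 < q)%N ->
  ~ mult_dependent b q -> h != 0 ->
  exists T0, forall T N, (T0 <= T)%N ->
    (K * pair_count (represented_pair q T b h l) N <= T ^ 2)%N.
Proof.
move=> b1 q1 ind h0.
have [C [T1 HT1]] := represented_pair_upper l q1 b1 h0.
suff [T0 HT0] : exists T0, forall T, (T0 <= T)%N ->
    (K * pair_count (represented_pair q T b h l) (C * T) <= T ^ 2)%N.
  exists (maxn T0 T1) => T N; rewrite geq_max => /andP[TT0 TT1].
  apply: leq_trans (HT0 T TT0); rewrite leq_mul2l; apply/orP; right.
  by apply: pair_count_support => m n /(HT1 T m n TT1) /and3P[_ -> ->].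
have lin A : exists T0, forall T, (T0 <= T)%N -> (A * T <= T ^ 2)%N.
  by exists A => T AT; rewrite expnS expn1 leq_mul2r AT orbT.
case: (boolP (all (fun p => p %| b)%N (primes q))) => [allb|]; last first.
  case/allPn => p; rewrite mem_primes => /and3P[pp _ pq] pb.
  have [T0 HT0] := lin (K * (C * (2 * b * C + 1)))%N.
  exists (maxn T0 (b + `|h|)) => T; rewrite geq_max => /andP[TT0 TT1].
  apply: leq_trans (HT0 T TT0).
  have cpb : coprime p b by rewrite prime_coprime.
  have bT : (b <= T)%N by apply: leq_trans TT1; rewrite leq_addr.
  have hT : (`|h| <= T)%N by apply: leq_trans TT1; rewrite leq_addl.
  have := pair_count_foreign_prime l C q1 b1 h0 pp pq cpb bT hT.
  move/(leq_mul (leqnn K))/leq_trans; apply.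
  by rewrite leq_eqVlt; apply/orP; left; apply/eqP; ring.
(* The exponent [q] suffices because the valuation of [q] at a prime is less than [q]. *)
have qb : (q %| b ^ q)%N.
  apply/dvdn_partP => [|p]; first exact: ltnW.
  rewrite inE/= => pq; rewrite p_part pfactor_dvdn ?expn_gt0 ?(ltnW b1)//; last first.
    by move: pq; rewrite mem_primes => /andP[].
  rewrite lognX.
  have pb : (0 < logn p b)%N.
    rewrite -pfactor_dvdn ?expn1 ?(ltnW b1)//; first exact: (allP allb).
    by move: pq; rewrite mem_primes => /andP[].
  by apply: leq_trans (leq_pmulr _ pb); rewrite ltnW// ltn_logl// ltnW.
case: (eqVneq l 0) => [l0|l0]; last first.
  have [T0 HT0] := lin (K * (C * (2 * (q * `|l|))))%N.
  exists (maxn T0 `|l|) => T; rewrite geq_max => /andP[TT0 TT1].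
  apply: leq_trans (HT0 T TT0).
  rewrite -!mulnA leq_mul2l; apply/orP; right.
  set W := (q * `|l|)%N.
  apply: (@leq_trans (\sum_(0 <= m < C * T) \sum_(0 <= n < C * T) ((n < W) + (m < W)))%N).
    apply: leq_sum => m _; apply: leq_sum => n _.
    case: (boolP (represented_pair _ _ _ _ _ _ _)) => //.
    by move/(represented_pair_offset q1 qb l0 TT1); do 2 case: (_ < _)%N.
  have W1 X : (\sum_(0 <= n < X) (n < W) <= W)%N.
    apply: leq_trans (row_band W X 0).
    by apply: leq_sum => m _; rewrite add0n.
  apply: (@leq_trans (\sum_(0 <= m < C * T) (W + C * T * (m < W)))%N).
    by apply: leq_sum => m _; rewrite big_split/= leq_add// sum_nat_const_nat subn0.
  rewrite big_split/= sum_nat_const_nat subn0.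
  have -> : (\sum_(0 <= m < C * T) C * T * (m < W) = C * T * \sum_(0 <= m < C * T) (m < W))%N.
    by rewrite big_distrr.
  have := leq_mul (leqnn (C * T)) (W1 (C * T)%N); move: (\sum_(_ <= _ < _) _)%N => S.
  move=> H; apply: leq_trans (leq_add (leqnn _) H) _.
  by rewrite /W leq_eqVlt; apply/orP; left; apply/eqP; ring.
rewrite l0 {l l0} in HT1 *.
have h'0 : - h != 0 by rewrite oppr_eq0.
have [C1 HC1] := bad_class_count b1 q1 ind h0.
have [C2 HC2] := bad_class_count b1 q1 ind h'0.
(* [g] brings the quadratic terms of both triangles down to half of the allowance; [T0] then does
   the same for the linear terms. *)
have [g g0 gK] := exp3_lt_exp4 (2 * K * C ^ 2 * (C1 + C2))%N.
have [T0 HT0] := lin (4 * K * C * (q * (2 * g) + 3 ^ g))%N.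
exists (maxn T0 T1) => T; rewrite geq_max => /andP[TT0 TT1].
have {HC1} A1 := pair_count_lower_triangle C T q1 qb g0 (fun c X => HC1 g c X g0).
have {HC2} A2 := pair_count_lower_triangle C T q1 qb g0 (fun c X => HC2 g c X g0).
have : (pair_count (represented_pair q T b h 0) (C * T) <=
  pair_count (fun m n => represented_pair q T b h 0 m n && (n < m)%N) (C * T) +
  pair_count (fun m n => represented_pair q T b (- h) 0 m n && (n < m)%N) (C * T))%N.
  rewrite [X in (_ + X)%N]exchange_pair_count /pair_count -big_split/=.
  apply: leq_sum => m _; rewrite -big_split/=; apply: leq_sum => n _.
  rewrite -represented_pairC; case: (boolP (represented_pair _ _ _ _ _ _ _)) => // rp.
  have /and3P[mn _ _] := HT1 T m n TT1 rp; rewrite neq_ltn in mn.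
  by case/orP: mn => ->; rewrite /= ?leq_addl ?leq_addr.
move: (pair_count _ _) (pair_count _ _) (pair_count _ _) A1 A2 => B B1 B2 A1 A2 HB.
have {}HB : (B <= B2 + B1)%N by rewrite addnC in HB *.
rewrite -(leq_pmul2l (ltn0Sn 1)) -(leq_pmul2r (expn_gt0 4 g : (0 < 4 ^ g)%N)).
have {}HB := leq_mul (leqnn (2 * K)) (leq_mul HB (leqnn (4 ^ g))).
rewrite mulnDl in HB.
have {}HB := leq_trans HB (leq_mul (leqnn (2 * K)) (leq_add A1 A2)).
have E1 := leq_mul (HT0 T TT0) (leqnn (4 ^ g)%N).
have E2 := leq_mul gK (leqnn (T ^ 2)%N).
have -> : (2 * (K * B) * 4 ^ g = 2 * K * (B * 4 ^ g))%N by ring.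
apply: leq_trans HB _.
have -> : (2 * T ^ 2 * 4 ^ g = T ^ 2 * 4 ^ g + 4 ^ g * T ^ 2)%N by ring.
apply: leq_trans (leq_add E1 E2).
by rewrite leq_eqVlt; apply/orP; left; apply/eqP; ring.
Qed.

Theorem represented_pair_vanish b q h l : (1 < b)%N -> (1 < q)%N ->
  exists T0, forall T N, (T0 <= T)%N -> (N * b < T)%N ->
    pair_count (represented_pair q T b h l) N = 0%N.
Proof.
move=> b1 q1; exists (`|h| + `|l|)%N => T N T0 NT.
rewrite /pair_count big_nat big1// => m /andP[_ mN].
rewrite big_nat big1// => n /andP[_ nN].
apply/eqP; rewrite eqb0; apply/negP => /(represented_pair_lower q1 b1 T0).
apply/negP; rewrite -ltnNge; apply: leq_ltn_trans NT; rewrite mulnC leq_mul2r.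
by rewrite geq_max (ltnW mN) (ltnW nN) orbT.
Qed.

End PairCount.

(** * Cosine polynomials *)

Section CosineLists.
Variable R : realType.
Implicit Types (s t : seq (R * int)) (x : R) (k : int).

(* A list of pairs (coefficient, frequency) stands for a cosine polynomial. *)
Definition cosp s x : R := \sum_(c <- s) c.1 * cos (2 * pi * c.2%:~R * x).

Definition cmul s t : seq (R * int) :=
  [seq (c.1 * d.1 / 2, c.2 + d.2) | c <- s, d <- t] ++
  [seq (c.1 * d.1 / 2, c.2 - d.2) | c <- s, d <- t].

Definition cscale (a : R) s : seq (R * int) := [seq (a * c.1, c.2) | c <- s].

(* The coefficient of [e^(2 i pi k x)]. *)
Definition fourier s k : R :=
  \sum_(c <- s) c.1 * (((c.2 == k)%:R + (c.2 == - k)%:R) / 2).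

(** The primitive vanishing at 0. Its increments replace integrals of cosine polynomials, and its
    value at 1 is the mean. *)
Definition anti s x : R :=
  \sum_(c <- s) c.1 *
    (if c.2 == 0 then x else sin (2 * pi * c.2%:~R * x) / (2 * pi * c.2%:~R)).

Definition l1norm s : R := \sum_(c <- s) `|c.1|.

Definition degree s : nat := \max_(c <- s) `|c.2|%N.

Definition nneg_coef s := all (fun c => 0 <= c.1) s.

Lemma cosp_cat s t x : cosp (s ++ t) x = cosp s x + cosp t x.
Proof. exact: big_cat. Qed.

Lemma cosp_cons c s x : cosp (c :: s) x = cosp [:: c] x + cosp s x.
Proof. by rewrite -cat1s cosp_cat. Qed.

Lemma fourier_cat s t k : fourier (s ++ t) k = fourier s k + fourier t k.
Proof. exact: big_cat. Qed.

Lemma fourier_cons c s k : fourier (c :: s) k = fourier [:: c] k + fourier s k.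
Proof. by rewrite -cat1s fourier_cat. Qed.

Lemma anti_cat s t x : anti (s ++ t) x = anti s x + anti t x.
Proof. exact: big_cat. Qed.

Lemma l1norm_cat s t : l1norm (s ++ t) = l1norm s + l1norm t.
Proof. exact: big_cat. Qed.

Lemma degree_cat s t : degree (s ++ t) = maxn (degree s) (degree t).
Proof. exact: big_cat. Qed.

Lemma nneg_coef_cat s t : nneg_coef (s ++ t) = nneg_coef s && nneg_coef t.
Proof. exact: all_cat. Qed.

Lemma cosp_scale a s x : cosp (cscale a s) x = a * cosp s x.
Proof. by rewrite /cosp big_map mulr_sumr; apply: eq_bigr => c _ /=; rewrite mulrA. Qed.

Lemma fourier_scale a s k : fourier (cscale a s) k = a * fourier s k.
Proof. by rewrite /fourier big_map mulr_sumr; apply: eq_bigr => c _ /=; rewrite mulrA. Qed.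

Lemma nneg_coef_scale a s : 0 <= a -> nneg_coef s -> nneg_coef (cscale a s).
Proof.
move=> a0 /allP H; apply/allP => _ /mapP[c cs ->] /=.
by rewrite mulr_ge0// H.
Qed.

Lemma cosM (a b : R) : cos a * cos b = (cos (a + b) + cos (a - b)) / 2.
Proof. by rewrite cosD cosB; field. Qed.

Lemma cosp_mul s t x : cosp (cmul s t) x = cosp s x * cosp t x.
Proof.
rewrite /cosp /cmul big_cat !big_allpairs_dep/= -big_split/= mulr_suml.
apply: eq_bigr => c _; rewrite mulr_sumr -big_split/=; apply: eq_bigr => d _ /=.
have -> : 2 * pi * (c.2 + d.2)%:~R * x = 2 * pi * c.2%:~R * x + 2 * pi * d.2%:~R * x.
  by rewrite intrD; ring.
have -> : 2 * pi * (c.2 - d.2)%:~R * x = 2 * pi * c.2%:~R * x - 2 * pi * d.2%:~R * x.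
  by rewrite intrB; ring.
transitivity (c.1 * d.1 * (cos (2 * pi * c.2%:~R * x) * cos (2 * pi * d.2%:~R * x))).
  by rewrite cosM; field.
by ring.
Qed.

Lemma fourier_mul s t k : fourier (cmul s t) k =
  \sum_(c <- s) c.1 * ((fourier t (k - c.2) + fourier t (k + c.2)) / 2).
Proof.
rewrite /fourier /cmul big_cat !big_allpairs_dep/= -big_split/=.
apply: eq_bigr => c _; rewrite -!big_split/= !mulr_suml mulr_sumr.
apply: eq_bigr => d _ /=.
have E1 : (c.2 + d.2 == k) = (d.2 == k - c.2) by lia.
have E2 : (c.2 + d.2 == - k) = (d.2 == - (k + c.2)) by lia.
have E3 : (c.2 - d.2 == k) = (d.2 == - (k - c.2)) by lia.
have E4 : (c.2 - d.2 == - k) = (d.2 == k + c.2) by lia.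
by rewrite E1 E2 E3 E4; field.
Qed.

Lemma fourierN s k : fourier s (- k) = fourier s k.
Proof. by apply: eq_bigr => c _; rewrite opprK addrC. Qed.

Lemma fourier1 k : fourier [:: (1, 0)] k = (k == 0)%:R.
Proof.
rewrite /fourier big_seq1/= mul1r !(eq_sym 0) oppr_eq0.
by case: (k == 0) => /=; field.
Qed.

Lemma cosp1 x : cosp [:: (1, 0)] x = 1.
Proof. by rewrite /cosp big_seq1/= mulr0 mul0r cos0 mulr1. Qed.

Lemma cosp_seq1 a k x : cosp [:: (a, k)] x = a * cos (2 * pi * k%:~R * x).
Proof. by rewrite /cosp big_seq1. Qed.

Lemma fourier_ge0 s k : nneg_coef s -> 0 <= fourier s k.
Proof.
move=> /allP H; rewrite /fourier big_seq; apply: sumr_ge0 => c cs.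
by rewrite mulr_ge0 ?H// divr_ge0// addr_ge0.
Qed.

Lemma nneg_coef_mul s t : nneg_coef s -> nneg_coef t -> nneg_coef (cmul s t).
Proof.
move=> /allP Hs /allP Ht; rewrite nneg_coef_cat; apply/andP; split;
  by apply/allP => _ /allpairsP[[c d] [cs dt ->]]; apply: divr_ge0 => //; apply: mulr_ge0; [exact: (Hs c)|exact: (Ht d)].
Qed.

Lemma l1norm_ge0 s : 0 <= l1norm s.
Proof. by apply: sumr_ge0 => c _. Qed.

Lemma l1norm_mul s t : l1norm (cmul s t) = l1norm s * l1norm t.
Proof.
rewrite /l1norm /cmul big_cat !big_allpairs_dep/= -big_split/= mulr_suml.
apply: eq_bigr => c _; rewrite mulr_sumr -big_split/=; apply: eq_bigr => d _ /=.
by rewrite normrM normfV normrM (@ger0_norm _ 2)//; field.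
Qed.

Lemma degree_mem s c : c \in s -> (`|c.2| <= degree s)%N.
Proof. by move=> cs; apply: (@leq_bigmax_seq _ s xpredT (fun c => `|c.2|%N)). Qed.

Lemma degree_le s N : (forall c, c \in s -> (`|c.2| <= N)%N) -> (degree s <= N)%N.
Proof. by move=> H; apply/bigmax_leqP_seq => c cs _; exact: H. Qed.

Lemma mem_cmul s t c : c \in cmul s t -> exists2 d, d \in s & exists2 e, e \in t &
  (c.2 = d.2 + e.2 \/ c.2 = d.2 - e.2).
Proof.
rewrite mem_cat => /orP[] /allpairsP[[d e] [ds et ->]]; exists d => //; exists e => //=.
  by left.
by right.
Qed.

Lemma degree_mul s t : (degree (cmul s t) <= degree s + degree t)%N.
Proof.
apply: degree_le => c /mem_cmul[d ds [e et H]].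
have := degree_mem ds; have := degree_mem et; case: H => ->; lia.
Qed.

Lemma norm_cosp_le s x : `|cosp s x| <= l1norm s.
Proof.
apply: le_trans (ler_norm_sum _ _ _) _; apply: ler_sum => c _.
rewrite normrM ler_piMr// ler_norml cos_geN1 cos_le1//.
Qed.

Lemma fourier_deg s k : (degree s < `|k|)%N -> fourier s k = 0.
Proof.
move=> H; rewrite /fourier big_seq big1// => c cs; have := degree_mem cs => dc.
have -> : (c.2 == k) = false by apply/eqP => E; move: H; rewrite -E ltnNge dc.
have -> : (c.2 == - k) = false.
  by apply/eqP => E; move: H; rewrite -(abszN k) -E ltnNge dc.
by rewrite /= addr0 mul0r mulr0.
Qed.

Lemma is_derive_anti s x : is_derive x (1 : R) (anti s) (cosp s x).
Proof.
elim: s => [|c s IH].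
  have -> : anti [::] = cst 0 by apply/funext => y; rewrite /anti big_nil.
  by rewrite /cosp big_nil; exact: is_derive_cst.
pose a : R := 2 * pi * c.2%:~R.
have -> : anti (c :: s) = (c.1 \*: (fun y : R =>
    if c.2 == 0 then y else a^-1 * sin (a * y))) + anti s.
  apply/funext => y; rewrite /anti big_cons/= fctE/=; congr (_ * _ + _).
  by case: ifP => // _; rewrite mulrC.
rewrite /cosp big_cons; apply: is_deriveD; apply: is_deriveZ.
rewrite -/a /a; case: eqP => [->|/eqP c0].
  by rewrite mulr0 mul0r cos0; exact: is_derive_id.
rewrite -/a; have a0 : a != 0.
  by rewrite /a !mulf_neq0 ?intr_eq0// gt_eqF// pi_gt0.
have -> : cos (a * x) = a^-1 *: (cos (a * x) * a).
  by rewrite /GRing.scale/=; field.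
apply: (@is_deriveZ _ _ _ (fun y => sin (a * y))).
apply: (@is_derive1_comp _ sin (fun y => a * y)).
rewrite -[X in is_derive _ _ _ X]mulr1.
exact: (@is_deriveZ _ _ _ id).
Qed.

Lemma anti0 s : anti s 0 = 0.
Proof.
by rewrite /anti big1// => c _; case: ifP => _; rewrite ?mulr0// sin0 mul0r mulr0.
Qed.

Lemma sin_2pi_int (k : int) x : sin (x + 2 * pi * k%:~R) = sin x.
Proof.
have H (n : nat) y : sin (y + 2 * pi * n%:R) = sin y.
  elim: n y => [|n IH] y; first by rewrite mulr0 addr0.
  have -> : y + 2 * pi * n.+1%:R = y + 2 * pi * n%:R + pi *+ 2.
    by rewrite -(natr1 n) -mulr_natl; ring.
  by rewrite sinD2pi.
case: k => n; first exact: H.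
by rewrite NegzE -[in RHS](subrK (2 * pi * n.+1%:R) x) H intrN mulrN.
Qed.

Lemma anti_period s x : anti s (x + 1) = anti s x + fourier s 0.
Proof.
rewrite /anti /fourier -big_split; apply: eq_bigr => c _ /=.
rewrite oppr0 -mulrDr; congr (_ * _); case: (c.2 == 0) => /=; first by field.
have -> : 2 * pi * c.2%:~R * (x + 1) = 2 * pi * c.2%:~R * x + 2 * pi * c.2%:~R by ring.
by rewrite sin_2pi_int addr0 mul0r addr0.
Qed.

Lemma anti1 s : anti s 1 = fourier s 0.
Proof. by rewrite -[1]add0r anti_period anti0 add0r. Qed.

(** Monotonicity of the integral in terms of primitives, by the mean value theorem for [g - f]. *)
Lemma increment_le (f df g dg : R -> R) (a b : R) : a <= b ->
  (forall x, is_derive x (1 : R) f (df x)) -> (forall x, is_derive x (1 : R) g (dg x)) ->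
  (forall x, a <= x <= b -> df x <= dg x) -> f b - f a <= g b - g a.
Proof.
move=> ab df_ dg_ H.
have D x : is_derive x (1 : R) (g - f) (dg x - df x) by exact: is_deriveB.
have [c cab E] : exists2 c, c \in `[a, b]%R &
    (g - f) b - (g - f) a = (dg c - df c) * (b - a).
  apply: (@MVT_segment R (g - f) (fun c => dg c - df c) a b ab) => //.
  apply: continuous_subspaceT => y.
  apply: differentiable_continuous; apply/derivable1_diffP.
  by have := D y; case.
rewrite -subr_ge0.
have -> : g b - g a - (f b - f a) = (dg c - df c) * (b - a).
  by rewrite -E !fctE; ring.
by rewrite mulr_ge0 ?subr_ge0// H//; move: cab; rewrite in_itv.
Qed.

Lemma anti_le s t (a b : R) : a <= b ->
  (forall x, a <= x <= b -> cosp s x <= cosp t x) ->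
  anti s b - anti s a <= anti t b - anti t a.
Proof. by move=> ab; apply: increment_le => // x; exact: is_derive_anti. Qed.

Lemma fourier0_le s t : (forall x, cosp s x <= cosp t x) -> fourier s 0 <= fourier t 0.
Proof.
move=> H; have := @anti_le s t 0 1 ler01 (fun x _ => H x).
by rewrite !anti0 !anti1 !subr0.
Qed.

(** Integration divides each term by its frequency: rapidly oscillating additions to a density
    hardly move its distribution function. *)
Lemma norm_anti_le s (N : nat) x : (0 < N)%N ->
  (forall c, c \in s -> (N <= `|c.2|)%N) -> `|anti s x| <= l1norm s / N%:R.
Proof.
move=> N0 H; apply: le_trans (ler_norm_sum _ _ _) _.
rewrite /l1norm mulr_suml big_seq [leRHS]big_seq; apply: ler_sum => c cs.
have c0 : c.2 != 0 by rewrite -absz_gt0 (leq_trans N0)// H.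
rewrite (negbTE c0) normrM ler_wpM2l// normrM normfV.
have E : `|2 * pi * c.2%:~R : R| = 2 * pi * `|c.2|%N%:R.
  by rewrite normrM ger0_norm ?mulr_ge0 ?pi_ge0// -intr_norm natr_absz.
have NC : N%:R <= `|2 * pi * c.2%:~R : R|.
  rewrite E; have : N%:R <= `|c.2|%N%:R :> R by rewrite ler_nat H.
  have := pi_ge2 R; have : 0 <= N%:R :> R by []; nra.
have NR : 0 < N%:R :> R by rewrite ltr0n.
rewrite -[leRHS]mul1r ler_pM ?invr_ge0//.
  by rewrite ler_norml sin_geN1 sin_le1.
by rewrite lef_pV2// posrE (lt_le_trans NR).
Qed.

End CosineLists.

Arguments cmul : simpl never.

(** * Riesz products *)

Section RieszProducts.
Variables (R : realType) (q : nat).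
Hypothesis q1 : (1 < q)%N.
Implicit Types (x : R) (k : int).

Definition unit_freq (i : nat) : int := q%:Z ^+ (2 * i).

(* [riesz0 T n] is the product of the [1 + cos (2 pi q^(2i) x)], [T <= i < T + n],
   minus [1]. *)
Fixpoint riesz0 (T n : nat) : seq (R * int) :=
  if n is m.+1 then
    let s := riesz0 T m in
    s ++ cmul [:: (1, unit_freq (T + m))] s ++ [:: (1, unit_freq (T + m))]
  else [::].

(** The constant 1 is kept apart: multiplied by the old density it gives that density back, and
    [riesz0] alone brings new frequencies. *)
Definition riesz T n : seq (R * int) := (1, 0) :: riesz0 T n.

Lemma unit_freq_gt0 i : 0 < unit_freq i.
Proof. by rewrite exprn_gt0// ltz_nat ltnW. Qed.

Lemma unit_freq_lt i j : (i < j)%N -> 4 * unit_freq i <= unit_freq j.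
Proof.
move=> ij; rewrite /unit_freq -(subnKC ij) addSn -addnS mulnDr exprD mulrC.
rewrite ler_wpM2l ?exprn_ge0//.
have -> : (2 * (j - i.+1).+1 = (2 * (j - i.+1)).+2)%N by rewrite mulnS.
rewrite !exprS -PoszX -!PoszM lez_nat.
have := expn_gt0 q (2 * (j - i.+1)); rewrite (ltnW q1)/=.
by move: (q ^ _)%N => Z Z0; nia.
Qed.

Lemma cosp_riesz_succ T n x : cosp (riesz T n.+1) x =
  cosp (riesz T n) x * (1 + cos (2 * pi * (unit_freq (T + n))%:~R * x)).
Proof.
rewrite /riesz /= [LHS]cosp_cons [in RHS]cosp_cons cosp_cat cosp_cat cosp_mul.
by rewrite !cosp1 cosp_seq1; ring.
Qed.

Lemma cosp_riesz_ge0 T n x : 0 <= cosp (riesz T n) x.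
Proof.
elim: n => [|n IH]; first by rewrite cosp1.
by rewrite cosp_riesz_succ mulr_ge0// -lerBlDl sub0r cos_geN1.
Qed.

Lemma nneg_coef_riesz0 T n : nneg_coef (riesz0 T n).
Proof.
elim: n => // n IH; rewrite /= nneg_coef_cat IH nneg_coef_cat.
by rewrite nneg_coef_mul//= ler01.
Qed.

Lemma fourier_riesz_succ T n k : fourier (riesz T n.+1) k =
  fourier (riesz T n) k + (fourier (riesz T n) (k - unit_freq (T + n)) +
    fourier (riesz T n) (k + unit_freq (T + n))) / 2.
Proof.
rewrite /riesz /= [LHS]fourier_cons fourier_cat fourier_cat fourier_mul.
rewrite !(fourier_cons (1, 0) (riesz0 T n)) big_seq1/= mul1r !fourier1; set u := unit_freq _.
have -> : fourier [:: (1, u)] k = ((k - u == 0)%:R + (k + u == 0)%:R) / 2 :> R.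
  rewrite /fourier big_seq1/= mul1r; congr ((_ %:R + _ %:R) / 2).
    by congr nat_of_bool; lia.
  by congr nat_of_bool; lia.
by field.
Qed.

Lemma rep0 s t : rep q s t 0.
Proof. by exists (fun=> 0) => //; rewrite big1// => i _; rewrite mul0r. Qed.

Lemma repN s t y : rep q s t y -> rep q s t (- y).
Proof.
case=> e eb ->; exists (fun i => - e i); first by move=> i; rewrite abszN.
by rewrite -sumrN; apply: eq_bigr => i _; rewrite mulNr.
Qed.

Lemma rep_extend s t y a : (s <= t)%N -> (`|a| <= 1)%N -> rep q s t y ->
  rep q s t.+1 (y + a * unit_freq t).
Proof.
move=> st a1 [e eb ->]; exists (fun i => if i == t then a else e i).
  by move=> i; case: ifP.
rewrite big_nat_recr//= eqxx; congr (_ + _).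
by apply: eq_big_nat => i /andP[_ it]; rewrite ltn_eqF.
Qed.

Lemma mem_riesz0 T n c : c \in riesz0 T n -> c.2 != 0 /\ rep q T (T + n) c.2.
Proof.
elim: n c => // n IH c; rewrite /= mem_cat addnS.
have ext y a : (`|a| <= 1)%N -> rep q T (T + n) y -> rep q T (T + n).+1 (y + a * unit_freq (T + n)).
  by move=> a1; apply: rep_extend => //; rewrite leq_addr.
case/orP => [/IH[c0 rc]|]; last (rewrite mem_cat => /orP[/mem_cmul[d]|]).
- by split => //; have := ext _ 0 isT rc; rewrite mul0r addr0.
- rewrite mem_seq1 => /eqP -> [e /IH[e0 re] H].
  have b := rep_bound q1 re; have u0 := unit_freq_gt0 (T + n).
  have uE : unit_freq (T + n) = (q ^ (2 * (T + n)))%N :> int by rewrite /unit_freq -PoszX.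
  split.
    apply/eqP => E; move: b u0 H; rewrite E uE /=; move: (q ^ _)%N => Z; clear; lia.
  case: H => -> /=.
    by have := ext _ 1 isT re; rewrite mul1r addrC.
  by have := ext _ 1 isT (repN re); rewrite mul1r addrC.
- rewrite mem_seq1 => /eqP -> /=; split; first by rewrite gt_eqF// unit_freq_gt0.
  by have := ext _ 1 isT (rep0 _ _); rewrite mul1r add0r.
Qed.

Lemma fourier_riesz0_supp T n k : fourier (riesz0 T n) k != 0 ->
  k != 0 /\ rep q T (T + n) k.
Proof.
move=> H; have : has (fun c => (c.2 == k) || (c.2 == - k)) (riesz0 T n).
  apply: contraR H => /hasPn H; rewrite /fourier big_seq big1// => c /H.
  by rewrite negb_or => /andP[/negbTE -> /negbTE ->]; rewrite addr0 mul0r mulr0.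
case/hasP => c /mem_riesz0[c0 rc] /orP[] /eqP E; first by rewrite -E.
by rewrite -(opprK k) -E oppr_eq0; split => //; exact: repN.
Qed.

Lemma fourier_riesz T n k : fourier (riesz T n) k = (k == 0)%:R + fourier (riesz0 T n) k.
Proof. by rewrite /riesz fourier_cons fourier1. Qed.

Lemma fourier_riesz_at0 T n : fourier (riesz T n) 0 = 1.
Proof.
rewrite fourier_riesz eqxx [X in _ + X](_ : _ = 0) ?addr0//.
by apply/eqP/negPn/negP => /fourier_riesz0_supp[]; rewrite eqxx.
Qed.

Lemma fourier_riesz_big T n k : unit_freq (T + n) <= 3 * `|k| -> fourier (riesz T n) k = 0.
Proof.
move=> H; have k0 : k != 0.
  by apply/eqP => k0; move: H; rewrite k0 normr0 mulr0 leNgt unit_freq_gt0.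
rewrite fourier_riesz (negbTE k0) add0r; apply/eqP/negPn/negP => /fourier_riesz0_supp[_].
move/(rep_bound q1) => b; move: H; rewrite /unit_freq -PoszX -abszE.
by move: b; move: (q ^ _)%N => Z; lia.
Qed.

(** Passing from [n] to [n + 1] adds two halved copies of the spectrum, centred at [u] and [-u] with
    [u = unit_freq q (T + n)]. All three copies have radius below [u / 3], so near 0 only the old
    one counts, and near [u] only one of the new ones. *)
Lemma fourier_riesz_low T n k : 3 * `|k| < unit_freq (T + n) ->
  fourier (riesz T n.+1) k = fourier (riesz T n) k.
Proof.
move=> H; rewrite fourier_riesz_succ !(@fourier_riesz_big T n (_ + _)) ?addr0 ?mul0r ?addr0//; lia.
Qed.

Lemma fourier_riesz_high T n k : 3 * `|k - unit_freq (T + n)| < unit_freq (T + n) ->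
  fourier (riesz T n.+1) k = fourier (riesz T n) (k - unit_freq (T + n)) / 2.
Proof.
move=> H; rewrite fourier_riesz_succ (@fourier_riesz_big T n k) ?add0r; last lia.
by rewrite (@fourier_riesz_big T n (k + unit_freq (T + n))) ?addr0; last lia.
Qed.

Lemma fourier_riesz_le1 T n k : fourier (riesz T n) k <= 1.
Proof.
elim: n k => [|n IH] k; first by rewrite fourier1 lern1 leq_b1.
have [H|H] := ltP (3 * `|k|) (unit_freq (T + n)); first by rewrite fourier_riesz_low.
rewrite fourier_riesz_succ (fourier_riesz_big H) add0r.
by have := IH (k - unit_freq (T + n)); have := IH (k + unit_freq (T + n)); lra.
Qed.

Lemma fourier_riesz_unit T n i : (T <= i < T + n)%N ->
  fourier (riesz T n) (unit_freq i) = 2^-1.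
Proof.
elim: n => [|n IH]; first by rewrite addn0 => /andP[/leq_ltn_trans H /H]; rewrite ltnn.
rewrite addnS ltnS => /andP[Ti]; rewrite leq_eqVlt => /orP[/eqP ->|it].
  rewrite fourier_riesz_high subrr ?fourier_riesz_at0 ?mul1r//.
  by rewrite normr0 mulr0 unit_freq_gt0.
rewrite fourier_riesz_low; first by rewrite IH// Ti.
have := unit_freq_lt it; have := unit_freq_gt0 i; lia.
Qed.

(** The value [1/4] for both sum and difference makes the mean of a product of two distinct even
    cosines equal to the product of their means [1/2]. *)
Lemma fourier_riesz_unit2 T n i j (e : bool) : (T <= i)%N -> (i < j)%N -> (j < T + n)%N ->
  fourier (riesz T n) (unit_freq j + (-1) ^+ e * unit_freq i) = 4^-1.
Proof.
move=> Ti ij; elim: n => [|n IH].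
  by rewrite addn0 => /ltnW H; have := leq_ltn_trans Ti ij; rewrite ltnNge H.
have i0 := unit_freq_gt0 i; have ijf := unit_freq_lt ij.
rewrite addnS ltnS leq_eqVlt => /orP[/eqP jE|jt].
  rewrite jE in ij ijf * => {IH}; rewrite fourier_riesz_high; last by case: e; rewrite ?expr0 ?expr1; lia.
  rewrite addrAC subrr add0r.
  have -> : fourier (riesz T n) ((-1) ^+ e * unit_freq i) = 2^-1.
    by case: e; rewrite ?expr0 ?expr1 ?mulN1r ?mul1r ?fourierN fourier_riesz_unit// Ti.
  by field.
rewrite fourier_riesz_low ?IH// {IH}.
by have := unit_freq_lt jt; case: e; rewrite ?expr0 ?expr1; lia.
Qed.

(** Parity of the exponent of [q]: the argument is an odd power of [q] times a number that is 1
    modulo [q], while nonzero represented numbers are an even power of [q] times a number coprime to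
    [q]. *)
Lemma fourier_riesz_odd T n i j (e : bool) : (i < j)%N ->
  fourier (riesz T n) (q%:Z ^+ (2 * i).+1 + (-1) ^+ e * q%:Z ^+ (2 * j).+1) = 0.
Proof.
move=> ij; set k := _ + _.
have q0 n' : q%:Z ^+ n' != 0 by rewrite expf_neq0// gt_eqF// ltz_nat ltnW.
have qn1 : ~~ (q%:Z %| 1)%Z by rewrite dvdz1 absz_nat gtn_eqF.
pose E' : int := 1 + q%:Z * ((-1) ^+ e * q%:Z ^+ (2 * (j - i)).-1).
have kE : k = q%:Z ^+ (2 * i).+1 * E'.
  rewrite /k -[in X in _ + X](subnKC (ltnW ij)) mulnDr -addSn exprD /E'.
  have : (0 < 2 * (j - i))%N by rewrite muln_gt0 subn_gt0.
  case: (2 * (j - i))%N => // m _ /=; rewrite [q%:Z ^+ m.+1]exprS; ring.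
have nE' : ~~ (q%:Z %| E')%Z.
  apply/negP => H; move/negP: qn1; apply.
  have H2 : (q%:Z %| q%:Z * ((-1) ^+ e * q%:Z ^+ (2 * (j - i)).-1))%Z by exact: dvdz_mulr.
  by have := rpredB H H2; rewrite addrK.
have k0 : k != 0.
  by rewrite kE mulf_neq0//; apply: contraNneq nE' => ->; exact: dvdz0.
rewrite fourier_riesz (negbTE k0) add0r; apply/eqP/negPn/negP => /fourier_riesz0_supp[_ rk].
have [i0 [E [_ kE0 [u u1 uE] _]]] := rep_lowest q1 rk k0.
have nE : ~~ (q%:Z %| E)%Z.
  have cE := coprimez_class q1 u1 uE; apply/negP => qE.
  have : (q%:Z %| gcdz E q%:Z)%Z by rewrite dvdz_gcd qE dvdzz.
  by rewrite (eqP cE) (negbTE qn1).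
have key a c (x y : int) : q%:Z ^+ a * x = q%:Z ^+ c * y -> (a < c)%N -> (q%:Z %| x)%Z.
  move=> H ac; have /(mulfI (q0 a)) -> : q%:Z ^+ a * x = q%:Z ^+ a * (q%:Z ^+ (c - a) * y).
    by rewrite H mulrA -exprD subnKC// ltnW.
  apply: dvdz_mulr; apply: (@dvdz_trans (q%:Z ^+ 1)); first by rewrite expr1.
  by apply: dvdz_exp2l; rewrite subn_gt0.
have Eq : q%:Z ^+ (2 * i).+1 * E' = q%:Z ^+ (2 * i0) * E by rewrite -kE.
case: (ltngtP (2 * i).+1 (2 * i0)) => H.
- by have := key _ _ _ _ Eq H; rewrite (negbTE nE').
- by have := key _ _ _ _ (esym Eq) H; rewrite (negbTE nE).
- by have := congr1 odd H; rewrite /= !mul2n !odd_double.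
Qed.

Definition even_avg T : seq (R * int) := [seq (T%:R^-1, q%:Z ^+ (2 * i)) | i <- index_iota T (2 * T)].
Definition odd_avg T : seq (R * int) := [seq (T%:R^-1, q%:Z ^+ (2 * i).+1) | i <- index_iota T (2 * T)].

(* [32 ((G_e - 1/2)^2 + G_o^2)], where [G_e] and [G_o] are the averages of
   [cos (2 pi q^n x)] over the even and the odd [n] of [2T, 4T). *)
Definition bias_test T : seq (R * int) := cscale 32
  (cmul (even_avg T) (even_avg T) ++ (cscale (-1) (even_avg T) ++
    ([:: (4^-1, 0)] ++ cmul (odd_avg T) (odd_avg T)))).

Lemma cosp_bias_test T x : cosp (bias_test T) x =
  32 * ((cosp (even_avg T) x - 2^-1) ^+ 2 + cosp (odd_avg T) x ^+ 2).
Proof.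
rewrite /bias_test cosp_scale cosp_cat [cosp (cscale _ _ ++ _) x]cosp_cat.
rewrite [cosp ([:: _] ++ _) x]cosp_cat !cosp_mul cosp_scale.
by rewrite cosp_seq1 mulr0 mul0r cos0; field.
Qed.

Lemma cosp_bias_test_ge0 T x : 0 <= cosp (bias_test T) x.
Proof. by rewrite cosp_bias_test mulr_ge0// addr_ge0// sqr_ge0. Qed.

(** Origin of the factor 32: if the test is below 1, then [(G_e - 1/2) + G_o] has square less than
    [2/32], so [G_e + G_o > 1/4]. The sum over the block is [T (G_e + G_o)]. *)
Lemma cosp_bias_test_lt1 T x : (0 < T)%N -> cosp (bias_test T) x < 1 ->
  T%:R / 4 <= \sum_(2 * T <= n < 4 * T) cos (2 * pi * (q%:Z ^+ n)%:~R * x).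
Proof.
move=> T0; rewrite cosp_bias_test => H.
have TR : 0 < T%:R :> R by rewrite ltr0n.
have -> : \sum_(2 * T <= n < 4 * T) cos (2 * pi * (q%:Z ^+ n)%:~R * x) =
    T%:R * (cosp (even_avg T) x + cosp (odd_avg T) x).
  have E s (f : nat -> int) : T%:R * cosp [seq (T%:R^-1, f i) | i <- s] x =
     \sum_(i <- s) cos (2 * pi * (f i)%:~R * x).
    rewrite /cosp big_map mulr_sumr; apply: eq_bigr => i _ /=.
    by rewrite mulrA divff ?gt_eqF// mul1r.
  have /= E1 := E (index_iota T (2 * T)) (fun i => q%:Z ^+ (2 * i)).
  have /= E2 := E (index_iota T (2 * T)) (fun i => q%:Z ^+ (2 * i).+1).
  rewrite [RHS]mulrDr /even_avg /odd_avg E1 E2 -big_split/= {E E1 E2}.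
  have -> : (4 * T = 2 * (2 * T))%N by rewrite mulnA.
  have split_parity (F : nat -> R) m : (T <= m)%N ->
      \sum_(2 * T <= n < 2 * m) F n = \sum_(T <= i < m) (F (2 * i)%N + F (2 * i).+1).
    elim: m => [|m IH]; first by rewrite leqn0 => /eqP ->; rewrite !big_geq.
    rewrite leq_eqVlt => /orP[/eqP ->|]; first by rewrite !big_geq.
    rewrite ltnS => Tm; rewrite [in RHS]big_nat_recr//= -IH// mulnS.
    have Tm2 : (2 * T <= 2 * m)%N by rewrite leq_mul2l.
    by rewrite big_nat_recr/= ?leqW// big_nat_recr//= addrA.
  by rewrite split_parity// leq_pmull.
rewrite ler_pM2l//.
move: (cosp (even_avg T) x) (cosp (odd_avg T) x) H => a b H.
have S : 0 <= (a - 2^-1 - b) ^+ 2 by exact: sqr_ge0.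
rewrite leNgt; apply/negP => ab.
have w4 : 4^-1 < 2^-1 - a - b by move: ab; lra.
have : 4^-1 * 4^-1 < (2^-1 - a - b) * (2^-1 - a - b) by rewrite ltr_pM.
by move: S H; rewrite !expr2; nra.
Qed.

Lemma fourier_mul_riesz0 s T n : fourier (cmul s (riesz T n)) 0 =
  \sum_(c <- s) c.1 * fourier (riesz T n) c.2.
Proof.
rewrite fourier_mul; apply: eq_bigr => c _.
by rewrite sub0r add0r fourierN; congr (_ * _); field.
Qed.

(** Second moment of an average of [T] cosines: off the diagonal the value is [a], and the [T]
    diagonal pairs have total weight [1/T]. *)
Lemma pair_average_le (F : nat -> int) (f : int -> R) (a : R) T :
  (0 < T)%N -> 0 <= a -> (forall k, f k <= 1) ->
  (forall i j, (T <= i < 2 * T)%N -> (T <= j < 2 * T)%N -> i != j ->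
     f (F i + F j) = a /\ f (F i - F j) = a) ->
  \sum_(c <- cmul [seq (T%:R^-1, F i) | i <- index_iota T (2 * T)]
                  [seq (T%:R^-1, F i) | i <- index_iota T (2 * T)]) c.1 * f c.2
    <= a + T%:R^-1 :> R.
Proof.
move=> T0 a0 f1 fa; have TR : 0 < T%:R :> R by rewrite ltr0n.
rewrite /cmul big_cat !big_allpairs_dep/= -big_split/= big_map.
have sz : (2 * T - T = T)%N by rewrite mul2n -addnn addnK.
apply: (@le_trans _ _ (\sum_(T <= i < 2 * T) (a / T%:R + T%:R^-2))).
  rewrite big_nat [leRHS]big_nat; apply: ler_sum => i iT.
  rewrite -big_split/= big_map.
  apply: (@le_trans _ _ (\sum_(T <= j < 2 * T) (a * T%:R^-2 + (j == i)%:R * T%:R^-2))).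
    rewrite big_nat [leRHS]big_nat; apply: ler_sum => j jT /=.
    rewrite expr2 invfM; set w := T%:R^-1 * T%:R^-1.
    have w0 : 0 <= w by rewrite mulr_ge0// invr_ge0 ltW.
    case: eqP => [_|/eqP ji].
      have := f1 (F i + F j); have := f1 (F i - F j).
      by move: (f _) (f _) => u v u1 v1; rewrite mul1r; nra.
    have [|-> ->] := fa i j iT jT; first by rewrite eq_sym.
    by rewrite mul0r addr0; lra.
  rewrite big_split/= sumr_const_nat sz lerD//.
    by rewrite -[leLHS]mulr_natr; rewrite le_eqVlt; apply/orP; left; apply/eqP; field; rewrite gt_eqF.
  rewrite -mulr_suml -[leRHS]mul1r ler_wpM2r ?invr_ge0 ?exprn_ge0//.
  rewrite (bigD1_seq i) ?mem_index_iota ?iota_uniq//= eqxx big1.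
    by rewrite addr0.
  by move=> j /negbTE ->.
rewrite sumr_const_nat sz -[leLHS]mulr_natr.
by rewrite le_eqVlt; apply/orP; left; apply/eqP; field; rewrite gt_eqF.
Qed.

(** The second moments of [G_e] and [G_o] are at most [1/4 + 1/T] and [1/T], and the mean of [G_e]
    is [1/2]; what remains is 32 times [2/T]. *)
Lemma fourier_bias_test T : (0 < T)%N ->
  fourier (cmul (bias_test T) (riesz T T)) 0 <= 64 / T%:R.
Proof.
move=> T0; have TR : 0 < T%:R :> R by rewrite ltr0n.
have T2 : (T + T = 2 * T)%N by rewrite mul2n addnn.
rewrite fourier_mul_riesz0; set r := fourier _.
have rN k : r (- k) = r k by exact: fourierN.
have r1 k : r k <= 1 by exact: fourier_riesz_le1.
pose L s : R := \sum_(c <- s) c.1 * r c.2.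
have LE : L (cmul (even_avg T) (even_avg T)) <= 4^-1 + T%:R^-1.
  apply: (@pair_average_le (fun i => q%:Z ^+ (2 * i)) r) => //.
  move=> i j /andP[Ti iT] /andP[Tj jT]; rewrite neq_ltn => /orP[] ij.
    have := @fourier_riesz_unit2 T T i j; rewrite T2 -/r => H; split.
      by have := H false Ti ij jT; rewrite expr0 mul1r addrC.
    by have := H true Ti ij jT; rewrite expr1 mulN1r -rN opprB.
  have := @fourier_riesz_unit2 T T j i; rewrite T2 -/r => H; split.
    by have := H false Tj ij iT; rewrite expr0 mul1r.
  by have := H true Tj ij iT; rewrite expr1 mulN1r.
have LO : L (cmul (odd_avg T) (odd_avg T)) <= 0 + T%:R^-1.
  apply: (@pair_average_le (fun i => q%:Z ^+ (2 * i).+1) r) => //.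
  move=> i j _ _; rewrite neq_ltn => /orP[] ij.
    have H := @fourier_riesz_odd T T i j; split.
      by have := H false ij; rewrite expr0 mul1r.
    by have := H true ij; rewrite expr1 mulN1r.
  have H := @fourier_riesz_odd T T j i; split.
    by have := H false ij; rewrite expr0 mul1r addrC.
  by have := H true ij; rewrite expr1 mulN1r -rN opprB.
have L1 : L (even_avg T) = 2^-1.
  rewrite /L big_map big_nat (eq_bigr (fun=> T%:R^-1 * 2^-1)).
    rewrite -big_nat sumr_const_nat mul2n -addnn addnK -mulr_natr.
    by field; rewrite gt_eqF.
  by move=> i iT /=; congr (_ * _); apply: fourier_riesz_unit; rewrite T2.
have r0 : r 0 = 1 by exact: fourier_riesz_at0.
have -> : \sum_(c <- bias_test T) c.1 * r c.2 = 32 * (L (cmul (even_avg T) (even_avg T))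
   - L (even_avg T) + 4^-1 + L (cmul (odd_avg T) (odd_avg T))).
  rewrite /bias_test /cscale big_map/=.
  rewrite (eq_bigr (fun c => 32 * (c.1 * r c.2))); last by move=> c _; rewrite mulrA.
  rewrite -mulr_sumr; congr (_ * _).
  have Lcat s t : L (s ++ t) = L s + L t by exact: big_cat.
  have LN : L (cscale (-1) (even_avg T)) = - L (even_avg T).
    by rewrite /L big_map -sumrN; apply: eq_bigr => c _; rewrite mulN1r mulNr.
  have LC : L [:: (4^-1, 0)] = 4^-1 by rewrite /L big_seq1/= r0 mulr1.
  transitivity (L (cmul (even_avg T) (even_avg T)) + (L (cscale (-1) (even_avg T)) +
    (L [:: (4^-1, 0)] + L (cmul (odd_avg T) (odd_avg T))))).
    by rewrite -!Lcat.
  by rewrite LN LC; ring.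
rewrite L1; move: LE LO; rewrite add0r; set z := T%:R^-1.
by move: (L _) (L _) => u v; lra.
Qed.

End RieszProducts.

(** * One stage of the construction *)

Section Stage.
Variable R : realType.
Implicit Types (s t P : seq (R * int)) (x e : R) (k h l : int) (b q T N D : nat).

Lemma big_cmul (F : R * int -> R) s t : \sum_(c <- cmul s t) F c =
  \sum_(c <- s) \sum_(d <- t) (F (c.1 * d.1 / 2, c.2 + d.2) + F (c.1 * d.1 / 2, c.2 - d.2)).
Proof.
rewrite /cmul big_cat !big_allpairs_dep/= -big_split/=; apply: eq_bigr => c _.
by rewrite -big_split.
Qed.

Lemma anti_mul_cat s t u x : anti (cmul s (t ++ u)) x = anti (cmul s t) x + anti (cmul s u) x.
Proof.
rewrite /anti !big_cmul -big_split/=; apply: eq_bigr => c _.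
by rewrite big_cat.
Qed.

Lemma anti_mul_scale s a t x : anti (cmul s (cscale a t)) x = a * anti (cmul s t) x.
Proof.
rewrite /anti !big_cmul mulr_sumr; apply: eq_bigr => c _.
rewrite big_map mulr_sumr; apply: eq_bigr => d _ /=.
by ring.
Qed.

Lemma fourier_mul_cat s t u k :
  fourier (cmul s (t ++ u)) k = fourier (cmul s t) k + fourier (cmul s u) k.
Proof.
rewrite /fourier !big_cmul -big_split/=; apply: eq_bigr => c _.
by rewrite big_cat.
Qed.

Lemma fourier_mul_scale s a t k : fourier (cmul s (cscale a t)) k = a * fourier (cmul s t) k.
Proof.
rewrite /fourier !big_cmul mulr_sumr; apply: eq_bigr => c _.
rewrite big_map mulr_sumr; apply: eq_bigr => d _ /=.
by ring.
Qed.

Lemma fourier_small s D k : (forall c, c \in s -> (D < `|c.2|)%N) -> (`|k| <= D)%N ->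
  fourier s k = 0.
Proof.
move=> H kD; rewrite /fourier big_seq big1// => c /H cD.
have -> : (c.2 == k) = false by apply/eqP; lia.
have -> : (c.2 == - k) = false by apply/eqP; lia.
by rewrite addr0 mul0r mulr0.
Qed.

Lemma fourier_mul_small s t D : (degree s <= D)%N ->
  (forall c, c \in t -> (D < `|c.2|)%N) -> fourier (cmul s t) 0 = 0.
Proof.
move=> sD tD; rewrite fourier_mul big_seq big1// => c cs.
have cD := leq_trans (degree_mem cs) sD.
by rewrite sub0r add0r fourierN (fourier_small tD)// addr0 mul0r mulr0.
Qed.

Lemma eventually_all (X : eqType) (r : seq X) (Q : X -> nat -> Prop) :
  (forall z, z \in r -> exists T0, forall T, (T0 <= T)%N -> Q z T) ->
  exists T0, forall T z, (T0 <= T)%N -> z \in r -> Q z T.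
Proof.
elim: r => [|z r IH] H; first by exists 0%N.
have [T1 H1] := H z (mem_head _ _).
have [|T2 H2] := IH; first by move=> y yr; apply: H; rewrite in_cons yr orbT.
exists (maxn T1 T2) => T y; rewrite geq_max => /andP[h1 h2].
by rewrite in_cons => /orP[/eqP ->|]; [exact: H1 | exact: H2].
Qed.

(* If [phi] is the Fourier transform of a measure, [del_sum phi b h N] is the
   integral of [sum_(L < N) |sum_(m < L) e(h b^m x)|^2 / L^3]. *)
Definition del_sum (phi : int -> R) b h N : R :=
  \sum_(1 <= L < N) (\sum_(0 <= m < L) \sum_(0 <= n < L)
    phi (h * (b%:Z ^+ m - b%:Z ^+ n))) / L%:R ^+ 3.

(** The terms vanish below [T / b], and the tail of [L^-3] from there on is of order [(b/T)^2]. With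
    [A = o(T^2)] the sum becomes small, uniformly in [N]. *)
Lemma weighted_tail (c : nat -> R) (A : R) T b N : (0 < T)%N -> (0 < b)%N ->
  (forall L, 0 <= c L <= A) -> (forall L, (L * b < T)%N -> c L = 0) ->
  \sum_(1 <= L < N) c L / L%:R ^+ 3 <= 2 * A * b%:R ^+ 2 / T%:R ^+ 2.
Proof.
move=> T0 b0 cA cT; have TR : 0 < T%:R :> R by rewrite ltr0n.
have A0 : 0 <= A by have /andP[h1 h2] := cA 0%N; exact: le_trans h2.
set B := 2 * A * _ / _.
have B0 : 0 <= B by rewrite divr_ge0 ?exprn_ge0// mulr_ge0 ?exprn_ge0// mulr_ge0.
(* The slack [A / n^2] pays for the next term, since [1/(n+1)^3 <= 1/n^2 - 1/(n+1)^2]. *)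
suff H : forall n, \sum_(1 <= L < n.+1) c L / L%:R ^+ 3 <= B /\
   ((T <= n * b)%N -> \sum_(1 <= L < n.+1) c L / L%:R ^+ 3 <= B - A / n%:R ^+ 2).
  by case: N => [|n]; [rewrite big_geq | case: (H n)].
elim=> [|n [IH1 IH2]].
  by rewrite big_geq//; split => //; rewrite mul0n leqNgt T0.
rewrite big_nat_recr//=.
have [nT|Tn] := ltnP (n.+1 * b) T.
  by rewrite cT// mul0r addr0; split.
have n1 : 0 < n.+1%:R :> R by rewrite ltr0n.
suff H : \sum_(1 <= L < n.+1) c L / L%:R ^+ 3 + c n.+1 / n.+1%:R ^+ 3 <= B - A / n.+1%:R ^+ 2.
  split => // ; apply: le_trans H _.
  by rewrite gerBl divr_ge0 ?exprn_ge0.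
have cA' : c n.+1 / n.+1%:R ^+ 3 <= A / n.+1%:R ^+ 3.
  by rewrite ler_wpM2r ?invr_ge0 ?exprn_ge0//; case/andP: (cA n.+1).
have [nT|Tn'] := ltnP (n * b) T.
  have -> : \sum_(1 <= L < n.+1) c L / L%:R ^+ 3 = 0.
    rewrite big_nat big1// => L /andP[_ Ln]; rewrite cT ?mul0r//.
    by apply: leq_ltn_trans nT; rewrite leq_mul2r -ltnS Ln orbT.
  rewrite add0r; apply: le_trans cA' _; rewrite lerBrDr.
  have H3 : A / n.+1%:R ^+ 3 <= A / n.+1%:R ^+ 2.
    rewrite ler_wpM2l// lef_pV2 ?posrE ?exprn_gt0// exprS ler_peMl ?exprn_ge0//.
    by rewrite ler1n.
  have H4 : 2 * (A / n.+1%:R ^+ 2) <= B.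
    have -> : B = 2 * (A * (b%:R ^+ 2 / T%:R ^+ 2)) by rewrite /B; ring.
    rewrite ler_wpM2l// ler_wpM2l// ler_pdivlMr ?exprn_gt0//.
    rewrite mulrC ler_pdivrMr ?exprn_gt0// -exprMn lerXn2r ?nnegrE ?mulr_ge0//.
    by rewrite -natrM ler_nat mulnC.
  by move: H3 H4; move: (A / n.+1%:R ^+ 3) (A / n.+1%:R ^+ 2) => u v; clearbody B; lra.
have n0 : 0 < n%:R :> R by rewrite ltr0n; case: n Tn' {IH1 IH2 Tn cA' n1} => //; rewrite mul0n leqNgt T0.
have := IH2 Tn'.
suff : A / n.+1%:R ^+ 3 <= A / n%:R ^+ 2 - A / n.+1%:R ^+ 2.
  move: cA'; move: (A / n.+1%:R ^+ 3) (A / n.+1%:R ^+ 2) (A / n%:R ^+ 2) (c _ / _) => u v w z.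
  by move: (\sum_(_ <= _ < _) _) => S; clearbody B; lra.
rewrite -mulrBr ler_wpM2l// -(natr1 n); set z : R := n%:R in n0 *.
have z1 : 0 < z + 1 by rewrite addr_gt0.
have -> : (z ^+ 2)^-1 - ((z + 1) ^+ 2)^-1 = (2 * z + 1) / (z ^+ 2 * (z + 1) ^+ 2).
  by field; rewrite !gt_eqF.
rewrite ler_pdivlMr ?mulr_gt0 ?exprn_gt0// mulrC ler_pdivrMr ?exprn_gt0//.
have z2 : 0 <= z ^+ 2 * (z + 1) ^+ 2 by rewrite mulr_ge0 ?exprn_ge0// ltW.
rewrite [X in _ <= _ * X]exprS [leRHS]mulrA [z ^+ 2 * _]mulrC [leRHS]mulrC ler_wpM2l ?exprn_ge0 ?ltW//.
nra.
Qed.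

Lemma del_sum_riesz q b h l e : (1 < q)%N -> (1 < b)%N -> ~ mult_dependent b q -> h != 0 ->
  0 < e -> exists T0, forall T, (T0 <= T)%N ->
   forall N, del_sum (fun k => fourier (riesz0 R q T T) (k - l)) b h N <= e.
Proof.
move=> q1 b1 ind h0 e0.
pose K := (Num.truncn (2 * b%:R ^+ 2 / e)).+1.
have [T1 HT1] := represented_pair_count l K b1 q1 ind h0.
have [T2 HT2] := represented_pair_vanish h l b1 q1.
exists (maxn 1 (maxn T1 T2)) => T; rewrite !geq_max => /and3P[T0 TT1 TT2] N.
have TR : 0 < T%:R :> R by rewrite ltr0n.
have KR : 0 < K%:R :> R by rewrite ltr0n.
pose c L : R := (pair_count (represented_pair q T b h l) L)%:R.
apply: (@le_trans _ _ (\sum_(1 <= L < N) c L / L%:R ^+ 3)).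
  apply: ler_sum => L _; rewrite ler_wpM2r ?invr_ge0 ?exprn_ge0//.
  rewrite /c /pair_count natr_sum; apply: ler_sum => m _.
  rewrite natr_sum; apply: ler_sum => n _.
  rewrite /represented_pair; case: asboolP => [_|H] /=.
    have := @fourier_riesz_le1 R q q1 T T (h * (b%:Z ^+ m - b%:Z ^+ n) - l).
    by rewrite fourier_riesz; apply: le_trans; rewrite lerDr.
  rewrite le_eqVlt; apply/orP; left; apply: contra_notT H.
  by move/(fourier_riesz0_supp q1); rewrite addnn -mul2n.
apply: le_trans (@weighted_tail c (T%:R ^+ 2 / K%:R) T b N T0 (ltnW b1) _ _) _.
- move=> L; rewrite ler0n/= ler_pdivlMr// mulrC -natrM -natrX ler_nat; exact: HT1.
- by move=> L LT; rewrite /c HT2.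
have -> : 2 * (T%:R ^+ 2 / K%:R) * b%:R ^+ 2 / T%:R ^+ 2 = 2 * b%:R ^+ 2 / K%:R :> R.
  by field; rewrite !gt_eqF.
by rewrite ler_pdivrMr// -ler_pdivrMl// mulrC /K ltW// truncnS_gt.
Qed.

Lemma del_sum_mul P s b h N : del_sum (fourier (cmul P s)) b h N =
  \sum_(c <- P) c.1 * ((del_sum (fun k => fourier s (k - c.2)) b h N +
    del_sum (fun k => fourier s (k - (- c.2))) b h N) / 2).
Proof.
rewrite /del_sum.
under [RHS]eq_bigr => c _ do rewrite -big_split/= mulr_suml mulr_sumr.
rewrite [RHS]exchange_big/=; apply: eq_bigr => L _.
transitivity (\sum_(0 <= m < L) \sum_(0 <= n < L) \sum_(c <- P)
   (c.1 * ((fourier s (h * (b%:Z ^+ m - b%:Z ^+ n) - c.2) +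
           fourier s (h * (b%:Z ^+ m - b%:Z ^+ n) - - c.2)) / 2)) / L%:R ^+ 3).
  rewrite mulr_suml; apply: eq_bigr => m _; rewrite mulr_suml; apply: eq_bigr => n _.
  by rewrite fourier_mul mulr_suml; apply: eq_bigr => c _; rewrite opprK.
transitivity (\sum_(0 <= m < L) \sum_(c <- P) \sum_(0 <= n < L)
   (c.1 * ((fourier s (h * (b%:Z ^+ m - b%:Z ^+ n) - c.2) +
           fourier s (h * (b%:Z ^+ m - b%:Z ^+ n) - - c.2)) / 2)) / L%:R ^+ 3).
  by apply: eq_bigr => m _; exact: exchange_big.
rewrite [LHS]exchange_big; apply: eq_bigr => c _.
transitivity (c.1 / 2 / L%:R ^+ 3 * \sum_(0 <= m < L)
  (\sum_(0 <= n < L) fourier s (h * (b%:Z ^+ m - b%:Z ^+ n) - c.2) +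
   \sum_(0 <= n < L) fourier s (h * (b%:Z ^+ m - b%:Z ^+ n) - - c.2))).
  rewrite mulr_sumr; apply: eq_bigr => m _.
  by rewrite -big_split/= mulr_sumr; apply: eq_bigr => n _; ring.
by rewrite big_split/=; ring.
Qed.

Lemma window_del P q b h e : (1 < q)%N -> (1 < b)%N -> ~ mult_dependent b q -> h != 0 ->
  0 < e -> nneg_coef P -> exists T0, forall T, (T0 <= T)%N ->
   forall N, del_sum (fourier (cmul P (riesz0 R q T T))) b h N <= e.
Proof.
move=> q1 b1 ind h0 e0 P0.
pose e' := e / (l1norm P + 1).
have l0 := l1norm_ge0 P.
have l1 : 0 < l1norm P + 1 by rewrite ltr_wpDl.
have e'0 : 0 < e' by rewrite divr_gt0.
have [|T0 HT0] := @eventually_all _ P (fun c T => forall N,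
  del_sum (fun k => fourier (riesz0 R q T T) (k - c.2)) b h N <= e' /\
  del_sum (fun k => fourier (riesz0 R q T T) (k - (- c.2))) b h N <= e').
  move=> c _; have [T1 H1] := del_sum_riesz c.2 q1 b1 ind h0 e'0.
  have [T2 H2] := del_sum_riesz (- c.2) q1 b1 ind h0 e'0.
  exists (maxn T1 T2) => T; rewrite geq_max => /andP[TT1 TT2] N.
  by split; [exact: H1 | exact: H2].
exists T0 => T TT0 N; rewrite del_sum_mul.
apply: (@le_trans _ _ (\sum_(c <- P) `|c.1| * e')).
  rewrite big_seq [leRHS]big_seq; apply: ler_sum => c cP.
  rewrite ger0_norm; last by move/allP: P0 => /(_ _ cP).
  rewrite ler_wpM2l//; first by move/allP: P0 => /(_ _ cP).
  by have [h1 h2] := HT0 T c TT0 cP N; lra.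
rewrite -mulr_suml -/(l1norm P) /e' mulrA ler_pdivrMr// mulrDr mulr1 mulrC.
by rewrite lerDl ltW.
Qed.

Lemma l1norm_riesz0 q T n : l1norm (riesz0 R q T n) <= 2 ^+ n.
Proof.
suff H : l1norm (riesz0 R q T n) + 1 <= 2 ^+ n by apply: le_trans H; rewrite lerDl.
elim: n => [|n IH]; first by rewrite /l1norm big_nil add0r expr0.
rewrite /= l1norm_cat [l1norm (cmul _ _ ++ _)]l1norm_cat l1norm_mul.
have -> : l1norm [:: (1 : R, unit_freq q (T + n))] = 1.
  by rewrite /l1norm big_seq1 normr1.
by rewrite exprS; lra.
Qed.

Lemma riesz0_freq q T n c : (1 < q)%N -> c \in riesz0 R q T n -> (4 ^ T <= `|c.2|)%N.
Proof.
move=> q1 /(mem_riesz0 q1)[c0 /rep_dvd /(absz_dvd_le c0)].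
rewrite abszX absz_nat; apply: leq_trans.
by rewrite -[4%N]/(2 ^ 2)%N -expnM pow2_lower.
Qed.

(** The absolute coefficients of the product add up to at most [2^T] times [l1norm P], while its
    frequencies are at least [4^T - D]; so its primitive is of order [2^-T]. *)
Lemma window_anti P q e : (1 < q)%N -> 0 < e -> exists T0, forall T, (T0 <= T)%N ->
  forall x, `|anti (cmul P (riesz0 R q T T)) x| <= e.
Proof.
move=> q1 e0.
pose D := degree P; pose K := (Num.truncn (l1norm P / e)).+1.
exists (D + K)%N => T TDK x.
have T2 : (D + K <= 2 ^ T)%N by apply: leq_trans TDK _; rewrite ltnW// ltn_expl.
have M0 : (0 < 2 ^ T * (2 ^ T - D))%N.
  by rewrite muln_gt0 expn_gt0/= subn_gt0; apply: leq_trans T2; rewrite addnS ltnS leq_addr.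
apply: le_trans (@norm_anti_le R (cmul P (riesz0 R q T T)) _ x M0 _) _.
  move=> c /mem_cmul[d dP [f /(riesz0_freq q1) fT H]].
  have dD := degree_mem dP.
  rewrite mulnBr -expnMn -[(2 * 2)%N]/4%N.
  have : (D <= 2 ^ T * D)%N by rewrite leq_pmull// expn_gt0.
  move: (2 ^ T * D)%N (4 ^ T)%N fT => X Y fT XD.
  rewrite -/D in dD.
  by case: H => ->; lia.
rewrite l1norm_mul natrM invfM.
have P2 : 0 < (2 ^ T)%:R :> R by rewrite ltr0n expn_gt0.
have P3 : 0 < (2 ^ T - D)%:R :> R.
  by rewrite ltr0n subn_gt0; apply: leq_trans T2; rewrite addnS ltnS leq_addr.
apply: (@le_trans _ _ (l1norm P / (2 ^ T - D)%:R)).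
  rewrite mulrA ler_wpM2r ?invr_ge0 ?ler0n// -mulrA ler_piMr ?l1norm_ge0//.
  by rewrite ler_pdivrMr// mul1r natrX; exact: l1norm_riesz0.
rewrite ler_pdivrMr// -ler_pdivrMl// mulrC.
apply: le_trans (ltW (truncnS_gt _)) _; rewrite -/K ler_nat leq_subRL//.
by apply: leq_trans T2; rewrite leq_addr.
Qed.

(** Test and Riesz product are nonnegative, so [P] may be replaced by the constant [l1norm P] that
    dominates it. *)
Lemma window_bias P q e : (1 < q)%N -> 0 < e -> exists T0, forall T, (T0 <= T)%N ->
  (0 < T)%N /\ fourier (cmul P (cmul (bias_test R q T) (riesz R q T T))) 0 <= e.
Proof.
move=> q1 e0.
pose K := (Num.truncn (l1norm P * 64 / e)).+1.
exists K => T KT; have T0 : (0 < T)%N by apply: leq_trans KT.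
have TR : 0 < T%:R :> R by rewrite ltr0n.
split => //; set V := cmul _ (riesz _ _ _ _).
apply: (@le_trans _ _ (fourier (cscale (l1norm P) V) 0)).
  apply: fourier0_le => x; rewrite cosp_mul cosp_scale ler_wpM2r//.
    by rewrite cosp_mul mulr_ge0 ?cosp_bias_test_ge0 ?cosp_riesz_ge0.
  exact: le_trans (ler_norm _) (norm_cosp_le _ _).
rewrite fourier_scale; apply: le_trans (ler_wpM2l (l1norm_ge0 P) (fourier_bias_test R q1 T0)) _.
rewrite mulrA ler_pdivrMr// -ler_pdivrMl// mulrC.
by apply: le_trans (ltW (truncnS_gt _)) _; rewrite ler_nat.
Qed.

End Stage.

Section StageLemma.
Variable R : realType.
Implicit Types (s t P : seq (R * int)) (x e : R) (k h l : int) (b q T N D : nat).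

Lemma cosp_flatten (I : Type) (g : I -> seq (R * int)) (r : seq I) x :
  cosp (flatten [seq g i | i <- r]) x = \sum_(i <- r) cosp (g i) x.
Proof.
elim: r => [|i r IH]; first by rewrite /cosp !big_nil.
by rewrite /= cosp_cat IH big_cons.
Qed.

Lemma fourier_flatten (I : Type) (g : I -> seq (R * int)) (r : seq I) k :
  fourier (flatten [seq g i | i <- r]) k = \sum_(i <- r) fourier (g i) k.
Proof.
elim: r => [|i r IH]; first by rewrite /fourier !big_nil.
by rewrite /= fourier_cat IH big_cons.
Qed.

Lemma fourier_mul_flatten (I : Type) P (g : I -> seq (R * int)) (r : seq I) k :
  fourier (cmul P (flatten [seq g i | i <- r])) k = \sum_(i <- r) fourier (cmul P (g i)) k.
Proof.
elim: r => [|i r IH].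
  by rewrite big_nil /fourier big_cmul big1// => c _; rewrite big_nil.
by rewrite /= fourier_mul_cat IH big_cons.
Qed.

Lemma anti_mul_flatten (I : Type) P (g : I -> seq (R * int)) (r : seq I) x :
  anti (cmul P (flatten [seq g i | i <- r])) x = \sum_(i <- r) anti (cmul P (g i)) x.
Proof.
elim: r => [|i r IH].
  by rewrite big_nil /anti big_cmul big1// => c _; rewrite big_nil.
by rewrite /= anti_mul_cat IH big_cons.
Qed.

Lemma sum_lacunary (u : nat -> R) (C : R) M : 0 <= C -> (forall j, 0 <= u j <= C) ->
  (forall i j, (i < j)%N -> u i = 0 \/ u j = 0) -> \sum_(0 <= j < M) u j <= C.
Proof.
move=> C0 uC lac; elim: M => [|M IH]; first by rewrite big_geq.
rewrite big_nat_recr//=; case: (eqVneq (u M) 0) => [->|uM]; first by rewrite addr0.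
rewrite big_nat big1 ?add0r; first by case/andP: (uC M).
by move=> i /andP[_ iM]; case: (lac i M iM) => // /eqP; rewrite (negbTE uM).
Qed.

Lemma fourier_mul_le_l1 P s k : nneg_coef P -> (forall i, fourier s i <= 1) ->
  fourier (cmul P s) k <= l1norm P.
Proof.
move=> /allP P0 s1; rewrite fourier_mul /l1norm big_seq [leRHS]big_seq.
apply: ler_sum => c cP; rewrite ger0_norm ?P0// ler_piMr ?P0//.
by have := s1 (k - c.2); have := s1 (k + c.2); lra.
Qed.

Lemma fourier_mul_riesz0_neq0 P q T D k : (1 < q)%N -> (degree P <= D)%N ->
  fourier (cmul P (riesz0 R q T T)) k != 0 ->
  (q ^ (2 * T) <= `|k| + D)%N /\ (`|k| <= q ^ (2 * (T + T)) + D)%N.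
Proof.
move=> q1 PD H.
have [c cP [y [y0 ry] ky]] : exists2 c, c \in P & exists2 y, y != 0 /\ rep q T (T + T) y &
    k = y + c.2 \/ k = y - c.2.
  have : has (fun c => (fourier (riesz0 R q T T) (k - c.2) != 0) ||
      (fourier (riesz0 R q T T) (k + c.2) != 0)) P.
    apply: contraR H => /hasPn H; rewrite fourier_mul big_seq big1// => c /H.
    by rewrite negb_or !negbK => /andP[/eqP -> /eqP ->]; rewrite addr0 mul0r mulr0.
  case/hasP => c cP /orP[] /(fourier_riesz0_supp q1) ry; exists c => //.
    by exists (k - c.2) => //; left; rewrite subrK.
  by exists (k + c.2) => //; right; rewrite addrK.
have cD := leq_trans (degree_mem cP) PD.
have := rep_bound q1 ry; have := absz_dvd_le y0 (rep_dvd ry); rewrite abszX absz_nat.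
move: (q ^ _)%N (q ^ _)%N => X Y h1 h2.
by move: c.2 cD ky => z zD [] ->; split; lia.
Qed.

(** The spectrum of a window lies between [q^(2T) - D] and [q^(4T) + D] in absolute value, so a
    little more than doubling [T] separates two windows. *)
Lemma windows_disjoint P q T T' D k : (1 < q)%N -> (degree P <= D)%N ->
  (2 * T + 2 * D < T')%N -> fourier (cmul P (riesz0 R q T T)) k = 0 \/
  fourier (cmul P (riesz0 R q T' T')) k = 0.
Proof.
move=> q1 PD TT; case: (eqVneq (fourier (cmul P (riesz0 R q T T)) k) 0) => [|/(fourier_mul_riesz0_neq0 q1 PD)[_ h1]]; [by left | right].
apply/eqP/negPn/negP => /(fourier_mul_riesz0_neq0 q1 PD)[h2 _].
have : (q ^ (2 * (T + T)) * 2 ^ (2 * D.+1) <= q ^ (2 * T'))%N.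
  apply: (@leq_trans (q ^ (2 * (T + T)) * q ^ (2 * D.+1))%N).
    by rewrite leq_mul2l (pow2_lower D.+1 q1) orbT.
  by rewrite -expnD leq_exp2l//; lia.
have : (2 * D.+1 < 2 ^ (2 * D.+1))%N by exact: ltn_expl.
have : (0 < q ^ (2 * (T + T)))%N by rewrite expn_gt0 (ltnW q1).
move: (q ^ _)%N (q ^ _)%N (2 ^ _)%N h1 h2 => X Y Z h1 h2 X0 DZ XZ.
nia.
Qed.

Lemma del_sum_average (I : Type) (r : seq I) (phi : I -> int -> R) (a : R) b h N :
  del_sum (fun k => \sum_(i <- r) a * phi i k) b h N = \sum_(i <- r) a * del_sum (phi i) b h N.
Proof.
rewrite /del_sum; under [RHS]eq_bigr => i _ do rewrite mulr_sumr.
rewrite [RHS]exchange_big/=; apply: eq_bigr => L _.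
under [RHS]eq_bigr => i _ do rewrite mulrA.
rewrite -mulr_suml; congr (_ / _).
under [RHS]eq_bigr => i _ do rewrite mulr_sumr.
rewrite [RHS]exchange_big/=; apply: eq_bigr => m _.
under [RHS]eq_bigr => i _ do rewrite mulr_sumr.
by rewrite [RHS]exchange_big.
Qed.

Lemma average_le (I : eqType) (r : seq I) (u : I -> R) (e : R) : (0 < size r)%N ->
  (forall i, i \in r -> u i <= e) -> \sum_(i <- r) (size r)%:R^-1 * u i <= e.
Proof.
move=> r0 H; have rR : 0 < (size r)%:R :> R by rewrite ltr0n.
rewrite -mulr_sumr ler_pdivrMl//.
apply: (@le_trans _ _ (\sum_(i <- r) e)).
  by rewrite big_seq [leRHS]big_seq; exact: ler_sum.
by rewrite big_const_seq count_predT iter_addr_0 mulr_natl.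
Qed.

(** Each Riesz product of the average only makes its own window biased; the minimum has small mean
    under all of them. The cap 1 is the threshold of the tests. *)
Definition window_min q (ts : seq nat) x : R :=
  foldr (fun T r => Num.min (cosp (bias_test R q T) x) r) 1 ts.

Definition lipschitz_fun (g : R -> R) :=
  exists2 L : R, 0 <= L & forall x y, `|g x - g y| <= L * `|x - y|.

Lemma lipschitz_funD (f g : R -> R) : lipschitz_fun f -> lipschitz_fun g ->
  lipschitz_fun (fun x => f x + g x).
Proof.
move=> [L L0 HL] [M M0 HM]; exists (L + M); first exact: addr_ge0.
move=> x y; rewrite opprD addrACA mulrDl; apply: le_trans (ler_normD _ _) _.
exact: lerD.
Qed.

Lemma lipschitz_fun_cst (a : R) : lipschitz_fun (fun=> a).
Proof. by exists 0 => // x y; rewrite subrr normr0 mul0r. Qed.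

Lemma lipschitz_fun_sum (F : nat -> R -> R) n : (forall i, lipschitz_fun (F i)) ->
  lipschitz_fun (fun x => \sum_(0 <= i < n) F i x).
Proof.
move=> H; elim: n => [|n IH].
  by under eq_fun do rewrite big_geq//; exact: lipschitz_fun_cst.
by under eq_fun do rewrite big_nat_recr//=; exact: lipschitz_funD.
Qed.

Lemma derive_bounded_lipschitz (f df : R -> R) (L : R) :
  (forall x, is_derive x (1 : R) f (df x)) -> (forall x, `|df x| <= L) ->
  forall x y, `|f x - f y| <= L * `|x - y|.
Proof.
move=> Df dfL x y; wlog xy : x y / x <= y.
  move=> H; have [/H //|/ltW /H] := leP x y.
  by rewrite distrC (distrC y).
have [c _ E] : exists2 c, c \in `[x, y]%R & f y - f x = df c * (y - x).
  apply: (@MVT_segment R f df x y xy) => //.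
  apply: continuous_subspaceT => z.
  apply: differentiable_continuous; apply/derivable1_diffP.
  by have := Df z; case.
by rewrite distrC (distrC x) E normrM ler_wpM2r.
Qed.

Lemma lipschitz_cosM (a : R) : lipschitz_fun (fun x => cos (a * x)).
Proof.
exists `|a| => // x y.
have H := @derive_bounded_lipschitz cos (fun x => - sin x) 1.
apply: le_trans (H _ _ (a * x) (a * y)) _; last by rewrite mul1r -mulrBr normrM.
by move=> z; rewrite normrN ler_norml sin_geN1 sin_le1.
Qed.

Lemma lipschitz_cosp s : lipschitz_fun (cosp s).
Proof.
elim: s => [|c s IH].
  have -> : cosp [::] = fun=> 0 :> R by apply/funext => x; rewrite /cosp big_nil.
  exact: lipschitz_fun_cst.
have -> : cosp (c :: s) = (fun x => c.1 * cos (2 * pi * c.2%:~R * x) + cosp s x).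
  by apply/funext => x; rewrite cosp_cons /cosp big_seq1.
apply: lipschitz_funD => //.
have [L L0 HL] := lipschitz_cosM (2 * pi * c.2%:~R).
exists (`|c.1| * L); first exact: mulr_ge0.
by move=> x y; rewrite -[leRHS]mulrA -mulrBr normrM ler_wpM2l.
Qed.

Lemma lipschitz_window_min q ts : lipschitz_fun (window_min q ts).
Proof.
elim: ts => [|T ts IH]; first exact: lipschitz_fun_cst.
have [L L0 HL] := lipschitz_cosp (bias_test R q T); have [M M0 HM] := IH.
exists (L + M); first exact: addr_ge0.
move=> x y /=; have := HL x y; have := HM x y.
have : 0 <= L * `|x - y| by rewrite mulr_ge0.
have : 0 <= M * `|x - y| by rewrite mulr_ge0.
rewrite mulrDl; move: (L * _) (M * _) => u v.
move: (window_min _ _ _) (window_min _ _ _) (cosp _ _) (cosp _ _) => z1 z2 z3 z4.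
rewrite !ler_norml => v0 u0 /andP[h1 h2] /andP[h3 h4].
by rewrite /Num.min /Order.min; do 2 case: ltP => ?; apply/andP; split; lra.
Qed.

Lemma window_min_ge0 q ts x : 0 <= window_min q ts x.
Proof.
by elim: ts => //= T ts IH; rewrite le_min IH cosp_bias_test_ge0.
Qed.

Lemma window_min_le q ts x T : T \in ts -> window_min q ts x <= cosp (bias_test R q T) x.
Proof.
elim: ts => //= T' ts IH; rewrite in_cons ge_min => /orP[/eqP ->|/IH ->]; last by rewrite orbT.
by rewrite lexx.
Qed.

Lemma window_min_lt1 q ts x : window_min q ts x < 1 ->
  exists2 T, T \in ts & cosp (bias_test R q T) x < 1.
Proof.
elim: ts => [|T ts IH] /=; first by rewrite ltxx.
rewrite gt_min => /orP[H|/IH[T' T'ts H]]; first by exists T; rewrite ?mem_head.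
by exists T' => //; rewrite in_cons T'ts orbT.
Qed.

(** [D] bounds the frequencies that must not be disturbed. Most requirements hold for each window
    that is far enough out; the smallness of single Fourier coefficients comes from averaging. [W]
    averages the products of [P], the test of a window and the Riesz product of the same window. *)
Lemma stage q P D (BH : seq (nat * int)) e (T0 : nat) : (1 < q)%N -> 0 < e ->
  nneg_coef P -> (degree P <= D)%N -> (forall x, 0 <= cosp P x) ->
  (forall bh, bh \in BH -> [/\ (1 < bh.1)%N, ~ mult_dependent bh.1 q & bh.2 != 0]) ->
  exists (f W : seq (R * int)) (H : R -> R),
  [/\ nneg_coef f, (forall c, c \in f -> (D < `|c.2|)%N),
      (forall x, 0 <= 1 + cosp f x), (forall k, fourier (cmul P f) k <= e) &
      forall bh N, bh \in BH -> del_sum (fourier (cmul P f)) bh.1 bh.2 N <= e] /\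
  [/\ (forall x, `|anti (cmul P f) x| <= e), lipschitz_fun H /\ (forall x, 0 <= H x),
      (forall x, H x < 1 -> exists2 T, (T0 <= T)%N &
         T%:R / 4 <= \sum_(2 * T <= n < 4 * T) cos (2 * pi * (q%:Z ^+ n)%:~R * x)),
      (forall x, H x * (cosp P x * (1 + cosp f x)) <= cosp W x) & fourier W 0 <= e].
Proof.
move=> q1 e0 P0 PD Ppos HBH.
have [|T1 HT1] := @eventually_all _ BH (fun bh T => forall N,
    del_sum (fourier (cmul P (riesz0 R q T T))) bh.1 bh.2 N <= e).
  by move=> bh /HBH[b1 ind h0]; exact: window_del.
have [T2 HT2] := window_anti P q1 e0.
have [T3 HT3] := window_bias P q1 e0.
pose A := (T0 + T1 + T2 + T3 + 2 * D + 1)%N.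
(* A coefficient is nonzero in at most one window, where it is at most [l1norm P]; more than
   [l1norm P / e] windows bring the average below [e]. *)
pose M := (Num.truncn (l1norm P / e)).+1.
(* Ratio 3 and [A > 2 D] give [2 T + 2 D < T'] for successive windows, hence disjoint spectra. *)
pose ts := [seq (A * 3 ^ j)%N | j <- index_iota 0 M].
have szts : size ts = M by rewrite size_map size_iota.
have sz0 : (0 < size ts)%N by rewrite szts.
have MR : 0 < (size ts)%:R :> R by rewrite ltr0n.
have tsA T : T \in ts -> (A <= T)%N.
  by move=> /mapP[j _ ->]; rewrite leq_pmulr// expn_gt0.
have tsP T : T \in ts -> [/\ (T0 <= T)%N, (T1 <= T)%N, (T2 <= T)%N & (T3 <= T)%N] /\
    ((0 < T)%N /\ (D < T)%N).
  by move=> /tsA; rewrite /A => H; split; [split|split]; lia.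
set a : R := (size ts)%:R^-1.
have a0 : 0 <= a by rewrite invr_ge0.
pose f : seq (R * int) := flatten [seq cscale a (riesz0 R q T T) | T <- ts].
pose W := flatten [seq cscale a (cmul P (cmul (bias_test R q T) (riesz R q T T))) | T <- ts].
have f1 x : 1 + cosp f x = \sum_(T <- ts) a * cosp (riesz R q T T) x.
  rewrite /f cosp_flatten; under [RHS]eq_bigr => T _ do rewrite cosp_cons cosp1 mulrDr mulr1.
  rewrite big_split/= big_const_seq count_predT iter_addr_0.
  congr (_ + _); first by rewrite -mulr_natr mulVf// gt_eqF.
  by apply: eq_bigr => T _; rewrite cosp_scale.
have fPf k : fourier (cmul P f) k = \sum_(T <- ts) a * fourier (cmul P (riesz0 R q T T)) k.
  by rewrite /f fourier_mul_flatten; apply: eq_bigr => T _; rewrite fourier_mul_scale.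
exists f, W, (window_min q ts); split; split.
- apply/allP => c /flattenP[_ /mapP[T _ ->]].
  by move: c; apply/allP; apply: nneg_coef_scale => //; exact: nneg_coef_riesz0.
- move=> c /flattenP[_ /mapP[T /tsP[_ [_ DT]] ->] /mapP[d dr ->]] /=.
  apply: leq_trans DT _; apply: leq_trans (riesz0_freq q1 dr).
  by rewrite ltnW// ltn_expl.
- move=> x; rewrite f1; apply: sumr_ge0 => T _; rewrite mulr_ge0//; exact: cosp_riesz_ge0.
- move=> k; rewrite fPf -mulr_sumr ler_pdivrMl// /ts big_map.
  apply: (@le_trans _ _ (l1norm P)); last first.
    by rewrite -ler_pdivrMr// szts ltW// truncnS_gt.
  apply: sum_lacunary; first exact: l1norm_ge0.
    move=> j; rewrite fourier_ge0 ?nneg_coef_mul ?nneg_coef_riesz0//=.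
    apply: fourier_mul_le_l1 => // i.
    have := @fourier_riesz_le1 R q q1 (A * 3 ^ j) (A * 3 ^ j) i.
    by rewrite fourier_riesz; apply: le_trans; rewrite lerDr.
  move=> i j ij; apply: (windows_disjoint k q1 PD).
  have : (3 ^ i.+1 <= 3 ^ j)%N by rewrite leq_exp2l.
  have : (2 * D < A)%N by rewrite /A; lia.
  have : (0 < 3 ^ i)%N by rewrite expn_gt0.
  rewrite expnS; move: (3 ^ i)%N (3 ^ j)%N => u v; nia.
- move=> bh N bhB.
  have -> : fourier (cmul P f) = fun k => \sum_(T <- ts) a * fourier (cmul P (riesz0 R q T T)) k.
    by apply/funext => k; exact: fPf.
  rewrite del_sum_average; apply: average_le => // T /tsP[[_ TT1 _ _] _].
  exact: HT1.
- move=> x; rewrite /f anti_mul_flatten.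
  apply: le_trans (ler_norm_sum _ _ _) _.
  under eq_bigr => T _ do rewrite anti_mul_scale normrM (ger0_norm a0).
  by apply: average_le => // T /tsP[[_ _ TT2 _] _]; exact: HT2.
- by split; [exact: lipschitz_window_min | exact: window_min_ge0].
- move=> x /window_min_lt1[T /tsP[[TT0 _ _ _] [T0' _]] H]; exists T => //.
  exact: cosp_bias_test_lt1.
- move=> x; rewrite f1 /W cosp_flatten !mulr_sumr big_seq [leRHS]big_seq.
  apply: ler_sum => T Tts; rewrite cosp_scale !cosp_mul.
  rewrite (_ : _ * (_ * (a * _)) = a * (cosp P x * (window_min q ts x * cosp (riesz R q T T) x))).
    2: by ring.
  rewrite ler_wpM2l// ler_wpM2l// ler_wpM2r ?cosp_riesz_ge0//.
  exact: window_min_le.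
- rewrite /W fourier_flatten; under eq_bigr => T _ do rewrite fourier_scale.
  by apply: average_le => // T /tsP[[_ _ _ TT3] _]; have [] := HT3 T TT3.
Qed.

End StageLemma.

(** * The sequence of densities *)

Section Approximants.
Variable R : realType.
Implicit Types (s t P f W : seq (R * int)) (x e : R) (k : int) (b q T N D i j n : nat).

Lemma sum_half_pow K n : \sum_(K <= i < n) 2^-1 ^+ i <= 2 * 2^-1 ^+ K :> R.
Proof.
have [nK|Kn] := leqP n K; first by rewrite big_geq// mulr_ge0// exprn_ge0// invr_ge0.
suff -> : \sum_(K <= i < n) 2^-1 ^+ i = 2 * 2^-1 ^+ K - 2 * 2^-1 ^+ n :> R.
  by rewrite gerBl mulr_ge0// exprn_ge0// invr_ge0.
elim: n Kn => // n IH; rewrite ltnS leq_eqVlt => /orP[/eqP ->|Kn].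
  by rewrite big_nat1 exprS; field.
by rewrite big_nat_recr/= 1?ltnW// IH// exprS; field.
Qed.

Lemma sum_inv_sqr n : \sum_(1 <= L < n) (L%:R ^+ 2)^-1 <= 2 :> R.
Proof.
suff H m : \sum_(1 <= L < m.+2) (L%:R ^+ 2)^-1 <= 2 - m.+1%:R^-1 :> R.
  case: n => [|[|n]]; [by rewrite big_geq | by rewrite big_geq |].
  by apply: le_trans (H n) _; rewrite gerBl invr_ge0.
elim: m => [|m IH]; first by rewrite big_nat1 expr1n invr1; lra.
rewrite big_nat_recr//=; apply: le_trans (lerD IH (lexx _)) _.
rewrite -(natr1 m.+1); set z : R := m.+1%:R.
have z0 : 0 < z by rewrite ltr0n.
have z1 : 0 < z + 1 by rewrite addr_gt0.
suff : ((z + 1) ^+ 2)^-1 <= z^-1 - (z + 1)^-1.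
  by move: (_^-1) (z^-1) (_^-1) => u v w; lra.
have -> : z^-1 - (z + 1)^-1 = (z * (z + 1))^-1 by field; rewrite !gt_eqF.
rewrite lef_pV2 ?posrE ?exprn_gt0 ?mulr_gt0// expr2.
by apply: ler_wpM2r; [exact: ltW | rewrite lerDl].
Qed.

(** Beyond the degree [D] of [P] the differences exceed every frequency: a row has at most [D + 2]
    nonzero entries, the diagonal one and those with [n <= D]. The double sum is thus at most linear
    in [L], and the series is dominated by that of [L^-2]. *)
Lemma del_sum_finite P b h : nneg_coef P -> (1 < b)%N -> h != 0 ->
  exists C, forall N, del_sum (fourier P) b h N <= C.
Proof.
move=> P0 b1 h0; set D := degree P.
have C0 := l1norm_ge0 P.
have F1 k : fourier P k <= l1norm P.
  move/allP: P0 => P0; rewrite /fourier /l1norm big_seq [leRHS]big_seq.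
  apply: ler_sum => c cP; rewrite ger0_norm ?P0// ler_piMr ?P0//.
  by do 2 case: (_ == _) => /=; lra.
have far m n : (n < m)%N -> (D < m)%N -> (D < `|(h * (b%:Z ^+ m - b%:Z ^+ n))%R|)%N.
  move=> nm Dm; rewrite abszM; apply: (@leq_trans `|(b%:Z ^+ m - b%:Z ^+ n)%R|); last first.
    by rewrite leq_pmull// lt0n absz_eq0.
  have : (b ^ n <= b ^ m.-1)%N by rewrite leq_exp2l//; case: m nm {Dm}.
  have : (2 * b ^ m.-1 <= b ^ m)%N by case: m nm {Dm} => // m _; rewrite expnS leq_mul2r b1 orbT.
  have : (m.-1 < b ^ m.-1)%N by exact: ltn_expl.
  rewrite -!PoszX; move: (b ^ n)%N (b ^ m)%N (b ^ m.-1)%N => u v w.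
  by clear -Dm; lia.
have row m L : \sum_(0 <= n < L) fourier P (h * (b%:Z ^+ m - b%:Z ^+ n)) <=
    l1norm P * (D.+2)%:R.
  apply: (@le_trans _ _ (\sum_(0 <= n < L) l1norm P * (((m <= n) && (n < m + 1))%N +
     ((0 <= n) && (n < 0 + D.+1))%N)%:R)).
    apply: ler_sum => n _; rewrite addn1 ltnS add0n leq0n /= -eqn_leq.
    have [nD|Dn] := ltnP n D.+1.
      by apply: le_trans (F1 _) _; rewrite ler_peMr// ler1n addn1.
    case: (eqVneq m n) => [_|mn]; first by apply: le_trans (F1 _) _; rewrite mulr1.
    rewrite mulr0; case: (ltngtP m n) mn => // mn _; rewrite fourier_deg//; last first.
      by rewrite far// (leq_trans Dn)// ltnW.
    rewrite (_ : _ - _ = - (b%:Z ^+ n - b%:Z ^+ m)); last by ring.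
    by rewrite mulrN abszN far.
  rewrite -mulr_sumr ler_wpM2l// -natr_sum ler_nat big_split/=.
  exact: (leq_add (row_band 1 L m) (row_band D.+1 L 0)).
exists (l1norm P * D.+2%:R * 2) => N.
apply: (@le_trans _ _ (\sum_(1 <= L < N) (l1norm P * D.+2%:R) * (L%:R ^+ 2)^-1)).
  apply: ler_sum_nat => L /andP[L0 _].
  have LR : 0 < L%:R :> R by rewrite ltr0n.
  rewrite ler_pdivrMr ?exprn_gt0//.
  have -> : l1norm P * D.+2%:R / L%:R ^+ 2 * L%:R ^+ 3 = (l1norm P * D.+2%:R) *+ L.
    rewrite -[RHS]mulr_natr; move: (l1norm P * _) => z; field; rewrite gt_eqF//.
  rewrite -[X in _ *+ X](subn0 L) -sumr_const_nat; apply: ler_sum => m _; exact: row.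
by rewrite -mulr_sumr ler_wpM2l ?mulr_ge0// sum_inv_sqr.
Qed.

(* [logn 2 i.+1] takes every value for infinitely many [i]. *)
Lemma stage_choice (B B' : set nat) (i : nat) P D :
  B `<=` bases -> B' `<=` bases -> compatible B B' ->
  nneg_coef P -> (degree P <= D)%N -> (forall x, 0 <= cosp P x) ->
  exists f W (H : R -> R),
  [/\ nneg_coef f, (forall c, c \in f -> (D < `|c.2|)%N),
      (forall x, 0 <= 1 + cosp f x), (forall k, fourier (cmul P f) k <= 2^-1 ^+ i) &
      forall b (h : nat) N, B b -> (b < i)%N -> (0 < h < i)%N ->
        del_sum (fourier (cmul P f)) b h%:Z N <= 2^-1 ^+ i] /\
  [/\ (forall x, `|anti (cmul P f) x| <= 2^-1 ^+ i), lipschitz_fun H /\ (forall x, 0 <= H x),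
      (B' (logn 2 i.+1) -> forall x, H x < 1 -> exists2 T, (i <= T)%N &
         T%:R / 4 <= \sum_(2 * T <= n < 4 * T)
           cos (2 * pi * ((logn 2 i.+1)%:Z ^+ n)%:~R * x)),
      (forall x, H x * (cosp P x * (1 + cosp f x)) <= cosp W x) &
      fourier W 0 <= 2^-1 ^+ i].
Proof.
move=> BB BB' comp P0 PD Ppos.
have e0 : 0 < 2^-1 ^+ i :> R by rewrite exprn_gt0// invr_gt0.
case: (pselect (B' (logn 2 i.+1))) => [B'q|nB'].
  have q1 := BB' _ B'q; set q := logn 2 i.+1 in B'q q1 *.
  (* Finitely many pairs [(b, h)] are imposed at each stage, and every pair is imposed at all
     sufficiently late stages. *)
  pose BH := [seq (b, h%:Z) | b <- [seq b <- iota 0 i | `[< B b >]], h <- iota 1 i].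
  have [|f [W [H [[S1 S2 S3 S4 S5] [S6 S7 S8 S9 S10]]]]] :=
    @stage R q P D BH _ i q1 e0 P0 PD Ppos.
    move=> _ /allpairsP[[b h] /= [bi hi ->]] /=.
    move: bi; rewrite mem_filter => /andP[/asboolP Bb _]; split.
    - exact: BB.
    - exact: comp.
    - by move: hi; rewrite mem_iota => /andP[]; case: h.
  exists f, W, H; split; split => //.
  move=> b h N Bb bi /andP[h0 hi]; apply: (S5 (b, h%:Z) N).
  apply/allpairsP; exists (b, h); split => //=.
    by rewrite mem_filter mem_iota/= add0n bi andbT; apply/asboolP.
  by rewrite mem_iota h0 add1n ltnS ltnW.
have F0 k : fourier (cmul P [::]) k = 0.
  by rewrite /fourier big_cmul big1// => c _; rewrite big_nil.
have N0 : fourier [::] 0 = 0 :> R by rewrite /fourier big_nil.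
(* No base to serve: the density is left unchanged, and the clause on [B'] is vacuous. *)
exists [::], [::], (fun=> 0); split; split => //.
- by move=> x; rewrite /cosp big_nil addr0.
- by move=> k; rewrite F0 ltW.
- move=> b h N _ _ _; rewrite /del_sum big1 ?ltW// => L _.
  by rewrite big1 ?mul0r// => m _; rewrite big1.
- move=> x; rewrite /anti big_cmul big1 ?normr0 ?ltW// => c _; by rewrite big_nil.
- by split => //; exact: lipschitz_fun_cst.
- by move=> x; rewrite mul0r /cosp big_nil.
- by rewrite N0 ltW.
Qed.

Lemma del_sumD (phi psi : int -> R) b h N :
  del_sum (fun k => phi k + psi k) b h N = del_sum phi b h N + del_sum psi b h N.
Proof.
rewrite /del_sum -big_split; apply: eq_bigr => L _ /=; rewrite -mulrDl; congr (_ / _).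
by rewrite -big_split; apply: eq_bigr => m _ /=; rewrite -big_split.
Qed.

(** All that is used later about the densities. By the last clause the partial sums of the tests
    [H j] keep a mean of at most 2 under all later densities. *)
Theorem approximants (B B' : set nat) :
  B `<=` bases -> B' `<=` bases -> compatible B B' ->
  exists (P : nat -> seq (R * int)) (H : nat -> R -> R),
  [/\ forall i, [/\ forall x, 0 <= cosp (P i) x, fourier (P i) 0 = 1 &
        forall k, 0 <= fourier (P i) k],
      forall i x, `|anti (P i.+1) x - anti (P i) x| <= 2^-1 ^+ i,
      forall e, 0 < e -> exists M, forall i k, (M <= `|k|)%N -> fourier (P i) k <= e,
      forall b (h : nat), B b -> (0 < h)%N ->
        exists C, forall i N, del_sum (fourier (P i)) b h%:Z N <= C &
   [/\ forall i, lipschitz_fun (H i) /\ (forall x, 0 <= H i x),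
      forall q, B' q -> forall K, exists2 i, (K <= i)%N & forall x, H i x < 1 ->
        exists2 T, (i <= T)%N & T%:R / 4 <=
          \sum_(2 * T <= n < 4 * T) cos (2 * pi * (q%:Z ^+ n)%:~R * x) &
      forall n i, (n <= i)%N -> exists W,
        (forall x, (\sum_(0 <= j < n) H j x) * cosp (P i) x <= cosp W x) /\
        fourier W 0 <= 2]].
Proof.
move=> BB BB' comp.
(* The second component dominates the degrees of the density and of all polynomials [W] produced so
   far. *)
pose state := (seq (R * int) * nat)%type.
pose good (s : state) := [/\ nneg_coef s.1, (degree s.1 <= s.2)%N & forall x, 0 <= cosp s.1 x].
pose spec i (s : state) (o : seq (R * int) * seq (R * int) * (R -> R)) :=
  [/\ nneg_coef o.1.1, (forall c, c \in o.1.1 -> (s.2 < `|c.2|)%N),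
      (forall x, 0 <= 1 + cosp o.1.1 x), (forall k, fourier (cmul s.1 o.1.1) k <= 2^-1 ^+ i) &
      forall b (h : nat) N, B b -> (b < i)%N -> (0 < h < i)%N ->
        del_sum (fourier (cmul s.1 o.1.1)) b h%:Z N <= 2^-1 ^+ i] /\
  [/\ (forall x, `|anti (cmul s.1 o.1.1) x| <= 2^-1 ^+ i),
      lipschitz_fun o.2 /\ (forall x, 0 <= o.2 x),
      (B' (logn 2 i.+1) -> forall x, o.2 x < 1 -> exists2 T, (i <= T)%N &
         T%:R / 4 <= \sum_(2 * T <= n < 4 * T)
           cos (2 * pi * ((logn 2 i.+1)%:Z ^+ n)%:~R * x)),
      (forall x, o.2 x * (cosp s.1 x * (1 + cosp o.1.1 x)) <= cosp o.1.2 x) &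
      fourier o.1.2 0 <= 2^-1 ^+ i].
have /choice[step stepP] (a : nat * state) : exists o, good a.2 -> spec a.1 a.2 o.
  case: (pselect (good a.2)) => [[g1 g2 g3]|ng].
    have [f [W [H HH]]] := stage_choice a.1 BB BB' comp g1 g2 g3.
    by exists (f, W, H).
  by exists ([::], [::], fun=> 0).
pose fix st i : state := if i is j.+1 then
    let s := st j in let o := step (j, s) in
    (s.1 ++ cmul s.1 o.1.1, s.2 + degree o.1.1 + degree o.1.2)%N
  else ([:: (1, 0)], 0%N).
pose o i := step (i, st i); pose P i := (st i).1; pose D i := (st i).2.
pose f i := (o i).1.1; pose W i := (o i).1.2; pose H i := (o i).2.
have PS i : P i.+1 = P i ++ cmul (P i) (f i) by [].
have DS i : D i.+1 = (D i + degree (f i) + degree (W i))%N by [].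
have cP i x : cosp (P i.+1) x = cosp (P i) x * (1 + cosp (f i) x).
  by rewrite PS cosp_cat cosp_mul mulrDr mulr1.
have G i : good (st i).
  elim: i => [|i IH].
    split => [||x]; rewrite /= ?ler01//; first by rewrite /degree big_seq1.
    by rewrite cosp1.
  have [[s1 s2 s3 s4 s5] _] := stepP (i, st i) IH; case: IH => g1 g2 g3; split.
  - by rewrite /= nneg_coef_cat g1 nneg_coef_mul.
  - rewrite /= degree_cat geq_max; apply/andP; split.
      by apply: leq_trans g2 _; rewrite -addnA leq_addr.
    apply: leq_trans (degree_mul _ _) _; apply: leq_trans (leq_addr _ _).
    by rewrite leq_add2r.
  - by move=> x; rewrite -/(P i.+1) cP mulr_ge0 ?g3 ?s3.
have S i : spec i (st i) (o i) by exact: (stepP (i, st i) (G i)).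
(* Coefficients never decrease, and stage [i] adds at most [2^-i] to each; upper bounds thus pass to
   earlier and to later densities. *)
have mono i j k : (i <= j)%N -> fourier (P i) k <= fourier (P j) k.
  elim: j => [|j IH]; first by rewrite leqn0 => /eqP ->.
  rewrite leq_eqVlt ltnS => /orP[/eqP ->//|/IH ij]; apply: le_trans ij _.
  rewrite PS fourier_cat lerDl fourier_ge0// nneg_coef_mul//; first by case: (G j).
  by have [[]] := S j.
have tail i j k : (i <= j)%N -> fourier (P j) k <= fourier (P i) k + \sum_(i <= a < j) 2^-1 ^+ a.
  elim: j => [|j IH]; first by rewrite leqn0 => /eqP ->; rewrite big_geq// addr0.
  rewrite leq_eqVlt ltnS => /orP[/eqP ->|ij]; first by rewrite big_geq// addr0.
  rewrite big_nat_recr//= addrA PS fourier_cat; apply: lerD; first exact: IH.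
  by have [[]] := S j.
have tail_del i j b (h : nat) N : (i <= j)%N -> B b -> (b < i)%N -> (0 < h < i)%N ->
   del_sum (fourier (P j)) b h%:Z N <=
   del_sum (fourier (P i)) b h%:Z N + \sum_(i <= a < j) 2^-1 ^+ a.
  move=> + Bb bi hi; elim: j => [|j IH]; first by rewrite leqn0 => /eqP ->; rewrite big_geq// addr0.
  rewrite leq_eqVlt ltnS => /orP[/eqP ->|ij]; first by rewrite big_geq// addr0.
  rewrite big_nat_recr//= addrA.
  have -> : fourier (P j.+1) = fun k => fourier (P j) k + fourier (cmul (P j) (f j)) k.
    by apply/funext => k; rewrite PS fourier_cat.
  rewrite del_sumD; apply: lerD; first exact: IH.
  have [[_ _ _ _ s5] _] := S j; apply: s5 => //; first exact: leq_trans ij.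
  by case/andP: hi => -> hi; rewrite (leq_trans hi).
exists P, H; split.
- move=> i; split; first by case: (G i).
    elim: i => [|i IH]; first by rewrite fourier1 eqxx.
    have [[_ s2 _ _ _] _] := S i; have [_ g2 _] := G i.
    by rewrite PS fourier_cat IH (fourier_mul_small g2 s2) addr0.
  by move=> k; apply: fourier_ge0; case: (G i).
- move=> i x; rewrite PS anti_cat addrAC subrr add0r.
  by have [_ []] := S i.
- move=> e e0.
  have [K HK] : exists K, 2 * 2^-1 ^+ K <= e.
    pose K := (Num.truncn (2 / e)).+1; exists K.
    have pK : 0 < 2 ^+ K :> R by rewrite exprn_gt0.
    rewrite exprVn ler_pdivrMr// -ler_pdivrMl// mulrC.
    apply: le_trans (ltW (truncnS_gt _)) _; rewrite -/K -natrX ler_nat.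
    by rewrite ltnW// ltn_expl.
  exists (degree (P K)).+1 => i k kM.
  have [iK|Ki] := leqP i K.
    by apply: le_trans (mono _ _ k iK) _; rewrite fourier_deg// ltW.
  apply: le_trans (tail _ _ k (ltnW Ki)) _; rewrite fourier_deg// add0r.
  exact: le_trans (sum_half_pow _ _) HK.
(* From stage [b + h + 1] on the pair [(b, h)] is controlled; the 2 bounds the sum of all later
   [2^-a]. *)
- move=> b h Bb h0; pose i0 := (b + h).+1.
  have gP : nneg_coef (P i0) by case: (G i0).
  have hn0 : h%:Z != 0 by case: h h0 {i0 gP}.
  have [C HC] := del_sum_finite gP (BB _ Bb) hn0.
  exists (C + 2) => i N.
  have C2 : del_sum (fourier (P (maxn i i0))) b h%:Z N <= C + 2.
    apply: le_trans (tail_del i0 _ _ _ _ (leq_maxr _ _) Bb _ _) _.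
    + by rewrite ltnS leq_addr.
    + by rewrite h0 ltnS leq_addl.
    apply: lerD; first exact: HC.
    apply: le_trans (sum_half_pow _ _) _.
    by rewrite ler_piMr// exprn_ile1 ?invr_ge0// invf_le1// ler1n.
  apply: le_trans C2; apply: ler_sum => L _; rewrite ler_wpM2r ?invr_ge0 ?exprn_ge0//.
  by apply: ler_sum => m _; apply: ler_sum => n _; apply: mono; exact: leq_maxl.
split.
- by move=> i; have [_ []] := S i.
(* [i + 1 = 2^q (2 K + 1)] has 2-adic valuation [q], and [i >= K]. *)
- move=> q B'q K; exists (2 ^ q * (2 * K).+1).-1.
    by have : (0 < 2 ^ q)%N := expn_gt0 2 q; move: (2 ^ q)%N => Z; nia.
  have E : logn 2 (2 ^ q * (2 * K).+1).-1.+1 = q.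
    rewrite prednK ?muln_gt0 ?expn_gt0// lognM ?expn_gt0// pfactorK//.
    by rewrite logn_coprime ?addn0// prime_coprime// dvdn2 /= mul2n odd_double.
  move=> x Hx; have [_ [_ _ s _ _]] := S (2 ^ q * (2 * K).+1).-1.
  by move: s; rewrite E => s; exact: s.
- move=> n i ni.
  (* The polynomial [W j] is carried to stage [i] by the factors [1 + cosp (f a)]. Their frequencies
     lie above the degree reached so far, so the mean does not change. *)
  have HW j : (j < i)%N -> exists V, [/\ (degree V <= D i)%N,
      (forall x, H j x * cosp (P i) x <= cosp V x) & fourier V 0 <= 2^-1 ^+ j].
    elim: i {ni} => // i IH; rewrite ltnS leq_eqVlt => /orP[/eqP ->|/IH[V [V1 V2 V3]]].
      have [_ [_ _ _ s9 s10]] := S i.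
      exists (W i); split; [by rewrite DS leq_addl| |exact: s10].
      by move=> x; rewrite cP; exact: s9.
    have [[_ s2 s3 _ _] _] := S i.
    exists (V ++ cmul V (f i)); split.
    + rewrite degree_cat geq_max DS; apply/andP; split.
        by apply: leq_trans V1 _; rewrite -addnA leq_addr.
      apply: leq_trans (degree_mul _ _) _; apply: leq_trans (leq_addr _ _).
      by rewrite leq_add2r.
    + move=> x; rewrite cP cosp_cat cosp_mul mulrA.
      have -> : cosp V x + cosp V x * cosp (f i) x = cosp V x * (1 + cosp (f i) x) by ring.
      by apply: ler_wpM2r; [exact: s3 | exact: V2].
    + by rewrite fourier_cat (fourier_mul_small V1 s2) addr0.
  have [V HV] : exists V : nat -> seq (R * int), forall j, (j < i)%N ->
      (forall x, H j x * cosp (P i) x <= cosp (V j) x) /\ fourier (V j) 0 <= 2^-1 ^+ j.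
    have /choice[V HV] j : exists V, (j < i)%N ->
      (forall x, H j x * cosp (P i) x <= cosp V x) /\ fourier V 0 <= 2^-1 ^+ j.
      by have [/HW[V [_ v2 v3]]|_] := ltnP j i; [exists V | exists [::]].
    by exists V.
  exists (flatten [seq V j | j <- index_iota 0 n]); split => [x|].
    rewrite cosp_flatten mulr_suml; apply: ler_sum_nat => j /andP[_ jn].
    by have [h1 _] := HV j (leq_trans jn ni); exact: h1.
  rewrite fourier_flatten; apply: (@le_trans _ _ (\sum_(0 <= j < n) 2^-1 ^+ j)).
    apply: ler_sum_nat => j /andP[_ jn].
    by have [_ h2] := HV j (leq_trans jn ni).
  by apply: le_trans (sum_half_pow _ _) _; rewrite expr0 mulr1.
Qed.

End Approximants.

(** * The limit measure *)

Section LimitMeasure.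
Variables (R : realType) (P : nat -> seq (R * int)).
Hypothesis P_ge0 : forall i x, 0 <= cosp (P i) x.
Hypothesis P_mean : forall i, fourier (P i) 0 = 1.
Hypothesis P_cauchy : forall i x, `|anti (P i.+1) x - anti (P i) x| <= 2^-1 ^+ i.
Implicit Types (x y : R) (i j : nat).

Definition clamp01 x : R := Num.max 0 (Num.min 1 x).
Definition cdf_approx i x := anti (P i) (clamp01 x).
(* The uniform limit of [cdf_approx i]: each term of the infimum is an upper bound of it. *)
Definition cdf_limit x := inf [set cdf_approx i x + 2 * 2^-1 ^+ i | i in [set: nat]].

Lemma clamp01_id x : 0 <= x <= 1 -> clamp01 x = x.
Proof. by move=> /andP[x0 x1]; rewrite /clamp01 (min_idPr x1) (max_idPr x0). Qed.

Lemma clamp01_cases x : [\/ x <= 0 /\ clamp01 x = 0, 0 <= x <= 1 /\ clamp01 x = x |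
  1 <= x /\ clamp01 x = 1].
Proof.
have [x0|x0] := leP x 0.
  by constructor 1; rewrite /clamp01 (min_idPr _) ?(le_trans x0)// (max_idPl _).
have [x1|x1] := leP x 1; last first.
  by constructor 3; rewrite /clamp01 (min_idPl _) ?ltW// (max_idPr _).
have h : 0 <= x <= 1 by rewrite (ltW x0) x1.
by constructor 2; split; [rewrite (ltW x0) | exact: clamp01_id].
Qed.

Lemma clamp01_nd x y : x <= y -> clamp01 x <= clamp01 y.
Proof.
by case: (clamp01_cases x) => -[? ->]; case: (clamp01_cases y) => -[? ->]; lra.
Qed.

Lemma clamp01_lip x y : `|clamp01 x - clamp01 y| <= `|x - y|.
Proof.
have h1 := ler_norm (x - y); have h2 := ler_norm (y - x); rewrite distrC in h2.
case: (clamp01_cases x) => -[? ->]; case: (clamp01_cases y) => -[? ->];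
  by rewrite ler_norml; apply/andP; split; move: h1 h2; lra.
Qed.

Lemma cdf_approx_nd i x y : x <= y -> cdf_approx i x <= cdf_approx i y.
Proof.
move=> xy; rewrite -subr_ge0.
have := @anti_le R [::] (P i) _ _ (clamp01_nd xy).
rewrite {1 2}/anti !big_nil subr0; apply => z _.
by rewrite /cosp big_nil; exact: P_ge0.
Qed.

Lemma cdf_approx_lip i : exists2 L : R, 0 <= L &
  forall x y, `|cdf_approx i x - cdf_approx i y| <= L * `|x - y|.
Proof.
exists (l1norm (P i)); first exact: l1norm_ge0.
move=> x y; apply: le_trans (ler_wpM2l (l1norm_ge0 _) (clamp01_lip x y)).
apply: (@derive_bounded_lipschitz _ (anti (P i)) (cosp (P i))) => z.
  exact: is_derive_anti.
exact: norm_cosp_le.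
Qed.

Lemma cdf_approx_succ i x : `|cdf_approx i.+1 x - cdf_approx i x| <= 2^-1 ^+ i.
Proof. exact: P_cauchy. Qed.

(** [2 * 2^-i] bounds the sum of all later increments, so the decrease of this correction pays for
    each step; the lower bounds behave symmetrically. *)
Lemma cdf_upper_noninc i j x : (i <= j)%N ->
  cdf_approx j x + 2 * 2^-1 ^+ j <= cdf_approx i x + 2 * 2^-1 ^+ i.
Proof.
elim: j => [|j IH]; first by rewrite leqn0 => /eqP ->.
rewrite leq_eqVlt ltnS => /orP[/eqP ->//|/IH]; apply: le_trans.
have := cdf_approx_succ j x; rewrite ler_norml exprS => /andP[_].
by move: (2^-1 ^+ j) => z; lra.
Qed.

Lemma cdf_lower_nondec i j x : (i <= j)%N ->
  cdf_approx i x - 2 * 2^-1 ^+ i <= cdf_approx j x - 2 * 2^-1 ^+ j.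
Proof.
elim: j => [|j IH]; first by rewrite leqn0 => /eqP ->.
rewrite leq_eqVlt ltnS => /orP[/eqP ->//|/IH H]; apply: le_trans H _.
have := cdf_approx_succ j x; rewrite ler_norml exprS => /andP[+ _].
by move: (2^-1 ^+ j) => z; lra.
Qed.

Lemma cdf_limit_dist i x : `|cdf_limit x - cdf_approx i x| <= 2 * 2^-1 ^+ i.
Proof.
have h0 j : 0 <= 2^-1 ^+ j :> R by rewrite exprn_ge0// invr_ge0.
have lb : lbound [set cdf_approx i x + 2 * 2^-1 ^+ i | i in [set: nat]]
    (cdf_approx i x - 2 * 2^-1 ^+ i).
  move=> _ [j _ <-]; have [ij|ji] := leqP i j.
    by have := cdf_lower_nondec x ij; have := h0 j; lra.
  by have := cdf_upper_noninc x (ltnW ji); have := h0 i; lra.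
rewrite ler_norml; apply/andP; split.
  rewrite -subr_ge0 opprK.
  have : cdf_approx i x - 2 * 2^-1 ^+ i <= cdf_limit x.
    by apply: lb_le_inf => //; exists (cdf_approx 0 x + 2 * 2^-1 ^+ 0), 0%N.
  lra.
rewrite lerBlDr addrC; apply: ge_inf; last by exists i.
by exists (cdf_approx i x - 2 * 2^-1 ^+ i).
Qed.

Lemma half_pow_small (e : R) : 0 < e -> exists i0, forall i, (i0 <= i)%N -> 2 * 2^-1 ^+ i <= e.
Proof.
move=> e0; pose K := (Num.truncn (2 / e)).+1; exists K => i Ki.
have pK : 0 < 2 ^+ i :> R by rewrite exprn_gt0.
rewrite exprVn ler_pdivrMr// -ler_pdivrMl// mulrC.
apply: le_trans (ltW (truncnS_gt _)) _; rewrite -/K -natrX ler_nat.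
by apply: leq_trans Ki _; rewrite ltnW// ltn_expl.
Qed.

Lemma ler_limit (a b : R) : (forall e, 0 < e -> a <= b + e) -> a <= b.
Proof. by move=> H; apply/ler_addgt0Pr => e e0; exact: H. Qed.

Lemma cdf_limit_nd : nondecreasing cdf_limit.
Proof.
move=> x y xy; apply: ler_limit => e e0.
have [i /(_ i (leqnn _)) ie] := half_pow_small (divr_gt0 e0 (ltr0n R 2)).
have := cdf_limit_dist i x; have := cdf_limit_dist i y; have := cdf_approx_nd i xy.
rewrite !ler_norml => h1 /andP[h2 h3] /andP[h4 h5].
by move: ie h1 h2 h3 h4 h5; lra.
Qed.

Lemma cdf_limit_continuous : continuous cdf_limit.
Proof.
move=> x; apply/cvgrPdist_le => e e0.
have e4 : 0 < e / 4 by rewrite divr_gt0.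
have [i /(_ i (leqnn _)) ie] := half_pow_small e4.
have [L L0 HL] := cdf_approx_lip i.
have d0 : 0 < e / 2 / (L + 1) by rewrite !divr_gt0// ltr_wpDl.
near=> y.
have xy : `|x - y| <= e / 2 / (L + 1).
  by near: y; apply: cvgr_dist_le => //; exact: cvg_id.
have H1 : L * `|x - y| <= e / 2.
  move: xy; rewrite ler_pdivlMr ?ltr_wpDl// => xy; apply: le_trans xy.
  by rewrite mulrDr mulr1 mulrC lerDl.
have := cdf_limit_dist i x; have := cdf_limit_dist i y; have := HL x y.
rewrite !ler_norml => /andP[h1 h2] /andP[h3 h4] /andP[h5 h6].
by apply/andP; split; move: H1 ie h1 h2 h3 h4 h5 h6; move: (L * _) (2 * _) => u v; lra.
Unshelve. all: by end_near. Qed.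

Lemma cdf_limit_le0 x : x <= 0 -> cdf_limit x = 0.
Proof.
move=> x0; have E i : cdf_approx i x = 0.
  by rewrite /cdf_approx /clamp01 (min_idPr _) ?(le_trans x0)// (max_idPl _)// anti0.
apply/eqP; rewrite -normr_le0; apply: ler_limit => e e0; rewrite add0r.
have [i /(_ i (leqnn _)) ie] := half_pow_small e0.
by have := cdf_limit_dist i x; rewrite E subr0 => H; exact: le_trans ie.
Qed.

Lemma cdf_limit_ge1 x : 1 <= x -> cdf_limit x = 1.
Proof.
move=> x1; have E i : cdf_approx i x = 1.
  by rewrite /cdf_approx /clamp01 (min_idPl _)// (max_idPr _)// anti1 P_mean.
apply/eqP; rewrite -subr_eq0 -normr_le0; apply: ler_limit => e e0; rewrite add0r.
have [i /(_ i (leqnn _)) ie] := half_pow_small e0.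
by have := cdf_limit_dist i x; rewrite E => H; exact: le_trans ie.
Qed.

HB.instance Definition _ := isCumulative.Build R _ R cdf_limit cdf_limit_nd
  (right_continuousW cdf_limit_continuous).

Lemma cdf_limitNy : cdf_limit @ -oo --> (0 : R).
Proof.
apply: (@cvg_trans _ ((fun=> 0 : R) @ -oo)); last exact: cvg_cst.
apply: near_eq_cvg; near=> x; rewrite cdf_limit_le0//.
Unshelve. all: by end_near. Qed.

Lemma cdf_limity : cdf_limit @ +oo --> (1 : R).
Proof.
apply: (@cvg_trans _ ((fun=> 1 : R) @ +oo)); last exact: cvg_cst.
apply: near_eq_cvg; near=> x; rewrite cdf_limit_ge1//.
Unshelve. all: by end_near. Qed.

HB.instance Definition _ := isCumulativeBounded.Build R 0 1 cdf_limit
  cdf_limitNy cdf_limity.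

Definition limit_measure : probability (measurableTypeR R) R :=
  lebesgue_stieltjes_measure cdf_limit.

Local Open Scope ereal_scope.

Lemma limit_measure_oc (a b : R) : (a <= b)%R ->
  limit_measure `]a, b]%classic = (cdf_limit b - cdf_limit a)%:E.
Proof.
move=> ab; rewrite /limit_measure/= /lebesgue_stieltjes_measure /measure_extension/=.
by rewrite measurable_mu_extE/= ?wlength_itv_bnd//; exact: is_ocitv.
Qed.

(** The Stieltjes measure is known on intervals open on the left; moving the left end by [d] and the
    continuity of the distribution function give the other half-open intervals. *)
Lemma limit_measure_co (a b : R) : (a <= b)%R ->
  limit_measure `[a, b[%classic <= (cdf_limit b - cdf_limit a)%:E.
Proof.
move=> ab; apply/lee_addgt0Pr => e e0.
have [d d0 Hd] : exists2 d : R, (0 < d)%R & (cdf_limit a - cdf_limit (a - d) <= e)%R.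
  have /cvgrPdist_le /(_ e e0) [r /= r0 Hr] := @cdf_limit_continuous a.
  exists (r / 2)%R; first by rewrite divr_gt0.
  apply: le_trans (ler_norm _) _; apply: Hr => /=.
  by rewrite opprB addrC subrK gtr0_norm ?divr_gt0//; lra.
have ad : (a - d <= b)%R by lra.
apply: (@le_trans _ _ (limit_measure `](a - d)%R, b]%classic)).
  apply: le_measure; rewrite ?inE//; try exact: measurable_itv.
  by move=> x /=; rewrite !in_itv/= => /andP[ax xb]; apply/andP; split; lra.
by rewrite limit_measure_oc// -EFinD lee_fin; lra.
Qed.

Lemma limit_measure01 : limit_measure [set` `[0, 1[%R] = 1.
Proof.
apply/eqP; rewrite eq_le probability_le1/=; last exact: measurable_itv.
have E : limit_measure `]0%R, 1%R]%classic = 1.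
  by rewrite limit_measure_oc// (cdf_limit_ge1 (lexx 1%R)) (cdf_limit_le0 (lexx 0%R)) subr0.
have Z : limit_measure `[1%R, 2%R[%classic <= 0.
  apply: le_trans (limit_measure_co _) _; first by rewrite ler1n.
  by rewrite !cdf_limit_ge1 ?ler1n// subrr.
rewrite -E; apply: (@le_trans _ _ (limit_measure (`[0%R, 1%R[%classic `|` `[1%R, 2%R[%classic))).
  apply: le_measure; rewrite ?inE//; try exact: measurable_itv.
    by apply: measurableU; exact: measurable_itv.
  move=> x /=; rewrite !in_itv/= => /andP[x0 x1].
  by have [xlt|xge] := ltP x 1%R; [left; rewrite ltW | right; rewrite (le_lt_trans x1)// ltr1n].
apply: le_trans (measureU2 _ _ _) _; try exact: measurable_itv.
by rewrite -[leRHS]adde0 leeD2l.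
Qed.

Lemma lipschitz_continuous (g : R -> R) : lipschitz_fun g -> continuous g.
Proof.
move=> [L L0 HL] x; apply/cvgrPdist_le => e e0.
have d0 : (0 < e / (L + 1))%R by rewrite divr_gt0// ltr_wpDl.
near=> y; apply: le_trans (HL x y) _.
have xy : (`|x - y| <= e / (L + 1))%R.
  by near: y; apply: cvgr_dist_le => //; exact: cvg_id.
move: xy; rewrite ler_pdivlMr ?ltr_wpDl// => xy; apply: le_trans xy.
by rewrite mulrDr mulr1 mulrC lerDl.
Unshelve. all: by end_near. Qed.

(** An upper Riemann-Stieltjes sum of mesh [1/n]; [L / n] bounds the oscillation of [g] on a
    cell. *)
Lemma limit_measure_integral_step (g : R -> R) (L : R) n : (0 < n)%N -> (0 <= L)%R ->
  (forall x, 0 <= g x)%R -> (forall x y, `|g x - g y| <= L * `|x - y|)%R ->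
  \int[limit_measure]_(x in [set` `[0, 1[%R]) (g x)%:E <=
  (\sum_(0 <= i < n) (g (i%:R / n%:R) + L / n%:R) *
    (cdf_limit (i.+1%:R / n%:R) - cdf_limit (i%:R / n%:R)))%R%:E.
Proof.
move=> n0 L0 g0 HL.
have nR : (0 < n%:R :> R)%R by rewrite ltr0n.
pose c i : R := (g (i%:R / n%:R) + L / n%:R)%R.
have c0 i : (0 <= c i)%R by rewrite addr_ge0// divr_ge0.
pose C i : set R := `[(i%:R / n%:R)%R, (i.+1%:R / n%:R)%R[%classic.
have mC i : measurable (C i : set (measurableTypeR R)) by exact: measurable_itv.
have mD : measurable ([set` `[0%R, 1%R[%R] : set (measurableTypeR R)) by exact: measurable_itv.
have mg : measurable_fun [set: measurableTypeR R] g.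
  by apply: continuous_measurable_fun; apply: lipschitz_continuous; exists L.
apply: (@le_trans _ _ (\int[limit_measure]_(x in [set` `[0%R, 1%R[%R])
    (\sum_(0 <= i < n) (c i)%:E * (\1_(C i) x)%:E))).
  apply: ge0_le_integral => //.
  - by move=> x _; rewrite lee_fin.
  - by apply/measurable_EFinP; apply: measurable_funTS.
  - apply: emeasurable_sum => i.
    by apply: emeasurable_funM => //; apply/measurable_EFinP; exact: measurable_indic.
  move=> x; rewrite /= in_itv/= => /andP[x0 x1].
  pose i := Num.truncn (x * n%:R).
  have /andP[i1 i2] := truncn_itv (mulr_ge0 x0 (ltW nR)).
  have iN : (i < n)%N.
    rewrite -(ltr_nat R); apply: le_lt_trans i1 _.
    by rewrite -[ltRHS]mul1r ltr_pM2r.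
  have xC : C i x.
    by rewrite /C/= in_itv/= ler_pdivrMr// i1/= ltr_pdivlMr.
  rewrite (bigD1_seq i) ?mem_index_iota ?iota_uniq//= indicE mem_set// mule1.
  rewrite -[leLHS]adde0; apply: leeD; last first.
    by apply: sume_ge0 => j _; rewrite mule_ge0// lee_fin.
  rewrite lee_fin /c; have := HL x (i%:R / n%:R)%R; rewrite ler_norml => /andP[_].
  rewrite lerBlDl => /le_trans; apply; rewrite lerD2l ler_wpM2l//.
  rewrite ger0_norm ?subr_ge0 ?ler_pdivrMr//.
  by rewrite lerBlDl -[X in (_ <= _ + X)%R]mul1r -mulrDl ler_pdivlMr// natr1 ltW.
rewrite ge0_integral_sum//; last 2 first.
- move=> i; apply: emeasurable_funM => //; apply/measurable_EFinP; exact: measurable_indic.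
- by move=> i x _; rewrite mule_ge0// lee_fin.
rewrite -sumEFin; apply: lee_sum => i _.
rewrite ge0_integralZl_EFin//; last by apply/measurable_EFinP; exact: measurable_indic.
rewrite integral_indic// EFinM lee_wpmul2l ?lee_fin//.
apply: (@le_trans _ _ (limit_measure (C i))).
  by apply: le_measure; rewrite ?inE//; exact: measurableI.
apply: limit_measure_co; rewrite ler_wpM2r ?invr_ge0// ler_nat//.
Qed.

(** Passage to the limit for upper bounds. The bound under [P i] is witnessed by a primitive [Phi],
    not by a cosine polynomial, so that sines fit in as well. *)
Lemma limit_measure_integral_le (g : R -> R) (e : R) : (forall x, 0 <= g x)%R ->
  lipschitz_fun g ->
  (exists i0, forall i, (i0 <= i)%N -> exists (Phi dPhi : R -> R),
    [/\ forall x, is_derive x (1%R : R) Phi (dPhi x),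
        (forall x, 0 <= x <= 1 -> g x * cosp (P i) x <= dPhi x)%R &
        (Phi 1 - Phi 0 <= e)%R]) ->
  \int[limit_measure]_(x in [set` `[0, 1[%R]) (g x)%:E <= e%:E.
Proof.
move=> g0 [L L0 HL] [i0 Hi0]; apply/lee_addgt0Pr => d d0.
pose n := (Num.truncn (4 * L / d)%R).+1.
have n0 : (0 < n)%N by [].
have nR : (0 < n%:R :> R)%R by rewrite ltr0n.
have Ln : (4 * L / n%:R <= d)%R.
  by rewrite ler_pdivrMr// -ler_pdivrMl// mulrC /n ltW// truncnS_gt.
apply: le_trans (limit_measure_integral_step n0 L0 g0 HL) _.
rewrite -EFinD lee_fin; set w := (L / n%:R)%R.
have w0 : (0 <= w)%R by rewrite divr_ge0.
pose c i : R := (g (i%:R / n%:R) + w)%R.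
have c0 i : (0 <= c i)%R by rewrite addr_ge0.
pose S := (\sum_(0 <= i < n) c i)%R.
have S0 : (0 <= S)%R by apply: sumr_ge0.
have d4 : (0 < d / 4 / (S + 1))%R by rewrite !divr_gt0// ltr_wpDl.
have [i1 Hi1] := half_pow_small d4.
(* Chosen after [n]: the increments of the distribution function are off by up to [4 * 2^-K] on each
   cell. *)
pose K := maxn i0 i1.
have HK := Hi1 K (leq_maxr _ _).
have [Phi [dPhi [DPhi gPhi Phie]]] := Hi0 K (leq_maxl _ _).
pose G i : R := (cdf_approx K (i%:R / n%:R))%R.
have in01 i : (i <= n)%N -> (0 <= (i%:R / n%:R : R) <= 1)%R.
  move=> ile; rewrite divr_ge0//= ler_pdivrMr// mul1r ler_nat//.
have GE i : (i <= n)%N -> G i = anti (P K) (i%:R / n%:R).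
  by move=> /in01 ile; rewrite /G /cdf_approx clamp01_id.
have step i : (i < n)%N -> ((g (i%:R / n%:R) - w) * (G i.+1 - G i) <=
    Phi (i.+1%:R / n%:R) - Phi (i%:R / n%:R))%R.
  move=> ilt; have ii : (i%:R / n%:R <= i.+1%:R / n%:R :> R)%R.
    by rewrite ler_wpM2r ?invr_ge0// ler_nat.
  rewrite !GE// 1?ltnW//; set a := (g _ - w)%R.
  have := @increment_le R (a \*: anti (P K)) (fun x => a *: cosp (P K) x) Phi dPhi _ _ ii _ DPhi.
  rewrite /= -scalerBr; apply.
    by move=> x; apply: is_deriveZ; exact: is_derive_anti.
  move=> x /andP[ix xi].
  have x01 : (0 <= x <= 1)%R.
    have /andP[h1 _] := in01 i (ltnW ilt); have /andP[_ h2] := in01 i.+1 ilt.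
    by rewrite (le_trans h1 ix) (le_trans xi h2).
  apply: le_trans (gPhi x x01); rewrite ler_wpM2r// /a.
  have := HL (i%:R / n%:R)%R x; rewrite ler_norml => /andP[_ H].
  rewrite lerBlDr -lerBlDl; apply: le_trans H _; rewrite /w ler_wpM2l//.
  rewrite distrC ger0_norm ?subr_ge0// lerBlDl; apply: le_trans xi _.
  by rewrite -[X in (_ <= _ + X)%R]mul1r -mulrDl natr1.
have fin i : (i < n)%N -> (c i * (cdf_limit (i.+1%:R / n%:R) - cdf_limit (i%:R / n%:R)) <=
    (Phi (i.+1%:R / n%:R) - Phi (i%:R / n%:R)) + 2 * w * (G i.+1 - G i) +
    c i * (2 * (2 * 2^-1 ^+ K)))%R.
  move=> ilt; have := step i ilt.
  have := cdf_limit_dist K (i.+1%:R / n%:R); have := cdf_limit_dist K (i%:R / n%:R).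
  rewrite !ler_norml -/(G i) -/(G i.+1) => /andP[h1 h2] /andP[h3 h4] h5.
  have h6 : (cdf_limit (i.+1%:R / n%:R) - cdf_limit (i%:R / n%:R) <=
     G i.+1 - G i + 2 * (2 * 2^-1 ^+ K))%R by move: h1 h2 h3 h4; lra.
  apply: le_trans (ler_wpM2l (c0 i) h6) _.
  by rewrite mulrDr lerD2r /c; move: h5; lra.
apply: le_trans (ler_sum_nat (fun i H => fin i (proj2 (andP H)))) _.
rewrite big_split big_split/= -mulr_sumr -mulr_suml -/S.
have /= -> := telescope_sumr (fun i => Phi (i%:R / n%:R)%R) (leq0n n).
rewrite (telescope_sumr G (leq0n n)).
rewrite /= mul0r divff ?gt_eqF//.
have G1 : (G n - G 0%N = 1)%R.
  by rewrite !GE// mul0r divff ?gt_eqF// anti0 anti1 P_mean subr0.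
rewrite G1 mulr1.
have h1 : (2 * w <= d / 2)%R by move: Ln; rewrite /w mulrA; lra.
have h2 : (S * (2 * (2 * 2^-1 ^+ K)) <= d / 2)%R.
  move: HK; rewrite ler_pdivlMr ?ltr_wpDl//.
  have : (0 <= 2^-1 ^+ K :> R)%R by rewrite exprn_ge0// invr_ge0.
  by move: (2^-1 ^+ K)%R => z; nra.
by move: Phie h1 h2; lra.
Qed.

End LimitMeasure.

(** * Almost sure bounds from bounded integrals *)

Section Consequences.
Variables (R : realType) (mu : probability (measurableTypeR R) R).
Hypothesis mu01 : mu [set` `[0, 1[%R] = 1%E.
Implicit Types (x : R).

Let D : set (measurableTypeR R) := [set` `[0, 1[%R].

Let mD : measurable D. Proof. exact: measurable_itv. Qed.

Lemma ae_unit_interval : {ae mu, forall x : R, 0 <= x < 1}.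
Proof.
exists (~` D); split; first exact: measurableC.
  by rewrite probability_setC// mu01 subee.
by move=> x /= H Dx; apply: H; move: Dx; rewrite /D/= in_itv.
Qed.

(** By monotone convergence the infinite sum has integral at most [C], hence is finite almost
    everywhere. *)
Lemma ae_bounded_sums (g : nat -> R -> R) (C : R) :
  (forall k x, 0 <= g k x) -> (forall k, lipschitz_fun (g k)) ->
  (forall n, (\int[mu]_(x in [set` `[0, 1[%R]) (\sum_(0 <= k < n) g k x)%:E <= C%:E)%E) ->
  {ae mu, forall x : R, exists M : R, forall n, \sum_(0 <= k < n) g k x <= M}.
Proof.
move=> g0 gL gC.
have mg k : measurable_fun D (EFin \o g k).
  apply/measurable_EFinP; apply: measurable_funTS.
  by apply: continuous_measurable_fun; exact: lipschitz_continuous.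
pose f x : \bar R := (\sum_(0 <= k <oo) (g k x)%:E)%E.
have mf : measurable_fun D f.
  by apply: ge0_emeasurable_sum => [k x _ _|k _]; [rewrite lee_fin | exact: mg].
have f0 x : (0 <= f x)%E by apply: nneseries_ge0 => k _ _; rewrite lee_fin.
have fint : mu.-integrable D f.
  apply/integrableP; split => //.
  apply: (@le_lt_trans _ _ C%:E); last exact: ltry.
  under eq_integral do rewrite gee0_abs//.
  rewrite /f integral_nneseries//; last by move=> k x _; rewrite lee_fin.
  apply: lime_le; first by apply: is_cvg_nneseries => k _ _; apply: integral_ge0 => x _; rewrite lee_fin.
  near=> n; rewrite -ge0_integral_sum//; last by move=> k x _; rewrite lee_fin.
  by under eq_integral do rewrite sumEFin; exact: gC.
apply: (@filterS2 _ _ (ae_filter_ringOfSetsType mu) _ _ _ _ ae_unit_interval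
  (integrable_ae mD fint)) => x x01 fx.
have {}fx : f x \is a fin_num by apply: fx; rewrite /D/= in_itv.
exists (fine (f x)) => n; rewrite -lee_fin fineK// -sumEFin.
by apply: nneseries_lim_ge => k _ _; rewrite lee_fin.
Unshelve. all: by end_near. Qed.

Lemma lipschitz_integrable (h : R -> R) (M : R) : lipschitz_fun h ->
  (forall x, `|h x| <= M) -> mu.-integrable [set` `[0, 1[%R] (EFin \o h).
Proof.
move=> hL hM; apply: measurable_bounded_integrable => //.
- by rewrite -ge0_fin_numE// fin_num_measure.
- by apply: measurable_funTS; apply: continuous_measurable_fun; exact: lipschitz_continuous.
exists M; split; first exact: num_real.
by move=> N MN x _ /=; apply: le_trans (hM x) _; exact: ltW.
Qed.

Lemma Rintegral_le_of_shift (h : R -> R) (a : R) : lipschitz_fun h ->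
  (forall x, `|h x| <= 1) ->
  (\int[mu]_(x in [set` `[0, 1[%R]) (1 + h x)%:E <= (1 + a)%:E)%E ->
  Rintegral mu [set` `[0, 1[%R] h <= a.
Proof.
move=> hL h1 H.
have ih := lipschitz_integrable hL h1.
have i1 : mu.-integrable D (EFin \o (fun=> 1 : R)).
  apply: (@lipschitz_integrable _ 1); first exact: lipschitz_fun_cst.
  by move=> x; rewrite normr1.
have := @RintegralD _ _ _ mu D (fun=> 1) h mD i1 ih.
have -> : Rintegral mu D (fun=> 1) = 1.
  by rewrite Rintegral_cst// mul1r; exact: (congr1 fine mu01).
move=> E.
suff : Rintegral mu D (fun x => 1 + h x) <= 1 + a by rewrite E lerD2l.
rewrite /Rintegral -lee_fin fineK//.
apply: integrable_fin_num => //.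
exact: (@integrableD _ _ _ mu D _ (EFin \o (fun=> 1 : R)) (EFin \o h)).
Qed.

End Consequences.

(** * Fourier coefficients and Weyl sums under the limit measure *)

Section TestIntegrals.
Variables (R : realType) (P : nat -> seq (R * int)) (mu : probability (measurableTypeR R) R).
Hypothesis mu01 : mu [set` `[0, 1[%R] = 1%E.
Hypothesis P_mean : forall i, fourier (P i) 0 = 1.
Hypothesis mu_le : forall (g : R -> R) (e : R), (forall x, 0 <= g x)%R -> lipschitz_fun g ->
  (exists i0, forall i, (i0 <= i)%N -> exists (Phi dPhi : R -> R),
    [/\ forall x, is_derive x (1%R : R) Phi (dPhi x),
        (forall x, 0 <= x <= 1 -> g x * cosp (P i) x <= dPhi x)%R &
        (Phi 1 - Phi 0 <= e)%R]) ->
  (\int[mu]_(x in [set` `[0, 1[%R]) (g x)%:E <= e%:E)%E.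
Implicit Types (x : R).

Lemma integral_le_mean (g : R -> R) (e : R) : (forall x, 0 <= g x) -> lipschitz_fun g ->
  (exists i0, forall i, (i0 <= i)%N -> exists W,
    (forall x, g x * cosp (P i) x <= cosp W x) /\ fourier W 0 <= e) ->
  (\int[mu]_(x in [set` `[0, 1[%R]) (g x)%:E <= e%:E)%E.
Proof.
move=> g0 gL [i0 H]; apply: mu_le => //; exists i0 => i /H[W [W1 W2]].
exists (anti W), (cosp W); split; first by move=> x; exact: is_derive_anti.
  by move=> x _; exact: W1.
by rewrite anti0 anti1 subr0.
Qed.

Lemma Rintegral_cos_le (n : int) (a e : R) : `|a| <= 1 -> (forall i, a * fourier (P i) n <= e) ->
  Rintegral mu [set` `[0, 1[%R] (fun x => a * cos (2 * pi * n%:~R * x)) <= e.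
Proof.
move=> a1 H.
have hb x : `|a * cos (2 * pi * n%:~R * x)| <= 1.
  by rewrite normrM mulr_ile1// ler_norml cos_geN1 cos_le1.
have hL : lipschitz_fun (fun x => a * cos (2 * pi * n%:~R * x)).
  have -> : (fun x => a * cos (2 * pi * n%:~R * x)) = cosp [:: (a, n)].
    by apply/funext => x; rewrite cosp_seq1.
  exact: lipschitz_cosp.
apply: Rintegral_le_of_shift => //.
apply: integral_le_mean.
- by move=> x; have := hb x; rewrite ler_norml; lra.
- by apply: lipschitz_funD => //; exact: lipschitz_fun_cst.
exists 0%N => i _; exists (P i ++ cmul [:: (a, n)] (P i)); split.
  by move=> x; rewrite cosp_cat cosp_mul cosp_seq1; rewrite le_eqVlt; apply/orP; left; apply/eqP; ring.
rewrite fourier_cat P_mean fourier_mul big_seq1/= sub0r add0r fourierN lerD2l.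
by have := H i; lra.
Qed.

Lemma sin_primitive (n : int) : exists2 Phi : R -> R,
  forall x, is_derive x (1 : R) Phi (sin (2 * pi * n%:~R * x)) & Phi 1 = Phi 0.
Proof.
case: (eqVneq n 0) => [->|n0].
  exists (cst 0) => // x; rewrite mulr0 mul0r sin0; exact: is_derive_cst.
pose a : R := 2 * pi * n%:~R.
have a0 : a != 0 by rewrite /a !mulf_neq0 ?intr_eq0// gt_eqF// pi_gt0.
exists (fun x => - a^-1 * cos (a * x)); last first.
  rewrite mulr1 mulr0 cos0 mulr1; have -> : cos a = 1; last by rewrite mulr1.
  by have := @sin_2pi_int R n (pi / 2); rewrite sin_pihalf addrC sinDpihalf.
move=> x; rewrite -/a.
have -> : sin (a * x) = - a^-1 *: (- sin (a * x) * a).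
  by rewrite /GRing.scale/=; field.
apply: (@is_deriveZ _ _ _ (fun y => cos (a * y))).
apply: (@is_derive1_comp _ cos (fun y => a * y)).
rewrite -[X in is_derive _ _ _ X]mulr1.
exact: (@is_deriveZ _ _ _ id).
Qed.

(** The densities are even, so sines have mean 0 under them. Cosine lists cannot express sines,
    hence primitives built term by term. *)
Lemma sin_cosp_primitive (n : int) s : exists2 Phi : R -> R,
  forall x, is_derive x (1 : R) Phi (sin (2 * pi * n%:~R * x) * cosp s x) & Phi 1 = Phi 0.
Proof.
elim: s => [|c s [Phi D E]].
  exists (cst 0) => // x; rewrite /cosp big_nil mulr0; exact: is_derive_cst.
have [F1 D1 E1] := sin_primitive (n + c.2); have [F2 D2 E2] := sin_primitive (n - c.2).
exists ((c.1 / 2) \*: (F1 + F2) + Phi); last first.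
  by rewrite -[LHS]/(c.1 / 2 * (F1 1 + F2 1) + Phi 1) E E1 E2.
move=> x; have -> : sin (2 * pi * n%:~R * x) * cosp (c :: s) x =
   (c.1 / 2) *: (sin (2 * pi * (n + c.2)%:~R * x) + sin (2 * pi * (n - c.2)%:~R * x)) +
   sin (2 * pi * n%:~R * x) * cosp s x.
  have -> : 2 * pi * (n + c.2)%:~R * x = 2 * pi * n%:~R * x + 2 * pi * c.2%:~R * x.
    by rewrite intrD; ring.
  have -> : 2 * pi * (n - c.2)%:~R * x = 2 * pi * n%:~R * x - 2 * pi * c.2%:~R * x.
    by rewrite intrB; ring.
  rewrite sinD sinB cosp_cons {1}/cosp big_seq1 /GRing.scale/=; by [field].
exact: is_deriveD.
Qed.

Lemma Rintegral_sin_le (n : int) (a : R) : `|a| <= 1 ->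
  Rintegral mu [set` `[0, 1[%R] (fun x => a * sin (2 * pi * n%:~R * x)) <= 0.
Proof.
move=> a1.
have hb x : `|a * sin (2 * pi * n%:~R * x)| <= 1.
  by rewrite normrM mulr_ile1// ler_norml sin_geN1 sin_le1.
have hL : lipschitz_fun (fun x => a * sin (2 * pi * n%:~R * x)).
  exists `|2 * pi * n%:~R| => // x y.
  rewrite -mulrBr normrM; apply: (@le_trans _ _ (1 * `|sin (2 * pi * n%:~R * x) - sin (2 * pi * n%:~R * y)|)).
    by rewrite ler_wpM2r.
  rewrite mul1r -normrM mulrBr -[leRHS]mul1r.
  apply: (@derive_bounded_lipschitz _ sin cos 1) => z.
  by rewrite ler_norml cos_geN1 cos_le1.
apply: Rintegral_le_of_shift => //.
apply: mu_le.
- by move=> x; have := hb x; rewrite ler_norml; lra.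
- by apply: lipschitz_funD => //; exact: lipschitz_fun_cst.
exists 0%N => i _; have [F DF F1] := sin_cosp_primitive n (P i).
exists (anti (P i) + a \*: F), (fun x => cosp (P i) x + a *: (sin (2 * pi * n%:~R * x) * cosp (P i) x)).
split.
- by move=> x; have DA := is_derive_anti (P i) x; exact: is_deriveD.
- by move=> x _; rewrite /GRing.scale/=; rewrite le_eqVlt; apply/orP; left; apply/eqP; ring.
- rewrite -[X in X - _]/(anti (P i) 1 + a * F 1) -[X in _ - X]/(anti (P i) 0 + a * F 0).
  by rewrite F1 anti0 anti1 P_mean; lra.
Qed.

Lemma normr_Rintegral_le (h : R -> R) (e : R) : lipschitz_fun h -> (forall x, `|h x| <= 1) ->
  Rintegral mu [set` `[0, 1[%R] (fun x => 1 * h x) <= e ->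
  Rintegral mu [set` `[0, 1[%R] (fun x => -1 * h x) <= e ->
  `|Rintegral mu [set` `[0, 1[%R] h| <= e.
Proof.
move=> hL h1; have ih := lipschitz_integrable mu hL h1.
rewrite !RintegralZl//; try exact: measurable_itv.
by rewrite mul1r mulN1r => H1 H2; rewrite ler_norml H1 andbT lerNl.
Qed.

Lemma lipschitz_sinM (a : R) : lipschitz_fun (fun x => sin (a * x)).
Proof.
exists `|a| => // x y.
rewrite -normrM mulrBr -[leRHS]mul1r.
apply: (@derive_bounded_lipschitz _ sin cos 1) => z.
by rewrite ler_norml cos_geN1 cos_le1.
Qed.

(** The imaginary part vanishes. The real part is bounded by testing the cosine with both signs; the
    negative sign only uses that the coefficients are nonnegative. *)
Lemma normc_fourier_coef_le (n : int) (e : R) : 0 <= e ->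
  (forall i, 0 <= fourier (P i) n <= e) -> ComplexField.Normc.normc (fourier_coef mu n) <= e.
Proof.
move=> e0 H; pose a : R := 2 * pi * (- n)%:~R.
have E x : - (2 * pi * n%:~R * x) = a * x by rewrite /a intrN; ring.
rewrite /fourier_coef /Cintegral /cis.
have C : `|Rintegral mu [set` `[0, 1[%R] (fun x => cos (- (2 * pi * n%:~R * x)))| <= e.
  under eq_Rintegral do rewrite E.
  apply: normr_Rintegral_le; first exact: lipschitz_cosM.
  - by move=> x; rewrite ler_norml cos_geN1 cos_le1.
  - apply: Rintegral_cos_le; first by rewrite normr1.
    by move=> i; rewrite mul1r fourierN; case/andP: (H i).
  apply: Rintegral_cos_le; first by rewrite normrN normr1.
  by move=> i; rewrite mulN1r fourierN; case/andP: (H i) => h _; lra.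
have S : `|Rintegral mu [set` `[0, 1[%R] (fun x => sin (- (2 * pi * n%:~R * x)))| <= 0.
  under eq_Rintegral do rewrite E.
  apply: normr_Rintegral_le; first exact: lipschitz_sinM.
  - by move=> x; rewrite ler_norml sin_geN1 sin_le1.
  - by apply: Rintegral_sin_le; rewrite normr1.
  - by apply: Rintegral_sin_le; rewrite normrN normr1.
rewrite /= (_ : Rintegral mu _ (fun x => sin _) = 0); last by apply/eqP; rewrite -normr_le0.
by rewrite expr0n addr0 sqrtr_sqr.
Qed.

(* [sum_(L < n) |sum_(m < L) e(h b^m x)|^2 / L^3], as a cosine polynomial. *)
Definition weyl_list (b : nat) (h : int) (L : nat) : seq (R * int) :=
  [seq ((L%:R ^+ 3)^-1, h * (b%:Z ^+ m - b%:Z ^+ n)) | m <- index_iota 0 L, n <- index_iota 0 L].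

Lemma cosp_weyl_list b h L x : cosp (weyl_list b h L) x =
  ((\sum_(0 <= n < L) cos (2 * pi * (h * b%:Z ^+ n)%:~R * x)) ^+ 2 +
   (\sum_(0 <= n < L) sin (2 * pi * (h * b%:Z ^+ n)%:~R * x)) ^+ 2) / L%:R ^+ 3.
Proof.
pose a n : R := 2 * pi * (h * b%:Z ^+ n)%:~R * x.
have -> : (\sum_(0 <= n < L) cos (a n)) ^+ 2 + (\sum_(0 <= n < L) sin (a n)) ^+ 2 =
    \sum_(0 <= m < L) \sum_(0 <= n < L) cos (a m - a n).
  rewrite !expr2 !mulr_suml -big_split; apply: eq_bigr => m _ /=.
  by rewrite !mulr_sumr -big_split; apply: eq_bigr => n _ /=; rewrite cosB.
rewrite /cosp /weyl_list big_allpairs_dep/= mulr_suml; apply: eq_bigr => m _.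
rewrite mulr_suml; apply: eq_bigr => n _; rewrite mulrC; congr (cos _ / _).
by rewrite mulrBr intrB /a; ring.
Qed.

Lemma ae_weyl_bounded b h (C : R) :
  (forall i N, del_sum (fourier (P i)) b h N <= C) ->
  {ae mu, forall x, exists M : R, forall N,
    \sum_(0 <= L < N) cosp (weyl_list b h L) x <= M}.
Proof.
move=> H; apply: (ae_bounded_sums mu01 (C := C)).
- by move=> L x; rewrite cosp_weyl_list divr_ge0 ?exprn_ge0// addr_ge0// sqr_ge0.
- by move=> L; exact: lipschitz_cosp.
move=> N; apply: integral_le_mean.
- by move=> x; apply: sumr_ge0 => L _; rewrite cosp_weyl_list divr_ge0 ?exprn_ge0// addr_ge0// sqr_ge0.
- by apply: lipschitz_fun_sum => L; exact: lipschitz_cosp.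
exists 0%N => i _; exists (flatten [seq cmul (weyl_list b h L) (P i) | L <- index_iota 0 N]).
split => [x|].
  by rewrite cosp_flatten mulr_suml; apply: ler_sum => L _; rewrite cosp_mul.
rewrite fourier_flatten; apply: le_trans (H i N).
rewrite le_eqVlt; apply/orP; left; apply/eqP.
have E L : fourier (cmul (weyl_list b h L) (P i)) 0 = (\sum_(0 <= m < L) \sum_(0 <= n < L)
    fourier (P i) (h * (b%:Z ^+ m - b%:Z ^+ n))) / L%:R ^+ 3.
  rewrite fourier_mul /weyl_list big_allpairs_dep/= mulr_suml; apply: eq_bigr => m _.
  rewrite mulr_suml; apply: eq_bigr => n _.
  rewrite sub0r add0r fourierN [RHS]mulrC; congr (_ * _).
  by move: (fourier _ _) => z; lra.
rewrite /del_sum; case: N => [|N]; first by rewrite !big_geq.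
(* Sums over [L] start at 0 here but at 1 in [del_sum]; the extra term is empty. *)
have E0 : fourier (cmul (weyl_list b h 0) (P i)) 0 = 0 by rewrite E big_geq// mul0r.
rewrite big_ltn// E0 add0r.
by apply: eq_bigr => L _; exact: E.
Qed.

End TestIntegrals.

(** * Weyl's criterion *)

Section Averages.
Variable R : realType.
Implicit Types (u : nat -> R) (x y e : R).

Definition avg0 u := forall e, 0 < e -> exists N0, forall N, (N0 <= N)%N ->
  `|\sum_(0 <= n < N) u n| <= e * N%:R.

Lemma avg0D u v : avg0 u -> avg0 v -> avg0 (fun n => u n + v n).
Proof.
move=> Hu Hv e e0; have e2 : 0 < e / 2 by rewrite divr_gt0.
have [N1 H1] := Hu _ e2; have [N2 H2] := Hv _ e2.
exists (maxn N1 N2) => N; rewrite geq_max => /andP[/H1 h1 /H2 h2].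
rewrite big_split/=; apply: le_trans (ler_normD _ _) _.
by move: h1 h2; lra.
Qed.

Lemma avg0Z (a : R) u : avg0 u -> avg0 (fun n => a * u n).
Proof.
move=> Hu e e0; have a1 : 0 < `|a| + 1 by rewrite ltr_wpDl.
have [N1 H1] := Hu _ (divr_gt0 e0 a1).
exists N1 => N /H1 h1; rewrite -mulr_sumr normrM.
apply: (@le_trans _ _ (`|a| * (e / (`|a| + 1) * N%:R))); first exact: ler_wpM2l.
by rewrite mulrA ler_wpM2r// mulrCA ger_pMr// ler_pdivrMr// mul1r lerDl.
Qed.

Lemma eq_avg0 u v : u =1 v -> avg0 u -> avg0 v.
Proof. by move=> uv; have -> : u = v by apply/funext. Qed.

Lemma avg0_zero : avg0 (fun=> 0).
Proof. by move=> e e0; exists 0%N => N _; rewrite big1// normr0 mulr_ge0// ltW. Qed.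

(* A partial sum of size [e N] stays above [e N / 2] during [e N / 2] steps. *)
Lemma slow_sums u (M : R) : (forall n, `|u n| <= 1) ->
  (forall N, \sum_(0 <= L < N) (\sum_(0 <= n < L) u n) ^+ 2 / L%:R ^+ 3 <= M) -> avg0 u.
Proof.
move=> u1 HM; pose A L := \sum_(0 <= n < L) u n.
pose S N := \sum_(0 <= L < N) A L ^+ 2 / L%:R ^+ 3.
have t0 L : 0 <= A L ^+ 2 / L%:R ^+ 3 by rewrite divr_ge0 ?sqr_ge0 ?exprn_ge0.
have slow L K : `|A (L + K)%N - A L| <= K%:R.
  rewrite /A (@big_cat_nat _ _ _ L)//= ?leq_addr// addrAC subrr add0r.
  apply: le_trans (ler_norm_sum _ _ _) _.
  apply: (@le_trans _ _ (\sum_(L <= i < L + K) 1)); first by apply: ler_sum.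
  by rewrite sumr_const_nat addKn.
suff main e : 0 < e -> e <= 1 -> exists N0, forall N, (N0 <= N)%N -> `|A N| <= e * N%:R.
  move=> e e0; have [e1|e1] := leP e 1; first exact: main.
  have [N0 H0] := main 1 ltr01 (lexx _); exists N0 => N /H0 /le_trans; apply.
  by rewrite ler_wpM2r// ltW.
move=> e0 e1.
have hs : has_sup (range S).
  by split; [exists (S 0%N), 0%N | exists M => _ [N _ <-]; exact: HM].
(* At least [e N / 4] terms of size [e^2 / (32 N)] add up to [e^3 / 128]; beyond [N1] the bounded
   series has less than this left. *)
have d0 : 0 < e ^+ 3 / 128 by rewrite divr_gt0// exprn_gt0.
have [_ [N1 _ <-] HN1] := sup_adherent d0 hs.
pose N2 := (Num.truncn (4 / e)).+1.
exists (maxn N1 N2) => N; rewrite geq_max => /andP[N1N N2N].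
have N0 : (0 < N)%N by apply: leq_trans N2N.
have NR : 0 < N%:R :> R by rewrite ltr0n.
have eN : 4 <= e * N%:R.
  rewrite -ler_pdivrMl// mulrC; apply: le_trans (ltW (truncnS_gt _)) _.
  by rewrite ler_nat.
rewrite leNgt; apply/negP; rewrite -/(A N) => H.
pose K := Num.truncn (e * N%:R / 2).
have /andP[K1 K2] : K%:R <= e * N%:R / 2 < K.+1%:R.
  by apply: truncn_itv; rewrite divr_ge0// ltW// mulr_gt0.
have K3 : e * N%:R / 4 <= K%:R.
  by move: K2; rewrite -(natr1 K); lra.
have KN : (K <= N)%N by rewrite -(ler_nat R); nra.
have low L : (N <= L < N + K)%N -> e ^+ 2 / (32 * N%:R) <= A L ^+ 2 / L%:R ^+ 3.
  move=> /andP[NL LK].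
  have LR : 0 < L%:R :> R by rewrite ltr0n (leq_trans N0).
  have L2 : L%:R <= 2 * N%:R :> R.
    by rewrite -natrM ler_nat mul2n -addnn (leq_trans (ltnW LK))// leq_add2l.
  have AL : e * N%:R / 2 <= `|A L|.
    have := slow N (L - N)%N; rewrite subnKC// => h.
    have h2 : (L - N)%:R <= K%:R :> R by rewrite ler_nat leq_subLR ltnW.
    have : `|A N| <= `|A L| + `|A L - A N|.
      by rewrite {1}(_ : A N = A L - (A L - A N)); [exact: ler_normB | ring].
    move: h h2 H K1; move: (`|A L - A N|) (`|A L|) (`|A N|) (e * N%:R).
    by move: ((L - N)%:R : R) (K%:R : R) => a b c d f g; lra.
  have A2 : e ^+ 2 * N%:R ^+ 2 / 4 <= A L ^+ 2.
    have -> : e ^+ 2 * N%:R ^+ 2 / 4 = (e * N%:R / 2) ^+ 2 by field.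
    rewrite -(@real_normK _ (A L)) ?num_real//.
    by rewrite lerXn2r ?nnegrE// divr_ge0// ltW// mulr_gt0.
  have L3 : L%:R ^+ 3 <= 8 * N%:R ^+ 3 :> R.
    have -> : 8 * N%:R ^+ 3 = (2 * N%:R) ^+ 3 :> R by ring.
    by rewrite lerXn2r ?nnegrE// ?mulr_ge0// ltW.
  rewrite ler_pdivlMr ?exprn_gt0//; apply: le_trans A2.
  apply: (@le_trans _ _ (e ^+ 2 / (32 * N%:R) * (8 * N%:R ^+ 3))).
    by rewrite ler_wpM2l// divr_ge0 ?exprn_ge0// ?mulr_ge0// ltW.
  by rewrite le_eqVlt; apply/orP; left; apply/eqP; field; rewrite gt_eqF.
have SN : S (N + K)%N - S N1 >= e ^+ 3 / 128.
  rewrite /S (@big_cat_nat _ _ _ N1 0 (N + K))//=; last first.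
    by apply: leq_trans N1N _; rewrite leq_addr.
  rewrite addrAC subrr add0r (@big_cat_nat _ _ _ N)//= ?leq_addr//.
  rewrite -[leLHS]add0r lerD//; first by apply: sumr_ge0.
  apply: (@le_trans _ _ (\sum_(N <= L < N + K) e ^+ 2 / (32 * N%:R))); last first.
    by apply: ler_sum_nat.
  rewrite sumr_const_nat addKn -[leRHS]mulr_natr.
  apply: (@le_trans _ _ (e ^+ 2 / (32 * N%:R) * (e * N%:R / 4))).
    by rewrite le_eqVlt; apply/orP; left; apply/eqP; field; rewrite gt_eqF.
  by rewrite ler_wpM2l// divr_ge0 ?exprn_ge0// ?mulr_ge0// ltW.
have Ssup : S (N + K)%N <= sup (range S).
  by apply: ub_le_sup; [exact: (proj2 hs) | exists (N + K)%N].
by move: HN1 SN Ssup; lra.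
Qed.

(** Each nonconstant term of the difference combines a sine and a cosine at [y n], to which the
    hypothesis applies; the constant term is exactly the subtracted mean. *)
Lemma avg0_increment (y : nat -> R) (s : seq (R * int)) (a c : R) :
  (forall h : int, h != 0 -> avg0 (fun n => cos (2 * pi * h%:~R * y n)) /\
     avg0 (fun n => sin (2 * pi * h%:~R * y n))) ->
  avg0 (fun n => anti s (y n - a) - anti s (y n - c) - fourier s 0 * (c - a)).
Proof.
move=> H; elim: s => [|d s IH].
  apply: eq_avg0 avg0_zero => n; rewrite /anti /fourier !big_nil; ring.
have anti_cons t : anti (d :: s) t = anti [:: d] t + anti s t by rewrite -cat1s anti_cat.
suff D : avg0 (fun n => anti [:: d] (y n - a) - anti [:: d] (y n - c) - fourier [:: d] 0 * (c - a)).
  apply: eq_avg0 (avg0D D IH) => n; rewrite !anti_cons (fourier_cons d s); ring.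
rewrite /fourier big_seq1 oppr0; have E t : anti [:: d] t = d.1 *
  (if d.2 == 0 then t else sin (2 * pi * d.2%:~R * t) / (2 * pi * d.2%:~R)) by rewrite /anti big_seq1.
have [d0|d0] := eqVneq d.2 0.
  by apply: eq_avg0 avg0_zero => n; rewrite !E d0 eqxx /=; field.
have [Hc Hs] := H _ d0.
pose w : R := 2 * pi * d.2%:~R.
have w0 : w != 0 by rewrite /w !mulf_neq0 ?intr_eq0// gt_eqF// pi_gt0.
have := avg0D (avg0Z (d.1 / w * (cos (w * a) - cos (w * c))) Hs)
  (avg0Z (d.1 / w * (sin (w * c) - sin (w * a))) Hc).
apply: eq_avg0 => n; rewrite !E (negbTE d0) /= -/w !(mulrBr w) !sinB.
by field.
Qed.

End Averages.

(** * Digit blocks and the orbit of [x] *)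

Section Words.
Variables (R : realType) (b : nat) (x : R).
Hypotheses (b1 : (1 < b)%N) (x01 : 0 <= x < 1).
Implicit Types (j n s v : nat).

Let b0 : (0 < b)%N := ltnW b1.
Let bR : 0 < b%:R :> R. Proof. by rewrite ltr0n. Qed.
Let x0 : 0 <= x. Proof. by case/andP: x01. Qed.

Definition prefix_value j := Num.truncn (x * b%:R ^+ j).

Definition shifted j : R := x * b%:R ^+ j - (prefix_value j)%:R.

(** The digits of index [n + 1] to [n + k], read as one integer: digits being numbered from 1, this
    block occurs at [n + 1]. *)
Definition word_value k n := (prefix_value (n + k) %% b ^ k)%N.

Lemma shifted_itv j : 0 <= shifted j < 1.
Proof.
have /andP[h1 h2] := truncn_itv (mulr_ge0 x0 (exprn_ge0 j (ltW bR))).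
by rewrite /shifted subr_ge0 h1 ltrBlDl natr1.
Qed.

Lemma prefix_valueD j s : exists2 w, (w < b ^ s)%N &
  prefix_value (j + s) = (prefix_value j * b ^ s + w)%N /\
  w%:R <= shifted j * b%:R ^+ s < w.+1%:R.
Proof.
have /andP[y0 y1] := shifted_itv j.
have bs : 0 < b%:R ^+ s :> R by rewrite exprn_gt0.
have ys : 0 <= shifted j * b%:R ^+ s by rewrite mulr_ge0// ltW.
have /andP[h1 h2] := truncn_itv ys.
exists (Num.truncn (shifted j * b%:R ^+ s)).
  by rewrite -(ltr_nat R) natrX (le_lt_trans h1)// -[ltRHS]mul1r ltr_pM2r.
split; last by rewrite h1.
have E : x * b%:R ^+ (j + s) = (prefix_value j * b ^ s)%N%:R + shifted j * b%:R ^+ s.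
  by rewrite /shifted exprD natrM natrX; ring.
apply: truncn_def; rewrite E natrD lerD2l h1 /= -addnS natrD ltrD2l.
exact: h2.
Qed.

Lemma word_value_lt k n : (word_value k n < b ^ k)%N.
Proof. by rewrite ltn_mod expn_gt0 b0. Qed.

Lemma word_value_itv k n :
  (word_value k n)%:R <= shifted n * b%:R ^+ k < (word_value k n).+1%:R.
Proof.
have [w wk [E H]] := prefix_valueD n k.
by rewrite /word_value E modnMDl modn_small.
Qed.

Lemma digit_word_value k n (i : 'I_k) :
  digit b x (n.+1 + i) = ((word_value k n %/ b ^ (k.-1 - i)) %% b)%N.
Proof.
have ik := ltn_ord i.
have Ek : (n + k = (n.+1 + i) + (k.-1 - i))%N by lia.
have [w wk [E _]] := prefix_valueD (n.+1 + i) (k.-1 - i).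
rewrite /digit -/(prefix_value _) /word_value Ek E.
set s := (k.-1 - i)%N in wk *; set t := prefix_value _.
have bs : (0 < b ^ s)%N by rewrite expn_gt0 b0.
have -> : (b ^ k = b ^ i.+1 * b ^ s)%N by rewrite -expnD /s; congr (_ ^ _)%N; lia.
set z := (t * b ^ s + w)%N.
have zt : (z %/ b ^ s = t)%N by rewrite divnMDl// (divn_small wk) addn0.
have := divn_eq z (b ^ i.+1 * b ^ s); set m := (z %/ _)%N; set r := (z %% _)%N => zE.
have : (t = m * b ^ i.+1 + r %/ b ^ s)%N by rewrite -zt zE mulnA divnMDl.
by move=> ->; rewrite expnSr mulnA modnMDl.
Qed.

Definition word_digits k v : k.-tuple 'I_b :=
  [tuple Ordinal (ltn_pmod (v %/ b ^ (k.-1 - i)) b0) | i < k].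

Lemma word_digits_inj k u v : (u < b ^ k)%N -> (v < b ^ k)%N ->
  word_digits k u = word_digits k v -> u = v.
Proof.
move=> uk vk E.
have D i : (i < k)%N -> ((u %/ b ^ i) %% b = (v %/ b ^ i) %% b)%N.
  move=> ik; have ik' : (k.-1 - i < k)%N by lia.
  have := congr1 (fun t => val (tnth t (Ordinal ik'))) E.
  by rewrite !tnth_mktuple/= (_ : (k.-1 - (k.-1 - i) = i)%N)//; lia.
suff H j : (j <= k)%N -> (u %% b ^ j = v %% b ^ j)%N.
  by have := H k (leqnn _); rewrite !modn_small.
elim: j => [|j IH] jk; first by rewrite expn0 !modn1.
have step w : (w %% b ^ j.+1 = (w %/ b ^ j) %% b * b ^ j + w %% b ^ j)%N.
  by rewrite expnS modn_divl [LHS](divn_eq _ (b ^ j)) modn_dvdm// dvdn_mull.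
by rewrite !step D// IH// ltnW.
Qed.

Lemma occurs_atE k (d : k.-tuple 'I_b) n :
  occurs_at x d n.+1 = (word_digits k (word_value k n) == d).
Proof.
apply/forallP/eqP => [H|<- i].
  apply: eq_from_tnth => i; rewrite tnth_mktuple; apply: val_inj => /=.
  by rewrite -digit_word_value; apply/eqP.
by rewrite tnth_mktuple/= digit_word_value.
Qed.

Lemma occ_countE k (d : k.-tuple 'I_b) N :
  occ_count x d N = (\sum_(0 <= n < N) (word_digits k (word_value k n) == d))%N.
Proof.
rewrite /occ_count big_add1 /=; apply: eq_bigr => n _; by rewrite occurs_atE.
Qed.

Lemma occ_count_word k v N : (v < b ^ k)%N ->
  occ_count x (word_digits k v) N = (\sum_(0 <= n < N) (word_value k n == v))%N.
Proof.
move=> vk; rewrite occ_countE; apply: eq_bigr => n _; congr nat_of_bool.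
by apply/eqP/eqP => [/word_digits_inj ->|->]//; exact: word_value_lt.
Qed.

Lemma sum_occ_count k N : (\sum_(d : k.-tuple 'I_b) occ_count x d N = N)%N.
Proof.
under eq_bigr => d _ do rewrite occ_countE.
rewrite exchange_big/= (eq_bigr (fun=> 1%N)) ?sum_nat_const_nat ?subn0 ?muln1//.
move=> n _; rewrite (bigD1 (word_digits k (word_value k n)))//= eqxx big1// => d.
by rewrite eq_sym => /negbTE ->.
Qed.

Lemma shifted_phase (h : int) n : 2 * pi * (h * b%:Z ^+ n)%:~R * x =
  2 * pi * h%:~R * shifted n + 2 * pi * (h * (prefix_value n)%:Z)%:~R.
Proof.
have E : (b%:Z ^+ n)%:~R = b%:R ^+ n :> R by rewrite -PoszX -natrX.
by rewrite /shifted !intrM E; ring.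
Qed.

Lemma sin_shifted (h : int) n : sin (2 * pi * (h * b%:Z ^+ n)%:~R * x) =
  sin (2 * pi * h%:~R * shifted n).
Proof. by rewrite shifted_phase sin_2pi_int. Qed.

Lemma cos_shifted (h : int) n : cos (2 * pi * (h * b%:Z ^+ n)%:~R * x) =
  cos (2 * pi * h%:~R * shifted n).
Proof. by rewrite shifted_phase -!sinDpihalf addrAC sin_2pi_int. Qed.

End Words.

(** * Normality forces small cosine averages *)

Section WeylNecessary.
Variables (R : realType) (b : nat) (x : R).
Hypotheses (b1 : (1 < b)%N) (x01 : 0 <= x < 1).

(** Multiplication by [2 sin (pi / J)] makes the sum telescope. *)
Lemma sum_cos_roots (J : nat) : (1 < J)%N ->
  \sum_(0 <= v < J) cos (2 * pi * (v%:R / J%:R)) = 0 :> R.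
Proof.
move=> J1; have JR : 0 < J%:R :> R by rewrite ltr0n ltnW.
pose t : R := pi / J%:R.
have t0 : 0 < t by rewrite divr_gt0// pi_gt0.
have tpi : t < pi.
  by rewrite ltr_pdivrMr// -[ltLHS]mulr1 ltr_pM2l ?pi_gt0// ltr1n.
have st : sin t != 0 by rewrite gt_eqF// sin_gt0_pi// t0.
apply: (mulfI (mulf_neq0 (_ : 2 != 0 :> R) st)); first by [].
rewrite mulr0 mulr_sumr.
pose F (v : nat) : R := sin ((2 * v%:R - 1) * t).
rewrite (eq_bigr (fun v => F v.+1 - F v)); last first.
  move=> v _; rewrite /F.
  have -> : (2 * v.+1%:R - 1) * t = 2 * pi * (v%:R / J%:R) + t.
    by rewrite -(natr1 v) /t; field; rewrite gt_eqF.
  have -> : (2 * v%:R - 1) * t = 2 * pi * (v%:R / J%:R) - t.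
    by rewrite /t; field; rewrite gt_eqF.
  by rewrite sinD sinB; ring.
have -> : \sum_(0 <= v < J) (F v.+1 - F v) = F J - F 0%N by rewrite telescope_sumr// (ltnW (ltnW J1)).
have -> : F 0%N = sin (- t) by rewrite /F; congr sin; ring.
have -> : F J = sin (- t + 2 * pi * 1%:~R).
  by rewrite /F; congr sin; rewrite /t; field; rewrite gt_eqF.
by rewrite sin_2pi_int subrr.
Qed.

(** The cosine at [b^n x] is nearly a function of the next [k] digits. All [b^k] blocks are equally
    frequent, and the cosines of equally spaced angles sum to 0. *)
Lemma normal01_avg0 : normal01 b x -> avg0 (fun n => cos (2 * pi * (b%:Z ^+ n)%:~R * x)).
Proof.
move=> nx e e0.
have b0 := ltnW b1.
pose k := (Num.truncn (3 * (2 * pi) / e)).+1.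
pose J := (b ^ k)%N.
have k0 : (0 < k)%N by [].
have J1 : (1 < J)%N by rewrite -(exp1n k) ltn_exp2r.
have JR : 0 < J%:R :> R by rewrite ltr0n ltnW.
have Je : 2 * pi / J%:R <= e / 3.
  rewrite ler_pdivrMr// -ler_pdivrMl ?divr_gt0//.
  rewrite (_ : (e / 3)^-1 * (2 * pi) = 3 * (2 * pi) / e); last by field; rewrite gt_eqF.
  apply: le_trans (ltW (truncnS_gt _)) _; rewrite -/k ler_nat.
  by rewrite ltnW// ltn_expl.
have e3 : 0 < e / 3 / J%:R by rewrite !divr_gt0.
have cnt v : (v < J)%N -> exists N0, forall N, (N0 <= N)%N ->
   `|(\sum_(0 <= n < N) (word_value b x k n == v))%N%:R - N%:R / J%:R| <= e / 3 / J%:R * N%:R.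
  move=> vJ; have /cvgrPdist_le /(_ _ e3) := nx k (word_digits b1 k v) k0.
  move=> [N0 _ H]; exists (maxn N0 1) => N; rewrite geq_max => /andP[/H /= h N1].
  have NR : 0 < N%:R :> R by rewrite ltr0n.
  move: h; rewrite (occ_count_word b1 x01)// distrC -natrX -/J => h.
  set A : R := (\sum_(0 <= n < N) _)%N%:R in h *.
  have -> : A - N%:R / J%:R = (A / N%:R - J%:R^-1) * N%:R.
    by field; rewrite !gt_eqF.
  by rewrite normrM (gtr0_norm NR) ler_pM2r.
pose cn v N := \sum_(0 <= n < N) (word_value b x k n == v)%:R : R.
have {}cnt v : exists N0, forall N, (N0 <= N)%N -> (v < J)%N ->
    `|cn v N - N%:R / J%:R| <= e / 3 / J%:R * N%:R.
  case: (ltnP v J) => [vJ|]; last by exists 0%N.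
  have [N0 H] := cnt v vJ; exists N0 => N /H.
  by rewrite natr_sum => h _; exact: h.
have [Nf HN] := choice cnt.
exists (\max_(v < J) Nf v)%N => N /bigmax_leqP hN.
have cs v : (v < J)%N -> `|cn v N - N%:R / J%:R| <= e / 3 / J%:R * N%:R.
  by move=> vJ; apply: HN => //; exact: (hN (Ordinal vJ) isT).
pose f n : R := cos (2 * pi * ((word_value b x k n)%:R / J%:R)).
(* As the cosines sum to 0, the counts may be replaced by their deviations from [N / J]. *)
have fE : \sum_(0 <= n < N) f n =
    \sum_(0 <= v < J) cos (2 * pi * (v%:R / J%:R)) * (cn v N - N%:R / J%:R).
  have -> : \sum_(0 <= v < J) cos (2 * pi * (v%:R / J%:R)) * (cn v N - N%:R / J%:R) =
     \sum_(0 <= v < J) cos (2 * pi * (v%:R / J%:R)) * cn v N.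
    under eq_bigr => v _ do rewrite mulrBr.
    by rewrite sumrB -[X in _ - X]mulr_suml sum_cos_roots// mul0r subr0.
  under [RHS]eq_bigr => v _ do rewrite mulr_sumr.
  rewrite exchange_big/=; apply: eq_bigr => n _.
  rewrite big_mkord (bigD1 (Ordinal (word_value_lt x b1 k n)))//= eqxx mulr1.
  rewrite big1 ?addr0// => v; rewrite eq_sym -val_eqE /= => /negbTE ->.
  by rewrite mulr0.
have fb : `|\sum_(0 <= n < N) f n| <= e / 3 * N%:R.
  rewrite fE; apply: le_trans (ler_norm_sum _ _ _) _.
  apply: (@le_trans _ _ (\sum_(0 <= v < J) (e / 3 / J%:R * N%:R))).
    rewrite !big_mkord; apply: ler_sum => v _; rewrite normrM.
    apply: le_trans (cs v (ltn_ord v)); rewrite -[leRHS]mul1r ler_wpM2r//.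
    by rewrite cos_max.
  rewrite sumr_const_nat subn0 -mulr_natr le_eqVlt; apply/orP; left; apply/eqP.
  by field; rewrite gt_eqF.
have df n : `|cos (2 * pi * (b%:Z ^+ n)%:~R * x) - f n| <= e / 3.
  have -> : cos (2 * pi * (b%:Z ^+ n)%:~R * x) = cos (2 * pi * shifted b x n).
    by have := cos_shifted b x 1 n; rewrite mul1r (_ : 1%:~R = 1 :> R)// mulr1.
  rewrite /f.
  have /andP[w1 w2] := word_value_itv b1 x01 k n.
  have S t : `|- sin t| <= 1 :> R by rewrite normrN sin_max.
  apply: le_trans (derive_bounded_lipschitz (fun t => is_derive_cos t) S _ _) _.
  rewrite mul1r -mulrBr normrM gtr0_norm ?mulr_gt0 ?pi_gt0//.
  apply: le_trans Je; rewrite ler_pM2l ?mulr_gt0 ?pi_gt0// -[leRHS]mul1r ler_pdivlMr//.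
  rewrite -{2}(gtr0_norm JR) -normrM mulrBl divfK ?gt_eqF// /J natrX.
  by rewrite ger0_norm ?subr_ge0// lerBlDr addrC natr1 ltW.
have -> : \sum_(0 <= n < N) cos (2 * pi * (b%:Z ^+ n)%:~R * x) = \sum_(0 <= n < N) f n +
   \sum_(0 <= n < N) (cos (2 * pi * (b%:Z ^+ n)%:~R * x) - f n).
  by rewrite -big_split; apply: eq_bigr => n _; rewrite [RHS]addrC subrK.
apply: le_trans (ler_normD _ _) _.
have : `|\sum_(0 <= n < N) (cos (2 * pi * (b%:Z ^+ n)%:~R * x) - f n)| <= e / 3 * N%:R.
  apply: le_trans (ler_norm_sum _ _ _) _.
  apply: (@le_trans _ _ (\sum_(0 <= n < N) (e / 3))); first exact: ler_sum.
  by rewrite sumr_const_nat subn0 [leRHS]mulr_natr.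
move=> gb; apply: le_trans (lerD fb gb) _.
rewrite -mulrDl ler_wpM2r//; lra.
Qed.

End WeylNecessary.

(** * Smoothing kernels *)

Section Kernel.
Variable R : realType.
Implicit Types (s : seq (R * int)) (d eta y a c : R).

Let hat : seq (R * int) := [:: (2^-1, 0); (2^-1, 1)].

Let hat_pow n := iter n (cmul hat) [:: (1, 0)].

Let cosp_hat_pow n y : cosp (hat_pow n) y = ((1 + cos (2 * pi * y)) / 2) ^+ n.
Proof.
have Z r : cosp [:: (r, 0)] y = r by rewrite cosp_seq1 mulr0 mul0r cos0 mulr1.
elim: n => [|n IH]; first by rewrite expr0 Z.
rewrite /hat_pow iterS cosp_mul -/(hat_pow n) IH exprS; congr (_ * _).
rewrite /hat cosp_cons Z cosp_seq1 (_ : 1%:~R = 1 :> R)// mulr1.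
by field.
Qed.

(** Normalised powers of [(1 + cos (2 pi y)) / 2], the de la Vallee Poussin kernel. The interval
    [[0, d/2]] gives the [n]-th power a mean of at least [q1^n d / 2], against values of at most
    [q2^n] where the condition on cosines holds, that is at distance at least [d] from the
    integers. *)
Lemma concentrated_kernel d eta : 0 < d < 2^-1 -> 0 < eta ->
  exists s, [/\ forall y, 0 <= cosp s y, fourier s 0 = 1 &
    forall y, cos (2 * pi * y) <= cos (2 * pi * d) -> cosp s y <= eta].
Proof.
move=> /andP[d0 d2] eta0; have pi0 : 0 < pi :> R := pi_gt0 R.
have dpi : 2 * pi * d < pi by move: d2; rewrite -(ltr_pM2l pi0); lra.
have dpi0 : 0 < pi * d by rewrite mulr_gt0.
pose q1 := (1 + cos (pi * d)) / 2; pose q2 := (1 + cos (2 * pi * d)) / 2.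
have q21 : q2 < q1.
  rewrite /q1 /q2 ltr_pM2r ?invr_gt0// ltrD2l ltr_cos ?in_itv/=; last 2 first.
  - by apply/andP; split; lra.
  - by apply/andP; split; lra.
  by lra.
have hat0 y : 0 <= (1 + cos y) / 2 :> R by rewrite divr_ge0//; have := cos_geN1 y; lra.
have q20 : 0 <= q2 by exact: hat0.
have q10 : 0 < q1 by exact: le_lt_trans q21.
have hat_ge0 n y : 0 <= cosp (hat_pow n) y by rewrite cosp_hat_pow exprn_ge0.
have mean n : d / 2 * q1 ^+ n <= fourier (hat_pow n) 0.
  have Z r y : cosp [:: (r, 0 : int)] y = r by rewrite cosp_seq1 mulr0 mul0r cos0 mulr1.
  have A r y : anti [:: (r, 0 : int)] y = r * y by rewrite /anti big_seq1 eqxx.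
  have h1 : d / 2 * q1 ^+ n <= anti (hat_pow n) (d / 2) - anti (hat_pow n) 0.
    have := @anti_le _ [:: (q1 ^+ n, 0)] (hat_pow n) 0 (d / 2).
    rewrite !A mulr0 subr0 => H; rewrite mulrC; apply: H; first lra.
    move=> y /andP[y0 yd]; rewrite Z cosp_hat_pow lerXn2r ?nnegrE ?hat0 ?(ltW q10)//.
    rewrite /q1 ler_wpM2r// ?invr_ge0// lerD2l.
    have yd' : 2 * pi * y <= pi * d by move: yd; rewrite -(ler_pM2l pi0); lra.
    have y0' : 0 <= 2 * pi * y by rewrite !mulr_ge0// ltW.
    have [->//|ne] := eqVneq (2 * pi * y) (pi * d).
    rewrite ltW// ltr_cos ?in_itv/=; last 2 first.
    - by apply/andP; split; lra.
    - by apply/andP; split; lra.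
    by rewrite lt_neqAle ne.
  have h2 : 0 <= anti (hat_pow n) 1 - anti (hat_pow n) (d / 2).
    have := @anti_le _ [:: (0, 0)] (hat_pow n) (d / 2) 1.
    rewrite !A !mul0r subr0; apply; first lra.
    by move=> y _; rewrite Z.
  move: h1 h2; rewrite anti0 anti1; lra.
have q0 : `|q2 / q1| < 1 by rewrite ger0_norm ?divr_ge0 ?(ltW q10)// ltr_pdivrMr ?mul1r.
have e0 : 0 < eta * (d / 2) by rewrite mulr_gt0// divr_gt0.
have /cvgrPdist_le /(_ _ e0) [n _ /(_ n (leqnn n))] := cvg_expr q0.
rewrite sub0r normrN ger0_norm ?exprn_ge0 ?divr_ge0 ?(ltW q10)// => qn.
have c0 : 0 < fourier (hat_pow n) 0.
  by apply: lt_le_trans (mean n); rewrite mulr_gt0 ?exprn_gt0// divr_gt0.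
exists (cscale (fourier (hat_pow n) 0)^-1 (hat_pow n)); split.
- by move=> y; rewrite cosp_scale mulr_ge0// invr_ge0 ltW.
- by rewrite fourier_scale mulVf// gt_eqF.
move=> y yd; rewrite cosp_scale mulrC ler_pdivrMr// cosp_hat_pow.
apply: le_trans (_ : q2 ^+ n <= _).
  rewrite lerXn2r ?nnegrE ?hat0//.
  by rewrite /q2 ler_wpM2r// ?invr_ge0// lerD2l.
apply: le_trans (ler_wpM2l (ltW eta0) (mean n)).
by move: qn; rewrite expr_div_n ler_pdivrMr ?exprn_gt0// -(mulrA eta).
Qed.

(* The difference of the two primitives is the convolution of [s] with the
   indicator function of [[a - d, c + d]]. *)
Lemma smooth_indicator s a c d eta y : 0 < d < 2^-1 ->
  0 <= eta -> fourier s 0 = 1 -> (forall y, 0 <= cosp s y) ->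
  (forall y, cos (2 * pi * y) <= cos (2 * pi * d) -> cosp s y <= eta) -> a <= c ->
  0 <= anti s (y - (a - d)) - anti s (y - (c + d)) /\
  (a <= y <= c -> 1 - eta <= anti s (y - (a - d)) - anti s (y - (c + d))).
Proof.
move=> /andP[d0 d2] eta0 s1 s0 sd ac; have pi0 : 0 < pi :> R := pi_gt0 R.
have Z r t : cosp [:: (r, 0 : int)] t = r by rewrite cosp_seq1 mulr0 mul0r cos0 mulr1.
have A r t : anti [:: (r, 0 : int)] t = r * t by rewrite /anti big_seq1 eqxx.
have mono u v : u <= v -> anti s u <= anti s v.
  move=> uv; have := @anti_le _ [:: (0, 0)] s u v uv.
  by rewrite !A !mul0r subr0 subr_ge0; apply=> t _; rewrite Z.
split; first by rewrite subr_ge0 mono//; lra.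
move=> /andP[ya yc].
have m1 : anti s d <= anti s (y - (a - d)) by apply: mono; lra.
have m2 : anti s (y - (c + d)) <= anti s (- d) by apply: mono; lra.
(* A full period has mass 1, so what [[-d, d]] misses is the mass of [[d, 1 - d]], where the kernel
   is at most [eta]. *)
have P : anti s (- d) = anti s (1 - d) - 1.
  by have := anti_period s (- d); rewrite s1 addrC => ->; ring.
have : anti s (1 - d) - anti s d <= eta.
  have := @anti_le _ s [:: (eta, 0)] d (1 - d); rewrite !A => H.
  apply: le_trans (H _ _) _; first lra; last first.
    by rewrite -mulrBr -[leRHS]mulr1 ler_wpM2l//; lra.
  move=> t /andP[t1 t2]; rewrite Z sd//.
  have key u : d <= u <= 2^-1 -> cos (2 * pi * u) <= cos (2 * pi * d).
    move=> /andP[]; rewrite le_eqVlt => /orP[/eqP->//|du] u2.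
    have u2' : 2 * pi * u <= pi by move: u2; rewrite -(ler_pM2l pi0); lra.
    have du' : 2 * pi * d < 2 * pi * u by rewrite ltr_pM2l// mulr_gt0.
    have d0' : 0 <= 2 * pi * d by rewrite !mulr_ge0// ltW.
    by rewrite ltW// ltr_cos ?in_itv//=; apply/andP; split; lra.
  have [th|th] := lerP t 2^-1; first by rewrite key ?t1.
  rewrite -(_ : cos (2 * pi * (1 - t)) = cos (2 * pi * t)).
    by rewrite key//; apply/andP; split; lra.
  have -> : 2 * pi * (1 - t) = - (2 * pi * t) + 2 * pi * 1%:~R by ring.
  by rewrite -sinDpihalf addrAC sin_2pi_int sinDpihalf cosN.
by move: m1 m2; rewrite P; lra.
Qed.

End Kernel.

(** * Small Weyl sums force normality *)

Section WeylSufficient.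
Variables (R : realType) (b : nat) (x : R).
Hypotheses (b1 : (1 < b)%N) (x01 : 0 <= x < 1).
Hypothesis weyl : forall h : int, h != 0 ->
  avg0 (fun n => cos (2 * pi * (h * b%:Z ^+ n)%:~R * x)) /\
  avg0 (fun n => sin (2 * pi * (h * b%:Z ^+ n)%:~R * x)).

Let b0 : (0 < b)%N := ltnW b1.

(** The block is compared with a smoothed indicator of its interval, enlarged by [d] on both sides.
    Its mean is [b^-k + 2 d]; the kernel and the Weyl sums cost another [d] each. *)
Lemma word_frequency_le k v e : 0 < e -> exists N0, forall N, (N0 <= N)%N ->
  (\sum_(0 <= n < N) (word_value b x k n == v))%N%:R <= (b%:R ^- k + e) * N%:R :> R.
Proof.
move=> e0; have JR : 0 < b%:R ^+ k :> R by rewrite exprn_gt0// ltr0n.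
have E1 : 0 < 1 + e by rewrite addr_gt0.
(* The total loss is [4 d]; the factor [1 / (1 + e)] keeps [d] below [1/2] for large [e]. *)
pose d := e / (1 + e) / 5.
have de : 5 * d <= e.
  rewrite /d mulrC divfK// ler_pdivrMr// -[leLHS]mulr1 ler_wpM2l ?ltW//; lra.
have d0 : 0 < d by rewrite !divr_gt0.
have d2 : d < 2^-1.
  rewrite /d ltr_pdivrMr// ltr_pdivrMr//; lra.
have [|s [s0 s1 sd]] := @concentrated_kernel R d d _ d0; first by rewrite d0.
pose a : R := v%:R / b%:R ^+ k; pose c : R := v.+1%:R / b%:R ^+ k.
have ac : a <= c by rewrite ler_pM2r ?invr_gt0// ler_nat.
have caE : c - a = b%:R ^- k by rewrite /c /a -(natr1 v); field; rewrite gt_eqF.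
pose y := shifted b x.
have W (h : int) : h != 0 -> avg0 (fun n => cos (2 * pi * h%:~R * y n)) /\
     avg0 (fun n => sin (2 * pi * h%:~R * y n)).
  move=> /weyl[Hc Hs]; split; [apply: eq_avg0 Hc|apply: eq_avg0 Hs] => n.
    exact: cos_shifted.
  exact: sin_shifted.
have [N0 HN] := avg0_increment s (a - d) (c + d) W d0.
exists N0 => N /HN; rewrite s1 mul1r sumrB.
set Q := \sum_(0 <= n < N) (_ - _).
have -> : \sum_(0 <= n < N) (c + d - (a - d)) = (b%:R ^- k + 2 * d) * N%:R.
  by rewrite sumr_const_nat subn0 mulr_natr; congr (_ *+ _); rewrite -caE; ring.
move=> /(le_trans (ler_norm _)) Qle.
pose w n : R := (word_value b x k n == v)%:R.
have D2 : 0 < d < 2^-1 by rewrite d0.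
have Qge : \sum_(0 <= n < N) (w n - d) <= Q.
  apply: ler_sum => n _.
  have [h0 h1] := smooth_indicator (y n) D2 (ltW d0) s1 s0 sd ac.
  rewrite /w; case: eqP => [vE|_]; last by apply: le_trans h0; rewrite sub0r oppr_le0 ltW.
  apply: h1; have /andP[] := word_value_itv b1 x01 k n; rewrite vE => u1 u2.
  by rewrite /a /c ler_pdivrMr// ler_pdivlMr// u1 ltW.
rewrite natr_sum -/(w _); move: Qge Qle; rewrite sumrB sumr_const_nat subn0 -[d *+ N]mulr_natr.
move=> Qge Qle; rewrite -/(\sum_(0 <= n < N) w n).
have h1 : 5 * (d * N%:R) <= e * N%:R by rewrite mulrA ler_wpM2r.
have h2 : 0 <= d * N%:R by rewrite mulr_ge0// ltW.
rewrite [(_ + 2 * d) * _]mulrDl -mulrA in Qle; rewrite mulrDl.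
move: (\sum_(0 <= n < N) w n) Qge => S; move: (b%:R ^- k * N%:R) (d * N%:R) (e * N%:R) Qle h1 h2.
move=> B D E; lra.
Qed.

(** The counts of the [b^k] words add up to [N]: if no word occurs too often, none occurs too
    rarely. *)
Lemma weyl_normal01 : normal01 b x.
Proof.
move=> k d0 k0; pose J := (b ^ k)%N.
have J0 : (0 < J)%N by rewrite expn_gt0 b0.
have JR : 0 < J%:R :> R by rewrite ltr0n.
have up (d : k.-tuple 'I_b) e : 0 < e -> exists N0, forall N, (N0 <= N)%N ->
    (occ_count x d N)%:R <= (J%:R^-1 + e) * N%:R :> R.
  move=> e0; have [[n nd]|nd] := pselect (exists n, word_digits b1 k (word_value b x k n) = d).
    have [N0 HN] := word_frequency_le k (word_value b x k n) e0.
    exists N0 => N /HN; rewrite -nd occ_count_word ?word_value_lt//.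
    by rewrite /J natrX.
  exists 0%N => N _; rewrite (occ_countE b1 x01) big1.
    by rewrite mulr_ge0// addr_ge0// ?invr_ge0 ltW.
  by move=> n _; case: eqP => // nE; case: nd; exists n.
apply/cvgrPdist_le => e e0.
(* The lower bound collects the excess of all other words, hence the division by the number [J] of
   words. *)
have e1 : 0 < e / J%:R by rewrite divr_gt0.
have [Nf HN] := choice (fun d : k.-tuple 'I_b => up d _ e1).
exists (maxn (\max_d Nf d) 1) => // N /=; rewrite geq_max => /andP[/bigmax_leqP hN N1].
have NR : 0 < N%:R :> R by rewrite ltr0n.
have U (d : k.-tuple 'I_b) : (occ_count x d N)%:R <= (J%:R^-1 + e / J%:R) * N%:R :> R.
  by apply: HN; exact: hN.
rewrite -natrX -/J.
have L : N%:R - (J%:R - 1) * ((J%:R^-1 + e / J%:R) * N%:R) <= (occ_count x d0 N)%:R :> R.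
  have := sum_occ_count b1 x01 k N; rewrite (bigD1 d0)//= => /(congr1 (fun m => m%:R : R)).
  rewrite natrD natr_sum => E; rewrite -{1}E -addrA gerDl subr_le0.
  apply: le_trans (ler_sum _ (fun d _ => U d)) _.
  rewrite sumr_const cardC1 card_tuple card_ord -/J.
  by rewrite -[leLHS]mulr_natl -subn1 natrB.
have {U} := U d0; move: (occ_count x d0 N) L => o L U.
have -> : J%:R^-1 - o%:R / N%:R = (N%:R / J%:R - o%:R) / N%:R :> R by field; rewrite !gt_eqF.
rewrite normrM normfV (gtr0_norm NR) ler_pdivrMr// ler_distlC.
have F : e / J%:R * N%:R <= e * N%:R.
  by rewrite ler_wpM2r// ler_pdivrMr// ler_peMr ?(ltW e0)// ler1n.
have F0 : 0 <= e / J%:R * N%:R by rewrite mulr_ge0// ltW.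
have E1 : (J%:R - 1) * ((J%:R^-1 + e / J%:R) * N%:R) =
   N%:R - N%:R / J%:R + e * N%:R - e / J%:R * N%:R by field; rewrite gt_eqF.
have E2 : (J%:R^-1 + e / J%:R) * N%:R = N%:R / J%:R + e / J%:R * N%:R by field; rewrite gt_eqF.
rewrite E1 in L; rewrite E2 in U; apply/andP.
move: (N%:R / J%:R) (e / J%:R * N%:R) (e * N%:R) L U F F0 => A B C L U F F0.
by split; lra.
Qed.

End WeylSufficient.

(** * Almost every point *)

Section Existence.
Variable R : realType.
Implicit Types (x : R).

Lemma bounded_sums_small (h : nat -> R) (M : R) : (forall k, 0 <= h k) ->
  (forall n, \sum_(0 <= k < n) h k <= M) -> exists K, forall k, (K <= k)%N -> h k < 1.
Proof.
move=> h0 hM; have C : cvgn (series h).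
  apply: nondecreasing_is_cvgn.
    by apply/nondecreasing_seqP => n; rewrite /series/= big_nat_recr//= lerDl.
  by exists M => _ [n _ <-]; exact: hM.
have /cvgrPdist_lt /(_ _ ltr01) [K _ HK] := cvg_series_cvg_0 C.
by exists K => k /HK; rewrite /= sub0r normrN; apply: le_lt_trans; exact: ler_norm.
Qed.

Lemma fracpart01 x : 0 <= x < 1 -> fracpart x = x.
Proof.
move=> /andP[x0 x1]; rewrite /fracpart (_ : Num.floor x = 0) ?subr0//.
by apply: floor_def; rewrite x0 add0r.
Qed.

Lemma avg0_opp_freq (b : nat) x : (forall h : nat, (0 < h)%N ->
    avg0 (fun n => cos (2 * pi * (h%:Z * b%:Z ^+ n)%:~R * x)) /\
    avg0 (fun n => sin (2 * pi * (h%:Z * b%:Z ^+ n)%:~R * x))) ->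
  forall h : int, h != 0 ->
    avg0 (fun n => cos (2 * pi * (h * b%:Z ^+ n)%:~R * x)) /\
    avg0 (fun n => sin (2 * pi * (h * b%:Z ^+ n)%:~R * x)).
Proof.
move=> H h h0; have a0 : (0 < `|h|)%N by rewrite absz_gt0.
have [Hc Hs] := H _ a0.
have [hp|hn] := leP 0 h; first by move: Hc Hs; rewrite gez0_abs.
have E n : 2 * pi * (h * b%:Z ^+ n)%:~R * x = - (2 * pi * (`|h|%N%:Z * b%:Z ^+ n)%:~R * x) :> R.
  by rewrite (ltz0_abs hn) mulNr intrN; ring.
split; first by apply: eq_avg0 Hc => n; rewrite E cosN.
by apply: eq_avg0 (avg0Z (-1) Hs) => n; rewrite E sinN mulN1r.
Qed.

Lemma biased_blocks_not_normal (q : nat) x : (1 < q)%N -> 0 <= x < 1 ->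
  (forall K, exists2 T, (K <= T)%N & T%:R / 4 <=
     \sum_(2 * T <= n < 4 * T) cos (2 * pi * (q%:Z ^+ n)%:~R * x)) ->
  ~ normal01 q x.
Proof.
move=> q1 x01 H /(normal01_avg0 q1 x01) A.
(* The sums up to [2 T] and [4 T] are then at most [T/16] and [T/8] in absolute value, so the block
   sum stays below [T/4]. *)
have e0 : 0 < 32^-1 :> R by rewrite invr_gt0.
have [N0 HN] := A _ e0.
have [T] := H N0.+1.
move=> NT; have NT2 : (N0 <= 2 * T)%N by lia.
have NT4 : (N0 <= 4 * T)%N by lia.
have := HN _ NT4; have := HN _ NT2; rewrite (@big_cat_nat _ _ _ (2 * T) 0 (4 * T))//=; last by lia.
have T0 : 0 < T%:R :> R by rewrite ltr0n; lia.
rewrite !natrM; move: (\sum_(_ <= _ < 2 * T) _) (\sum_(2 * T <= _ < _) _) => u v.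
by rewrite !ler_norml => /andP[u1 u2] /andP[v1 v2]; lra.
Qed.

(** Here an empty collection imposes no condition; the conventions are met afterwards by taking
    [bases] for the other collection. *)
Theorem rajchman_measure (B B' : set nat) :
  B `<=` bases -> B' `<=` bases -> compatible B B' ->
  exists mu : probability (measurableTypeR R) R,
    [/\ mu [set` `[0, 1[%R] = 1%E, rajchman mu &
      {ae mu, forall x : R, normal_in_all B x /\ nonnormal_in_all B' x}].
Proof.
move=> BB BB' comp.
have [P [H [HP P_cauchy Psmall Pdel [HL Hblock HW]]]] := approximants R BB BB' comp.
have P_ge0 i x : 0 <= cosp (P i) x by have [] := HP i.
have P_mean i : fourier (P i) 0 = 1 by have [] := HP i.
have P_coef i k : 0 <= fourier (P i) k by have [] := HP i.
pose mu := limit_measure P_ge0 P_mean P_cauchy.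
have mu01 : mu [set` `[0, 1[%R] = 1%E by exact: limit_measure01.
have mu_le := @limit_measure_integral_le R P P_ge0 P_mean P_cauchy.
exists mu; split => //.
- move=> e e0; have e2 : 0 < e / 2 by rewrite divr_gt0.
  have [M HM] := Psmall _ e2; exists M => n Mn.
  apply: (@le_lt_trans _ _ (e / 2)); last by lra.
  apply: (normc_fourier_coef_le mu01 P_mean mu_le) => [|i]; first exact: ltW.
  by rewrite P_coef HM.
have ae_norm : {ae mu, forall x, forall b h : nat, B b -> (0 < h)%N ->
    exists M : R, forall N, \sum_(0 <= L < N) cosp (weyl_list R b h%:Z L) x <= M}.
  apply: ae_foralln => b; apply: ae_foralln => h.
  have [Bb|nBb] := pselect (B b); last by apply: aeW => x /nBb.
  have [h0|h0] := ltnP 0 h; last by apply: aeW => x _; lia.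
  have [C HC] := Pdel b h Bb h0.
  apply: (@filterS _ _ (ae_filter_ringOfSetsType mu)) (ae_weyl_bounded mu01 mu_le HC).
  by move=> x Hx _ _.
have ae_sum : {ae mu, forall x : R, exists M : R, forall n, \sum_(0 <= k < n) H k x <= M}.
  apply: (ae_bounded_sums mu01 (C := 2)).
  - by move=> k x; have [_] := HL k.
  - by move=> k; have [] := HL k.
  move=> n; apply: (integral_le_mean mu_le).
  - by move=> x; apply: sumr_ge0 => k _; have [_] := HL k.
  - by apply: lipschitz_fun_sum => k; have [] := HL k.
  by exists n => i /HW.
have ae_unit := ae_unit_interval mu01.
apply: (@filterS2 _ _ (ae_filter_ringOfSetsType mu) _ _ _ _ ae_norm
  (@filterS2 _ _ (ae_filter_ringOfSetsType mu) _ _ _ (fun x p q => conj p q) ae_sum ae_unit)).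
move=> x Hnorm [[M HM] x01]; split=> [b Bb|q Bq]; rewrite /normal fracpart01//.
  have b1 := BB _ Bb; apply: weyl_normal01 => //.
  apply: avg0_opp_freq => h h0; have [C HC] := Hnorm b h Bb h0.
  have bound (f g : nat -> R) : (forall N, \sum_(0 <= L < N)
      ((\sum_(0 <= n < L) f n) ^+ 2 + (\sum_(0 <= n < L) g n) ^+ 2) / L%:R ^+ 3 <= C) ->
      (forall n, `|f n| <= 1) -> avg0 f.
    move=> HN f1; apply: (slow_sums (M := C)) => // N; apply: le_trans (HN N).
    apply: ler_sum => L _; rewrite ler_wpM2r ?invr_ge0 ?exprn_ge0//.
    by rewrite lerDl sqr_ge0.
  split.
  - apply: bound (fun n => sin (2 * pi * (h%:Z * b%:Z ^+ n)%:~R * x)) _ _.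
      by move=> N; under eq_bigr => L _ do rewrite -cosp_weyl_list.
    by move=> n; rewrite ler_norml cos_geN1 cos_le1.
  - apply: bound (fun n => cos (2 * pi * (h%:Z * b%:Z ^+ n)%:~R * x)) _ _.
      by move=> N; under eq_bigr => L _ do rewrite addrC -cosp_weyl_list.
    by move=> n; rewrite ler_norml sin_geN1 sin_le1.
apply: biased_blocks_not_normal => //; first exact: BB'.
(* The tests have bounded sums at [x], so they end up below the threshold 1, in particular at the
   late stages devoted to [q]. *)
move=> K; have [K0 HK0] := bounded_sums_small (fun k => (HL k).2 x) HM.
have [i iK Hi] := Hblock q Bq (maxn K K0).
have [|T iT HT] := Hi x; first by apply: HK0; lia.
by exists T => //; lia.
Qed.

End Existence.

Theorem theorem1p2 (R : realType) :
  (forall B B' : set nat,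
     B `<=` bases -> B' `<=` bases -> B `|` B' !=set0 -> compatible B B' ->
     exists mu : probability (measurableTypeR R) R,
       [/\ mu [set` `[0, 1[%R] = 1%E, rajchman mu
         & {ae mu, forall x : R, normal_set R B B' x}])
  /\ (exists mu : probability (measurableTypeR R) R,
       [/\ mu [set` `[0, 1[%R] = 1%E, rajchman mu
         & {ae mu, forall x : R, normal_set R set0 bases x}]).
Proof.
have sub0 : set0 `<=` bases by [].
have subT : bases `<=` bases by [].
have comp0l : compatible set0 bases by [].
have comp0r : compatible bases set0 by [].
split=> [B B' BB BB' BB'0 comp|]; last first.
  have [mu [mu1 mu2 mu3]] := rajchman_measure R sub0 subT comp0l.
  exists mu; split=> //; apply: (@filterS _ _ (ae_filter_ringOfSetsType mu)) mu3 => x [_ Hx].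
  by rewrite normal_set_absolutely_non_normal.
have [B0|B0] := eqVneq B set0.
  (* By convention both conditions are now non-normality, and [B'] lies in [bases]: absolutely
     non-normal numbers suffice. *)
  have [mu [mu1 mu2 mu3]] := rajchman_measure R sub0 subT comp0l.
  exists mu; split=> //; apply: (@filterS _ _ (ae_filter_ringOfSetsType mu)) mu3 => x [_ Hx].
  have B'0 : B' != set0 by apply/eqP => B'0; move: BB'0; rewrite B0 B'0 setU0 => -[].
  rewrite /normal_set /normalL /normalR B0 eqxx (negbTE B'0).
  by split=> // b /BB' /Hx.
have [B'0|B'0] := eqVneq B' set0.
  (* Symmetrically, both conditions are normality, and numbers normal in every base suffice. *)
  have [mu [mu1 mu2 mu3]] := rajchman_measure R subT sub0 comp0r.
  exists mu; split=> //; apply: (@filterS _ _ (ae_filter_ringOfSetsType mu)) mu3 => x [Hx _].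
  rewrite /normal_set /normalL /normalR B'0 eqxx (negbTE B0).
  by split=> // b /BB /Hx.
have [mu [mu1 mu2 mu3]] := rajchman_measure R BB BB' comp.
exists mu; split=> //; apply: (@filterS _ _ (ae_filter_ringOfSetsType mu)) mu3 => x [Hx Hx'].
by rewrite /normal_set /normalL /normalR (negbTE B0) (negbTE B'0).
Qed.
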